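(* Let $d\ge1$ and $\varphi\in L^2(\mathbb{R}^d)\cap L^1(\mathbb{R}^d)$. For $(p,\ell)\in\Lambda$ set $\Phi^\mu_{p;\ell}(\omega)=\sum_{\eta\in\mu I^\ell_p}\hat\varphi(\omega-\eta)$. Suppose that $\mu>0$ is chosen so that $$a\le\sum_{(p,\ell)\in\Lambda}|\Phi^\mu_{p;\ell}(\omega)|^2\le b\qquad\text{for all }\omega\in\mathbb{R}^d,$$ for suitable constants $a,b>0$. Moreover, assume that $$|\hat\varphi(\omega)|\le\frac{C_N}{(1+|\omega|)^N}\qquad(\omega\in\mathbb{R}^d),$$ for some $N>2d$ (and some constant $C_N>0$). Then there exist $A,B>0$ and $\nu_0>0$ such that for all $f\in L^2(\mathbb{R}^d)$ $$A\|f\|_2^2\le|\langle S^{\mu,\nu}_{\varphi,\varphi}f,f\rangle|\le B\|f\|_2^2\qquad\text{for some } 0<\nu<\nu_0 .$$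
   Context: Fourier transform: $\hat f(\omega)=\int_{\mathbb{R}^d} e^{-2\pi \mathrm{i} x\omega}f(x)\,dx$ (with $x\omega$ the inner product of $\mathbb{R}^d$). Let $\beta(0)=1$ and $\beta(p)=2^{p-1}$ for $p\ge1$. Phase space partition: for $p=0$ there is a single box $C_0=[-1,1]^d$. For $p\ge1$ the boxes are $X_{p,\ell}=\prod_{s=1}^d[\beta(p)\ell_s,\beta(p)(\ell_s+1))$, with $\ell\in J$, where $J$ is the set of multi-indices $\ell=(\ell_1,\ldots,\ell_d)\in\{-2,-1,0,1\}^d$ such that $\max_s|\ell_s+\tfrac12|>1$ (there are $2^d(2^d-1)$ of them). Set $I^\ell_p=X_{p,\ell}\cap\mathbb{Z}^d$ for $p\ge1$, $\ell\in J$, and, for $p=0$, with a single dummy index $\ell=*$, $I^*_0=C_0\cap\mathbb{Z}^d$. The index set is $\Lambda=\{(0,* )\}\cup\{(p,\ell):p\ge1,\ \ell\in J\}$. For $\mu>0$, $\mu I^\ell_p=\{\mu m:m\in I^\ell_p\}$. For $\nu>0$ and $\gamma=(p,k,\ell)$ with $(p,\ell)\in\Lambda$, $k\in\mathbb{Z}^d$, set $$\varphi_\gamma(x)=\beta(p)^{-d/2}\sum_{\eta\in\mu I^\ell_p}e^{2\pi \mathrm{i}\,\eta\left(x-k\frac{\nu}{\beta(p)}\right)}\varphi\left(x-k\frac{\nu}{\beta(p)}\right).$$ The frame operator is $S^{\mu,\nu}_{\varphi,\varphi}f=\sum_\gamma\langle f,\varphi_\gamma\rangle\varphi_\gamma$,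 so that $\langle S^{\mu,\nu}_{\varphi,\varphi}f,f\rangle=\sum_\gamma|\langle f,\varphi_\gamma\rangle|^2$; for a given $\nu$, the asserted inequality for all $f$ says that $\{\varphi_\gamma\}_\gamma$ is a frame of $L^2(\mathbb{R}^d)$. *)

(* Defs.v *)
From HB Require Import structures.
From mathcomp Require Import all_boot all_order all_algebra finmap.
From mathcomp Require Import all_classical all_reals all_analysis.
From mathcomp Require Import complex.

Set Implicit Arguments.
Unset Strict Implicit.
Unset Printing Implicit Defensive.

Import Order.TTheory GRing.Theory Num.Theory.
Import numFieldNormedType.Exports.
Import ComplexField.Normc.

Local Open Scope classical_set_scope.
Local Open Scope ring_scope.

Section measurable_rV.
Context (R : realType) (n : nat).

Definition rV_coord (i : 'I_n) (x : 'rV[R]_n) : measurableTypeR R := x ord0 i.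

Let rV_set0 : g_sigma_preimage rV_coord set0.
Proof. exact: sigma_algebra0. Qed.

Let rV_setC A : g_sigma_preimage rV_coord A -> g_sigma_preimage rV_coord (~` A).
Proof. exact: sigma_algebraC. Qed.

Let rV_bigcup (F : _^nat) : (forall i, g_sigma_preimage rV_coord (F i)) ->
  g_sigma_preimage rV_coord (\bigcup_i (F i)).
Proof. exact: sigma_algebra_bigcup. Qed.

HB.instance Definition _ := @isMeasurable.Build default_measure_display
  'rV[R]_n (g_sigma_preimage rV_coord) rV_set0 rV_setC rV_bigcup.

Lemma measurable_rV_coord i : measurable_fun [set: 'rV[R]_n] (rV_coord i).
Proof.
move=> _ Y mY; rewrite setTI; apply: sub_sigma_algebra => /=.
rewrite -bigcup_seq/=; exists i => /=; first by rewrite mem_index_enum.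
by exists Y => //; rewrite setTI.
Qed.

Lemma measurable_fun_rV d (T : measurableType d) (f : T -> 'rV[R]_n) :
  (forall i, measurable_fun [set: T] (rV_coord i \o f)) ->
  measurable_fun [set: T] f.
Proof.
move=> mf _ A mA; rewrite setTI.
suff : g_sigma_preimage (fun i => rV_coord i \o f) `<=` measurable.
  apply; rewrite g_sigma_preimage_comp.
  by exists A => //; rewrite setTI.
apply: smallest_sub; first exact: sigma_algebra_measurable.
rewrite -bigcup_seq => B [i _ [C mC <-]].
exact: mf.
Qed.

End measurable_rV.

Section lebesgue_measure_rV.
Context {R : realType}.

Definition rV_cons (n : nat) (p : measurableTypeR R * 'rV[R]_n) : 'rV[R]_n.+1 :=
  row_mx (const_mx p.1) p.2 : 'rV[R]_(1 + n).

Lemma rV_cons0 n p : @rV_cons n p ord0 ord0 = p.1.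
Proof.
have -> : ord0 = lshift n (ord0 : 'I_1) :> 'I_n.+1 by exact: val_inj.
by apply: etrans (row_mxEl _ _ _ _) _; rewrite mxE.
Qed.

Lemma rV_consS n p i : @rV_cons n p ord0 (lift ord0 i) = p.2 ord0 i.
Proof.
have -> : lift ord0 i = rshift 1 i :> 'I_n.+1 by exact: val_inj.
exact: row_mxEr.
Qed.

Lemma measurable_rV_cons n :
  measurable_fun [set: measurableTypeR R * 'rV[R]_n] (@rV_cons n).
Proof.
apply: measurable_fun_rV => i; case: (unliftP ord0 i) => [j|] ->.
  rewrite (_ : _ \o _ = rV_coord j \o snd).
    by apply: measurableT_comp; [exact: measurable_rV_coord|].
  by apply/funext => p; exact: rV_consS.
rewrite (_ : _ \o _ = fst); first exact: measurable_fst.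
by apply/funext => p; exact: rV_cons0.
Qed.

Definition rV_uncons n (x : 'rV[R]_n.+1) : measurableTypeR R * 'rV[R]_n :=
  (rV_coord ord0 x, rsubmx (x : 'rV[R]_(1 + n))).

Lemma measurable_rV_uncons n :
  measurable_fun [set: 'rV[R]_n.+1] (@rV_uncons n).
Proof.
apply/measurable_fun_pairP; split; first exact: measurable_rV_coord.
apply: measurable_fun_rV => i.
rewrite (_ : _ \o _ = rV_coord (rshift 1 i : 'I_n.+1)).
  exact: measurable_rV_coord.
by apply/funext => x; rewrite /rV_coord /= mxE.
Qed.

Lemma rV_consK n : cancel (@rV_cons n) (@rV_uncons n).
Proof.
move=> [a y]; congr pair; [exact: rV_cons0|exact: row_mxKr].
Qed.

Section step.
Local Open Scope ereal_scope.
Context (n : nat) (mu : {sigma_finite_measure set 'rV[R]_n -> \bar R}).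

Definition cons_measure_rV : set 'rV[R]_n.+1 -> \bar R :=
  pushforward (lebesgue_measure \x mu) (@rV_cons n).

Let cons0 : cons_measure_rV set0 = 0.
Proof. by rewrite /cons_measure_rV /pushforward preimage_set0 measure0. Qed.

Let cons_ge0 A : 0 <= cons_measure_rV A.
Proof. exact: (measure_ge0 (lebesgue_measure \x mu)). Qed.

Let cons_sigma_additive : semi_sigma_additive cons_measure_rV.
Proof.
move=> F mF tF mUF; rewrite /cons_measure_rV /pushforward preimage_bigcup.
have mcons A : measurable A -> measurable (@rV_cons n @^-1` A).
  by move=> mA; rewrite -[X in measurable X]setTI; exact: measurable_rV_cons.
apply: measure_semi_sigma_additive.
- by move=> k; exact: mcons.
- apply/trivIsetP => i j _ _ ij; rewrite -preimage_setI.
  by move/trivIsetP : tF => /(_ _ _ _ _ ij) ->//; rewrite preimage_set0.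
- by rewrite -preimage_bigcup; exact: mcons.
Qed.

HB.instance Definition _ := isMeasure.Build _ _ _ cons_measure_rV
  cons0 cons_ge0 cons_sigma_additive.

Let cons_sigma_finite : sigma_finite [set: 'rV[R]_n.+1] cons_measure_rV.
Proof.
have /sigma_finiteP[F [TF ndF Foo]] := sigma_finiteT (@lebesgue_measure R).
have /sigma_finiteP[G [TG ndG Goo]] := sigma_finiteT mu.
exists (fun k => @rV_uncons n @^-1` (F k `*` G k)).
  rewrite -preimage_bigcup (_ : \bigcup_k _ = setT) ?preimage_setT//.
  rewrite -subTset -setXTT TF TG => -[x y] [/= [i _ Fx] [j _ Gy]].
  exists (maxn i j) => //; split.
  - by move: x Fx; exact/subsetPset/ndF/leq_maxl.
  - by move: y Gy; exact/subsetPset/ndG/leq_maxr.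
move=> k; have [mF Fk] := Foo k; have [mG Gk] := Goo k; split.
  rewrite -[X in measurable X]setTI; apply: measurable_rV_uncons => //.
  exact: measurableX.
rewrite /cons_measure_rV /pushforward -comp_preimage.
rewrite (_ : _ \o _ = id); last by apply/funext => p; exact: rV_consK.
by rewrite preimage_id product_measure1E// lte_mul_pinfty// ge0_fin_numE.
Qed.

HB.instance Definition _ := Measure_isSigmaFinite.Build _ _ _ cons_measure_rV
  cons_sigma_finite.

End step.

Fixpoint lebesgue_measure_rV (n : nat) :
    {sigma_finite_measure set 'rV[R]_n -> \bar R} :=
  match n with
  | 0 => \d_(0 : 'rV[R]_0)
  | n.+1 => cons_measure_rV (lebesgue_measure_rV n)
  end.

Lemma lebesgue_measure_rV_box n (A : 'I_n -> set (measurableTypeR R)) :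
  (forall i, measurable (A i)) ->
  lebesgue_measure_rV n [set x | forall i, A i (x ord0 i)] =
  (\prod_(i < n) lebesgue_measure (A i))%E.
Proof.
elim: n A => [|n IHn] A mA.
  by rewrite big_ord0 /= diracE mem_set// => -[].
rewrite big_ord_recl -IHn; last by move=> i; exact: mA.
rewrite /= /cons_measure_rV /pushforward -product_measure1E//; last first.
  rewrite [X in _ X](_ : _ = \bigcap_(i in [set: 'I_n])
      rV_coord i @^-1` A (lift ord0 i)).
    apply: fin_bigcap_measurable => // i _.
    by rewrite -[X in measurable X]setTI; exact: measurable_rV_coord.
  by apply/seteqP; split=> x /= xA i; [move=> _|]; exact: xA.
congr (_ _); apply/seteqP; split=> -[t y] /= H.
- split=> [|i]; first by have := H ord0; rewrite rV_cons0.
  by have := H (lift ord0 i); rewrite rV_consS.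
- by move=> i; case: (unliftP ord0 i) => [j|] ->;
    rewrite ?rV_consS ?rV_cons0; [exact: H.2|exact: H.1].
Qed.

End lebesgue_measure_rV.

Section fourier.
Local Open Scope complex_scope.
Context {R : realType} {d : nat}.
Local Notation vec := 'rV[R]_d.
Local Notation leb := (@lebesgue_measure_rV R d).
Implicit Types (f g : vec -> R[i]) (x w : vec).

Definition dot x w : R := \sum_(s < d) x ord0 s * w ord0 s.

Definition enorm x : R := Num.sqrt (dot x x).

Definition cis (t : R) : R[i] := cos t +i* sin t.

Definition cmeasurable f :=
  measurable_fun [set: vec] (fun x => complex.Re (f x)) /\
  measurable_fun [set: vec] (fun x => complex.Im (f x)).

Definition cLnorm (p : \bar R) f : \bar R :=
  Lnorm leb p (fun x => (normc (f x))%:E).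

(* Elements of L^p are represented by Borel functions, not by classes modulo
   equality almost everywhere. *)
Definition cLp (p : \bar R) : set (vec -> R[i]) :=
  [set f | cmeasurable f /\ (cLnorm p f < +oo)%E].

Definition cintegral f : R[i] :=
  (\int[leb]_x complex.Re (f x)) +i* (\int[leb]_x complex.Im (f x)).

Definition inner f g : R[i] := cintegral (fun x => f x * (g x)^*).

Definition fourier f w : R[i] :=
  cintegral (fun x => cis (- (2 * pi * dot x w)) * f x).

End fourier.

Definition beta (p : nat) : nat := if p is q.+1 then (2 ^ q)%N else 1%N.

Definition J (d : nat) : set 'rV[int]_d :=
  [set l | (forall s, -2 <= l ord0 s <= 1) /\
           1 < \big[Num.max/0]_(s < d) `|(l ord0 s)%:~R + 2^-1 : rat| ].

(* The second component is None for the dummy index *. *)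
Definition Lambda (d : nat) : set (nat * option 'rV[int]_d) :=
  [set pl | match pl with
            | (0, None) => True
            | (p.+1, Some l) => J l
            | _ => False
            end].

Section phase_space.
Local Open Scope complex_scope.
Context {R : realType} {d : nat}.
Local Notation vec := 'rV[R]_d.
Local Notation zvec := 'rV[int]_d.

Definition vec_of_int (m : zvec) : vec := map_mx intr m.

Definition box (p : nat) (l : option zvec) : set vec :=
  match l with
  | None => [set x | forall s, -1 <= x ord0 s <= 1]
  | Some l => [set x | forall s,
      (beta p)%:R * (l ord0 s)%:~R <= x ord0 s
        < (beta p)%:R * ((l ord0 s)%:~R + 1)]
  end.

Definition boxZ (p : nat) (l : option zvec) : set zvec :=
  [set m | box p l (vec_of_int m)].

Definition scaled_boxZ (mu : R) (p : nat) (l : option zvec) : set vec :=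
  [set mu *: vec_of_int m | m in boxZ p l].

(* Boxes are bounded, so the sums over scaled_boxZ here and in atom are finite
   sums. *)
Definition Phi (phi : vec -> R[i]) (mu : R) (p : nat) (l : option zvec)
    (w : vec) : R[i] :=
  \sum_(eta \in scaled_boxZ mu p l) fourier phi (w - eta).

Definition frame_index := (nat * zvec * option zvec)%type.

Definition Gamma : set frame_index := [set g | Lambda (g.1.1, g.2)].

Definition atom (phi : vec -> R[i]) (mu nu : R) (g : frame_index)
    (x : vec) : R[i] :=
  let: (p, k, l) := g in
  let y := x - (nu / (beta p)%:R) *: vec_of_int k in
  ((beta p)%:R `^ (- (d%:R / 2)))%:C *
  \sum_(eta \in scaled_boxZ mu p l) cis (2 * pi * dot eta y) * phi y.

(* The series of the <f, phi_g> phi_g, g in Gamma, converges unconditionally in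
   L^2, and Sf is its sum. *)
Definition is_frame_operator (phi : vec -> R[i]) (mu nu : R)
    (f Sf : vec -> R[i]) : Prop :=
  cLp 2%:E Sf /\
  forall e : R, 0 < e ->
  exists F0 : {fset frame_index}, [set` F0] `<=` Gamma /\
  forall F : {fset frame_index}, (F0 `<=` F)%fset -> [set` F] `<=` Gamma ->
  (cLnorm 2%:E (fun x => Sf x -
     \sum_(g <- F) inner f (atom phi mu nu g) * atom phi mu nu g x)%R <= e%:E)%E.

End phase_space.

(* Main.v *)
(* For [h] bounded with compact support, the inner product of the inverse Fourier
   transform of [h] with an atom of index [(p, k, l)] is a sample, at a point of the
   lattice of step [nu / beta p], of the inverse transform of [h * Phi^*].  Averaging
   these samples against a product of Fejer kernels expresses their sum of squares
   through the autocorrelation of [h * Phi^*]: the value at 0 is the main term, and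
   the values at distance at least [beta p / (2 * nu)] are small by the decay of the
   Fourier transform of [phi], with errors that are summable over the boxes and of
   total size [O(nu)] relative to the main term.  The bounds on the sum of the
   [|Phi|^2] give the frame inequality on such inverse transforms.  The same sampling
   estimate, with no error term for a fine lattice, yields Plancherel's formula, hence
   their density in [L^2]; the frame operator then exists by duality and
   completeness. *)
Require Import Defs.
From mathcomp Require Import all_boot all_order all_algebra.
From mathcomp Require Import all_classical all_reals all_analysis.
From mathcomp Require Import complex finmap.
From mathcomp Require Import measurable_realfun.
From mathcomp Require Import ring lra zify.

Set Implicit Arguments.
Unset Strict Implicit.
Unset Printing Implicit Defensive.

Import Order.TTheory GRing.Theory Num.Theory.
Import numFieldNormedType.Exports.
Import ComplexField.Normc.

Local Open Scope classical_set_scope.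
Local Open Scope ring_scope.

(** The sampled functions are inverse transforms of [h * Phi^*], which is merely bounded, measurable
    and compactly supported, so Poisson summation has no pointwise meaning here. Averaging over
    differences of grid points asks much less: continuity of the autocorrelation at 0 and its
    smallness away from the central cell. The continuity comes from translation continuity of Borel
    sets, proved by a sigma-algebra argument. Why the exponent [2 * d]: a box has about [beta p ^ d]
    frequencies, a factor that the normalization of the atoms cancels, and the power [-2d] of the
    distance splits into one inverse square per coordinate, which has finite mass against the Fejer
    kernel. With [L = beta p / nu] the error of a box is then of order
    [L ^- (2d) * L ^ d = (nu / beta p) ^ d], summable over [p] and small with [nu]. Norms are
    handled squared, with [2x^2 + 2y^2] in place of the triangle inequality; this is the origin of
    the factors 4 between the bounds on inverse transforms and the final frame bounds. *)

Section complex_algebra.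
Context {R : realType}.
Implicit Types x y z : R[i].

(** * Real and imaginary parts, modulus, and unit characters *)

Lemma ReD x y : complex.Re (x + y) = complex.Re x + complex.Re y.
Proof. by case: x; case: y. Qed.

Lemma ImD x y : complex.Im (x + y) = complex.Im x + complex.Im y.
Proof. by case: x; case: y. Qed.

Lemma ReN x : complex.Re (- x) = - complex.Re x.
Proof. by case: x. Qed.

Lemma ImN x : complex.Im (- x) = - complex.Im x.
Proof. by case: x. Qed.

Lemma ReM x y :
  complex.Re (x * y) = complex.Re x * complex.Re y - complex.Im x * complex.Im y.
Proof. by case: x; case: y. Qed.

Lemma ImM x y :
  complex.Im (x * y) = complex.Re x * complex.Im y + complex.Im x * complex.Re y.
Proof. by case: x; case: y. Qed.

Lemma ReJ x : complex.Re (x^*)%R = complex.Re x.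
Proof. by case: x. Qed.

Lemma ImJ x : complex.Im (x^*)%R = - complex.Im x.
Proof. by case: x. Qed.

Lemma Re_sum I (s : seq I) (P : pred I) (F : I -> R[i]) :
  complex.Re (\sum_(i <- s | P i) F i) = \sum_(i <- s | P i) complex.Re (F i).
Proof. by apply: (big_morph (@complex.Re R)) => // x y; rewrite ReD. Qed.

Lemma complex_ext x y : complex.Re x = complex.Re y ->
  complex.Im x = complex.Im y -> x = y.
Proof. by case: x => a b; case: y => a' b' /= -> ->. Qed.

Lemma sqr_normc x : normc x ^+ 2 = complex.Re x ^+ 2 + complex.Im x ^+ 2.
Proof. by case: x => a b /=; rewrite sqr_sqrtr// addr_ge0// sqr_ge0. Qed.

Lemma normc_ge0 x : 0 <= normc x.
Proof. by case: x => a b /=; exact: sqrtr_ge0. Qed.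

Lemma normcJ x : normc (x^*)%R = normc x.
Proof. by case: x => a b /=; rewrite sqrrN. Qed.

Lemma mulcJ x : x * (x^*)%R = real_complex R (normc x ^+ 2).
Proof.
rewrite sqr_normc; apply: complex_ext.
  by rewrite ReM ReJ ImJ /= mulrN opprK !expr2.
by rewrite ImM ReJ ImJ /=; ring.
Qed.

Lemma normr_Re_le x : `|complex.Re x| <= normc x.
Proof.
rewrite -(@ler_pXn2r _ 2%N)// ?nnegrE ?normc_ge0//.
by rewrite sqr_normc real_normK ?num_real// lerDl sqr_ge0.
Qed.

Lemma normr_Im_le x : `|complex.Im x| <= normc x.
Proof.
rewrite -(@ler_pXn2r _ 2%N)// ?nnegrE ?normc_ge0//.
by rewrite sqr_normc real_normK ?num_real// lerDr sqr_ge0.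
Qed.

Lemma normc_le_ReIm x : normc x <= `|complex.Re x| + `|complex.Im x|.
Proof.
rewrite -(@ler_pXn2r _ 2%N)// ?nnegrE ?normc_ge0 ?addr_ge0//.
rewrite sqr_normc sqrrD !real_normK ?num_real//.
have : 0 <= `|complex.Re x| * `|complex.Im x| by rewrite mulr_ge0.
lra.
Qed.

Lemma normc_real (r : R) : normc (real_complex R r) = `|r|.
Proof. by rewrite /= expr0n/= addr0 sqrtr_sqr. Qed.

Lemma normcX x n : normc (x ^+ n) = normc x ^+ n.
Proof.
elim: n => [|n IH]; first by rewrite !expr0 -[RHS]normc1.
by rewrite !exprS normcM IH.
Qed.

Lemma sqr_normcD x y :
  normc (x + y) ^+ 2 <= 2 * normc x ^+ 2 + 2 * normc y ^+ 2.
Proof.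
have h : normc (x + y) ^+ 2 <= (normc x + normc y) ^+ 2.
  by rewrite lerXn2r ?nnegrE ?addr_ge0 ?normc_ge0// le_normcD.
apply: (le_trans h).
have := sqr_ge0 (normc x - normc y).
nra.
Qed.

Lemma normc_sum_le I (s : seq I) (P : pred I) (F : I -> R[i]) :
  normc (\sum_(i <- s | P i) F i) <= \sum_(i <- s | P i) normc (F i).
Proof.
elim/big_ind2 : _ => [||//]; first by rewrite normc0.
by move=> x1 x2 y1 y2 h1 h2; exact: le_trans (le_normcD _ _) (lerD _ _).
Qed.

Lemma cisD (s t : R) : cis (s + t) = cis s * cis t.
Proof.
apply: complex_ext; first by rewrite ReM /= cosD.
by rewrite ImM /= sinD [in RHS]addrC.
Qed.

Lemma cis0 : cis (0 : R) = 1.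
Proof. by rewrite /cis cos0 sin0. Qed.

Lemma cisN (t : R) : cis (- t) = ((cis t)^*)%R.
Proof. by apply: complex_ext; rewrite ?ReJ ?ImJ /= ?cosN ?sinN. Qed.

Lemma normc_cis (t : R) : normc (cis t) = 1.
Proof. by rewrite /= cos2Dsin2 sqrtr1. Qed.

End complex_algebra.

(** * Measurability of complex-valued functions *)

Section complex_measurable.
Context d (T : measurableType d) {R : realType}.
Implicit Types f g : T -> R[i].

(** The conditions of [cmeasurable] over an arbitrary measurable space, so that functions on
    products of spaces of rows are covered as well. *)
Definition cmeas f :=
  measurable_fun [set: T] (fun x => complex.Re (f x)) /\
  measurable_fun [set: T] (fun x => complex.Im (f x)).

Lemma cmeasD f g : cmeas f -> cmeas g -> cmeas (fun x => f x + g x).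
Proof.
move=> [f1 f2] [g1 g2]; split.
  by under eq_fun do rewrite ReD; exact: measurable_funD.
by under eq_fun do rewrite ImD; exact: measurable_funD.
Qed.

Lemma cmeasN f : cmeas f -> cmeas (fun x => - f x).
Proof.
move=> [f1 f2]; split.
  by under eq_fun do rewrite ReN; exact: measurableT_comp.
by under eq_fun do rewrite ImN; exact: measurableT_comp.
Qed.

Lemma cmeasB f g : cmeas f -> cmeas g -> cmeas (fun x => f x - g x).
Proof. by move=> mf mg; apply: cmeasD => //; exact: cmeasN. Qed.

Lemma cmeasM f g : cmeas f -> cmeas g -> cmeas (fun x => f x * g x).
Proof.
move=> [f1 f2] [g1 g2]; split.
  under eq_fun do rewrite ReM.
  by apply: measurable_funB; exact: measurable_funM.
under eq_fun do rewrite ImM.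
by apply: measurable_funD; exact: measurable_funM.
Qed.

Lemma cmeasJ f : cmeas f -> cmeas (fun x => ((f x)^*)%R).
Proof.
move=> [f1 f2]; split; first by under eq_fun do rewrite ReJ.
by under eq_fun do rewrite ImJ; exact: measurableT_comp.
Qed.

Lemma cmeas_cst (z : R[i]) : cmeas (fun=> z).
Proof. by split; exact: measurable_cst. Qed.

Lemma cmeas_cis (u : T -> R) : measurable_fun setT u -> cmeas (fun x => cis (u x)).
Proof.
move=> mu; split => /=; apply: measurableT_comp => //.
- by apply: continuous_measurable_fun; exact: continuous_cos.
- by apply: continuous_measurable_fun; exact: continuous_sin.
Qed.

Lemma cmeas_real (u : T -> R) :
  measurable_fun setT u -> cmeas (fun x => real_complex R (u x)).
Proof. by move=> mu; split => //=; exact: measurable_cst. Qed.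

Lemma cmeas_indic (A : set T) : measurable A ->
  cmeas (fun x => real_complex R (\1_A x)).
Proof. by move=> mA; apply: cmeas_real; exact: measurable_indic. Qed.

Lemma measurable_normc2 f : cmeas f ->
  measurable_fun setT (fun x => normc (f x) ^+ 2).
Proof.
move=> [f1 f2]; under eq_fun do rewrite sqr_normc.
by apply: measurable_funD; exact: measurable_funX.
Qed.

Lemma measurable_normc f : cmeas f ->
  measurable_fun setT (fun x => normc (f x)).
Proof.
move=> mf; have -> : (fun x => normc (f x)) =
    (fun x => Num.sqrt (normc (f x) ^+ 2)).
  by apply/funext => x; rewrite sqrtr_sqr ger0_norm// normc_ge0.
apply: measurableT_comp (measurable_normc2 mf) => //.
by apply: continuous_measurable_fun; exact: sqrt_continuous.
Qed.

End complex_measurable.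

Lemma cmeas_comp d1 d2 (T1 : measurableType d1) (T2 : measurableType d2)
    (R : realType) (f : T2 -> R[i]) (h : T1 -> T2) :
  cmeas f -> measurable_fun setT h -> cmeas (fun x => f (h x)).
Proof. by move=> [f1 f2] mh; split; [exact: (measurableT_comp f1 mh)|exact: (measurableT_comp f2 mh)]. Qed.

(** * Integrals of complex-valued functions *)

Section complex_integral.
Context d (T : measurableType d) {R : realType} (m : {measure set T -> \bar R}).
Implicit Types f g : T -> R[i].

(** For the measure on rows this is convertible to [cintegral], so what follows applies to [inner]
    and [fourier] without translation. *)
Definition cint f : R[i] :=
  Complex (\int[m]_x complex.Re (f x)) (\int[m]_x complex.Im (f x)).

Definition cintble f :=
  cmeas f /\ (\int[m]_x (normc (f x))%:E < +oo)%E.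

Lemma cintble_le f (g : T -> R) : cmeas f -> measurable_fun setT g ->
  (forall x, normc (f x) <= g x) -> (\int[m]_x (g x)%:E < +oo)%E -> cintble f.
Proof.
move=> mf mg fg goo; split => //; apply: le_lt_trans goo.
apply: ge0_le_integral => //.
- by move=> x _; rewrite lee_fin normc_ge0.
- by apply/measurable_EFinP; exact: measurable_normc.
- exact/measurable_EFinP.
- by move=> x _; rewrite lee_fin.
Qed.

Lemma cintble_norm_integrable f :
  cintble f -> m.-integrable setT (EFin \o (fun x => normc (f x))).
Proof.
move=> [mf foo]; apply/integrableP; split.
  by apply/measurable_EFinP; exact: measurable_normc.
by under eq_integral do rewrite /= ger0_norm ?normc_ge0//.
Qed.

Lemma cintble_Re f :
  cintble f -> m.-integrable setT (EFin \o (fun x => complex.Re (f x))).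
Proof.
move=> fi; apply: le_integrable (cintble_norm_integrable fi) => //.
  by apply/measurable_EFinP; exact: fi.1.1.
move=> x _ /=; rewrite lee_fin (ger0_norm (normc_ge0 _)); exact: normr_Re_le.
Qed.

Lemma cintble_Im f :
  cintble f -> m.-integrable setT (EFin \o (fun x => complex.Im (f x))).
Proof.
move=> fi; apply: le_integrable (cintble_norm_integrable fi) => //.
  by apply/measurable_EFinP; exact: fi.1.2.
move=> x _ /=; rewrite lee_fin (ger0_norm (normc_ge0 _)); exact: normr_Im_le.
Qed.

Lemma cintbleD f g : cintble f -> cintble g -> cintble (fun x => f x + g x).
Proof.
move=> fi gi; have [mf foo] := fi; have [mg goo] := gi.
apply: (@cintble_le _ (fun x => normc (f x) + normc (g x))).
- exact: cmeasD.
- by apply: measurable_funD; exact: measurable_normc.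
- by move=> x; exact: le_normcD.
- under eq_integral do rewrite EFinD.
  rewrite ge0_integralD//.
  + exact: lte_add_pinfty.
  + by move=> x _; rewrite lee_fin normc_ge0.
  + by apply/measurable_EFinP; exact: measurable_normc.
  + by move=> x _; rewrite lee_fin normc_ge0.
  + by apply/measurable_EFinP; exact: measurable_normc.
Qed.

Lemma cintble_bndM (M : R) (h f : T -> R[i]) : cmeas h ->
  (forall x, normc (h x) <= M) -> cintble f -> cintble (fun x => h x * f x).
Proof.
move=> mh hM [mf foo].
apply: (@cintble_le _ (fun x => `|M| * normc (f x))).
- exact: cmeasM.
- by apply: measurable_funM => //; exact: measurable_normc.
- move=> x; rewrite normcM ler_wpM2r ?normc_ge0//.
  exact: le_trans (hM _) (ler_norm _).
- under eq_integral do rewrite EFinM.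
  rewrite ge0_integralZl_EFin//.
  + by rewrite lte_mul_pinfty// lee_fin.
  + by move=> x _; rewrite lee_fin normc_ge0.
  + by apply/measurable_EFinP; exact: measurable_normc.
Qed.

Lemma cintbleZ (z : R[i]) f : cintble f -> cintble (fun x => z * f x).
Proof.
by move=> fi; apply: (@cintble_bndM (normc z)) => //; exact: cmeas_cst.
Qed.

Lemma cintbleN f : cintble f -> cintble (fun x => - f x).
Proof. by move=> fi; under eq_fun do rewrite -mulN1r; exact: cintbleZ. Qed.

Lemma cintbleB f g : cintble f -> cintble g -> cintble (fun x => f x - g x).
Proof. by move=> fi gi; apply: cintbleD => //; exact: cintbleN. Qed.

Lemma cintbleJ f : cintble f -> cintble (fun x => ((f x)^*)%R).
Proof.
move=> [mf foo]; split; first exact: cmeasJ.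
by under eq_integral do rewrite normcJ.
Qed.

Lemma cintble0 : cintble (fun=> 0).
Proof.
split; first exact: cmeas_cst.
by under eq_integral do rewrite normc0; rewrite integral0.
Qed.

Lemma cintble_sum I (s : seq I) (F : I -> T -> R[i]) :
  (forall i, cintble (F i)) -> cintble (fun x => \sum_(i <- s) F i x).
Proof.
move=> iF; elim: s => [|i s IH].
  by under eq_fun do rewrite big_nil; exact: cintble0.
by under eq_fun do rewrite big_cons; exact: cintbleD.
Qed.

Lemma cint_ext f g : f =1 g -> cint f = cint g.
Proof. by move=> /funext ->. Qed.

Lemma cint0 : cint (fun=> 0) = 0.
Proof. by apply: complex_ext; rewrite /= Rintegral_cst// mul0r. Qed.

Lemma cintD f g : cintble f -> cintble g ->
  cint (fun x => f x + g x) = cint f + cint g.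
Proof.
move=> fi gi; apply: complex_ext; rewrite ?ReD ?ImD /=.
  rewrite -RintegralD//; [|exact: cintble_Re..].
  by under eq_Rintegral do rewrite ReD.
rewrite -RintegralD//; [|exact: cintble_Im..].
by under eq_Rintegral do rewrite ImD.
Qed.

Lemma cintZ (z : R[i]) f : cintble f -> cint (fun x => z * f x) = z * cint f.
Proof.
move=> fi.
have [fr fm] := (cintble_Re fi, cintble_Im fi).
have Z (r : R) (u : T -> R) : m.-integrable setT (EFin \o u) ->
    m.-integrable setT (EFin \o (fun x => r * u x)).
  by move=> iu; apply: eq_integrable (integrableZl _ r iu).
apply: complex_ext; rewrite ?ReM ?ImM /=.
  under eq_Rintegral do rewrite ReM.
  by rewrite RintegralB ?RintegralZl//; exact: Z.
under eq_Rintegral do rewrite ImM.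
by rewrite RintegralD ?RintegralZl//; exact: Z.
Qed.

Lemma cintN f : cintble f -> cint (fun x => - f x) = - cint f.
Proof.
move=> fi; rewrite -[RHS]mulN1r -cintZ//.
by apply: cint_ext => x; rewrite mulN1r.
Qed.

Lemma cintB f g : cintble f -> cintble g ->
  cint (fun x => f x - g x) = cint f - cint g.
Proof. by move=> fi gi; rewrite cintD ?cintN//; exact: cintbleN. Qed.

Lemma cint_sum I (s : seq I) (F : I -> T -> R[i]) : (forall i, cintble (F i)) ->
  cint (fun x => \sum_(i <- s) F i x) = \sum_(i <- s) cint (F i).
Proof.
move=> iF; elim: s => [|i s IH].
  by under eq_fun do rewrite big_nil; rewrite big_nil cint0.
under eq_fun do rewrite big_cons.
by rewrite big_cons cintD ?IH//; exact: cintble_sum.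
Qed.

Lemma cintJ f : cintble f -> cint (fun x => ((f x)^*)%R) = ((cint f)^*)%R.
Proof.
move=> fi; apply: complex_ext; rewrite ?ReJ ?ImJ /=.
  by under eq_Rintegral do rewrite ReJ.
under eq_Rintegral do rewrite ImJ -mulN1r.
by rewrite RintegralZl ?mulN1r//; exact: cintble_Im.
Qed.

(* Multiplying by the conjugate of the integral reduces the claim to the
   monotonicity of the integral of the real part. *)
Lemma normc_cint_le f : cintble f ->
  ((normc (cint f))%:E <= \int[m]_x (normc (f x))%:E)%E.
Proof.
move=> fi; have fn := cintble_norm_integrable fi.
have -> : (\int[m]_x (normc (f x))%:E = (\int[m]_x normc (f x))%:E)%E.
  by rewrite fineK//; exact: integrable_fin_num.
rewrite lee_fin; set w := cint f; set I := Rintegral _ _ _.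
have I0 : 0 <= I by apply: Rintegral_ge0 => x _; exact: normc_ge0.
have [w0|w0] := eqVneq (normc w) 0; first by rewrite w0.
have wp : 0 < normc w by rewrite lt_neqAle eq_sym w0 normc_ge0.
rewrite -(ler_pM2l wp).
have -> : normc w * normc w = complex.Re (cint (fun x => (w^*)%R * f x)).
  by rewrite cintZ// -/w [X in complex.Re X]mulrC mulcJ /= expr2.
rewrite /I -RintegralZl//; apply: le_Rintegral => //.
- by apply: cintble_Re; exact: cintbleZ.
- by apply: eq_integrable (integrableZl _ (normc w) fn).
- move=> x _; apply: le_trans (ler_norm _) _.
  by apply: le_trans (normr_Re_le _) _; rewrite normcM normcJ.
Qed.

End complex_integral.

(** * Fubini's theorem for complex-valued functions *)

Section complex_fubini.
Context d1 d2 (T1 : measurableType d1) (T2 : measurableType d2) {R : realType}.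

(** Tonelli handles the positive and the negative part separately. Sections whose integral is not
    finite receive the value fixed by extended subtraction and [fine], and the result is still
    measurable. *)
Lemma measurable_Rintegral_section (m2 : {sigma_finite_measure set T2 -> \bar R})
    (F : T1 * T2 -> R) : measurable_fun setT F ->
  measurable_fun setT (fun x => \int[m2]_y F (x, y)).
Proof.
move=> mF; rewrite /Rintegral; apply: measurableT_comp => //.
under eq_fun do rewrite integralE.
have mF' : measurable_fun setT (EFin \o F) by exact/measurable_EFinP.
apply: emeasurable_funB.
  rewrite [X in measurable_fun _ X](_ : _ = fubini_F m2 (EFin \o F)^\+%E); last first.
    by apply/funext => x; apply: eq_integral => y _; rewrite !funeposE.
  by apply: measurable_fun_fubini_tonelli_F => //; exact: measurable_funepos.
rewrite [X in measurable_fun _ X](_ : _ = fubini_F m2 (EFin \o F)^\-%E); last first.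
  by apply/funext => x; apply: eq_integral => y _; rewrite !funenegE.
by apply: measurable_fun_fubini_tonelli_F => //; exact: measurable_funeneg.
Qed.

Lemma cmeas_cint_section (m2 : {sigma_finite_measure set T2 -> \bar R})
    (F : T1 * T2 -> R[i]) : cmeas F ->
  cmeas (fun x => cint m2 (fun y => F (x, y))).
Proof.
move=> [F1 F2]; split => /=; first exact: (measurable_Rintegral_section m2 F1).
exact: (measurable_Rintegral_section m2 F2).
Qed.

Variables (m1 : {sigma_finite_measure set T1 -> \bar R})
  (m2 : {sigma_finite_measure set T2 -> \bar R}).

(** Every section is assumed integrable, not just almost every one: this lets [fine] be removed
    pointwise, and bounded kernels provide it. *)
Lemma cint_fubini (F : T1 * T2 -> R[i]) :
  cintble (m1 \x m2)%E F ->
  (forall x, cintble m2 (fun y => F (x, y))) ->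
  (forall y, cintble m1 (fun x => F (x, y))) ->
  cint m1 (fun x => cint m2 (fun y => F (x, y))) =
  cint m2 (fun y => cint m1 (fun x => F (x, y))).
Proof.
move=> iF i1 i2.
have fub (G : T1 * T2 -> R) : (m1 \x m2)%E.-integrable setT (EFin \o G) ->
    (forall x, m2.-integrable setT (EFin \o (fun y => G (x, y)))) ->
    (forall y, m1.-integrable setT (EFin \o (fun x => G (x, y)))) ->
    \int[m1]_x (\int[m2]_y G (x, y)) = \int[m2]_y (\int[m1]_x G (x, y)).
  move=> iG h1 h2; congr fine.
  under eq_integral do rewrite fineK ?(integrable_fin_num _ (h1 _))//.
  under [RHS]eq_integral do rewrite fineK ?(integrable_fin_num _ (h2 _))//.
  exact: (Fubini iG).
apply: complex_ext => /=.
  apply: (fub (fun z => complex.Re (F z))) => [|x|y]; exact: cintble_Re.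
apply: (fub (fun z => complex.Im (F z))) => [|x|y]; exact: cintble_Im.
Qed.

(** The product of [|g|], [|M|] and [|h|] dominates the integrand, and Tonelli makes it integrable.
    The lemma serves both the multiplication formula for Fourier transforms and the passage from
    grid sums to autocorrelations. *)
Lemma cint_kernel_swap (M : R) (g : T1 -> R[i]) (h : T2 -> R[i])
    (k : T1 * T2 -> R[i]) :
  cintble m1 g -> cintble m2 h -> cmeas k -> (forall z, normc (k z) <= M) ->
  cint m1 (fun x => g x * cint m2 (fun y => k (x, y) * h y)) =
  cint m2 (fun y => h y * cint m1 (fun x => k (x, y) * g x)).
Proof.
move=> ig ih mk kM; have [mg goo] := ig; have [mh hoo] := ih.
have k2 x : cintble m2 (fun y => k (x, y) * h y).
  apply: (@cintble_bndM _ _ _ _ M (fun y => k (x, y))) => //.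
  by apply: (@cmeas_comp _ _ _ _ _ k (pair x)) => //; exact: pair1_measurable.
have k1 y : cintble m1 (fun x => k (x, y) * g x).
  apply: (@cintble_bndM _ _ _ _ M (fun x => k (x, y))) => //.
  by apply: (@cmeas_comp _ _ _ _ _ k (pair^~ y)) => //; exact: pair2_measurable.
transitivity (cint m1 (fun x => cint m2 (fun y => g x * (k (x, y) * h y)))).
  by apply: cint_ext => x; rewrite cintZ.
transitivity (cint m2 (fun y => cint m1 (fun x => g x * (k (x, y) * h y)))).
  have mg' : cmeas (fun z : T1 * T2 => g z.1) by apply: cmeas_comp.
  have mh' : cmeas (fun z : T1 * T2 => h z.2) by apply: cmeas_comp.
  apply: (@cint_fubini (fun z => g z.1 * (k z * h z.2))) => [|x|y].
  - apply: (@cintble_le _ _ _ _ _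
      (fun z => normc (g z.1) * (`|M| * normc (h z.2)))).
    + by apply: cmeasM => //; exact: cmeasM.
    + apply: measurable_funM; first exact: measurable_normc.
      by apply: measurable_funM => //; exact: measurable_normc.
    + move=> z; rewrite !normcM ler_wpM2l ?normc_ge0// ler_wpM2r ?normc_ge0//.
      exact: le_trans (kM _) (ler_norm _).
    rewrite fubini_tonelli1; last 2 first.
    + apply/measurable_EFinP; apply: measurable_funM; first exact: measurable_normc.
      by apply: measurable_funM => //; exact: measurable_normc.
    + by move=> z; rewrite lee_fin !mulr_ge0 ?normc_ge0.
    rewrite /fubini_F /=.
    have -> : (fun x => \int[m2]_y (normc (g x) * (`|M| * normc (h y)))%:E)%E =
       (fun x => (normc (g x))%:E * (`|M|%:E * \int[m2]_y (normc (h y))%:E))%E.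
      apply/funext => x; under eq_integral do rewrite EFinM EFinM.
      rewrite ge0_integralZl_EFin ?normc_ge0//; last 2 first.
      - by move=> y _; rewrite mule_ge0// lee_fin ?normc_ge0.
      - by apply: emeasurable_funM => //; apply/measurable_EFinP;
          exact: measurable_normc.
      rewrite ge0_integralZl_EFin ?normc_ge0//.
      - by move=> y _; rewrite lee_fin normc_ge0.
      - by apply/measurable_EFinP; exact: measurable_normc.
    rewrite ge0_integralZr//; last 3 first.
    + by apply/measurable_EFinP; exact: measurable_normc.
    + by move=> x _; rewrite lee_fin normc_ge0.
    + by rewrite mule_ge0 ?lee_fin// integral_ge0// => y _; rewrite lee_fin normc_ge0.
    rewrite lte_mul_pinfty//.
    + by apply: integral_ge0 => x _; rewrite lee_fin normc_ge0.
    + by rewrite ge0_fin_numE// integral_ge0// => x _; rewrite lee_fin normc_ge0.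
    + by rewrite lte_mul_pinfty// lee_fin.
  - exact: (cintbleZ (g x) (k2 x)).
  - rewrite (_ : (fun x => _) = (fun x => h y * (k (x, y) * g x))).
      exact: (cintbleZ (h y) (k1 y)).
    by apply/funext => x /=; ring.
apply: cint_ext => y; rewrite -cintZ//; apply: cint_ext => x.
ring.
Qed.

End complex_fubini.

(** * Measurable operations on row vectors *)

Section row_measurable.
Context {R : realType} {n : nat}.
Context d (T : measurableType d).
Implicit Types f g : T -> 'rV[R]_n.

Lemma measurable_coord f i : measurable_fun setT f ->
  measurable_fun setT (fun x => f x ord0 i).
Proof.
move=> mf; exact: (measurableT_comp (@measurable_rV_coord R n i) mf).
Qed.

Lemma measurable_rVD f g : measurable_fun setT f -> measurable_fun setT g ->
  measurable_fun setT (fun x => f x + g x).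
Proof.
move=> mf mg; apply: measurable_fun_rV => i.
rewrite (_ : _ \o _ = fun x => f x ord0 i + g x ord0 i).
  by apply: measurable_funD; exact: measurable_coord.
by apply/funext => x; rewrite /rV_coord /= mxE.
Qed.

Lemma measurable_rVN f : measurable_fun setT f ->
  measurable_fun setT (fun x => - f x).
Proof.
move=> mf; apply: measurable_fun_rV => i.
rewrite (_ : _ \o _ = fun x => - (f x ord0 i)).
  by apply: measurableT_comp => //; exact: measurable_coord.
by apply/funext => x; rewrite /rV_coord /= mxE.
Qed.

Lemma measurable_rVB f g : measurable_fun setT f -> measurable_fun setT g ->
  measurable_fun setT (fun x => f x - g x).
Proof. by move=> mf mg; apply: measurable_rVD => //; exact: measurable_rVN. Qed.

Lemma measurable_dot f g : measurable_fun setT f -> measurable_fun setT g ->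
  measurable_fun setT (fun x => dot (f x) (g x)).
Proof.
move=> mf mg; rewrite /dot.
apply: measurable_sum => i.
by apply: measurable_funM; exact: measurable_coord.
Qed.

End row_measurable.

(** * Lebesgue measure on rows: iterated integrals and translation invariance *)

Section lebesgue_row.
Context {R : realType}.
Local Notation leb := (@lebesgue_measure_rV R).

(** By construction the measure in dimension [n.+1] is the image of a product measure under
    [rV_cons], so Tonelli splits off the first coordinate. *)
Lemma ge0_integral_leb_cons n (f : 'rV[R]_n.+1 -> \bar R) :
  measurable_fun setT f -> (forall x, 0 <= f x)%E ->
  (\int[leb n.+1]_x f x =
   \int[lebesgue_measure]_t \int[leb n]_y f (rV_cons (t, y)))%E.
Proof.
move=> mf f0.
rewrite [LHS](_ : _ =
  \int[pushforward (lebesgue_measure \x leb n)%E (@rV_cons R n)]_x f x)%E//.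
rewrite ge0_integral_pushforward//; last exact: measurable_rV_cons.
rewrite preimage_setT fubini_tonelli1//.
  by apply: (measurableT_comp mf); exact: measurable_rV_cons.
by move=> x; exact: f0.
Qed.

Lemma integral_leb_prod n (g : 'I_n -> R -> R) :
  (forall i, measurable_fun setT (g i)) -> (forall i t, 0 <= g i t) ->
  (\int[leb n]_x (\prod_(i < n) g i (x ord0 i))%:E =
   \prod_(i < n) \int[lebesgue_measure]_t (g i t)%:E)%E.
Proof.
elim: n g => [|n IH] g mg g0.
  rewrite big_ord0 /= integral_dirac//.
    by rewrite diracT mul1e big_ord0.
  by under eq_fun do rewrite big_ord0; exact: measurable_cst.
rewrite ge0_integral_leb_cons; last 2 first.
- apply/measurable_EFinP; apply: measurable_prod => i _.
  by apply: measurableT_comp; [exact: mg|exact: measurable_rV_coord].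
- by move=> x; rewrite lee_fin prodr_ge0.
under eq_integral => t _.
  under eq_integral => y _.
    rewrite big_ord_recl rV_cons0 /=.
    under eq_bigr => i _ do rewrite rV_consS /=.
    rewrite EFinM.
    over.
  rewrite ge0_integralZl_EFin//; last 2 first.
  - by move=> y _; rewrite lee_fin prodr_ge0.
  - apply/measurable_EFinP; apply: measurable_prod => i _.
    by apply: measurableT_comp; [exact: mg|exact: measurable_rV_coord].
  rewrite (IH (fun i => g (lift ord0 i)))//.
  over.
rewrite ge0_integralZr//.
- by rewrite big_ord_recl.
- by apply/measurable_EFinP; exact: mg.
- by move=> t _; rewrite lee_fin.
- by apply: prode_ge0 => i _; apply: integral_ge0 => t _; rewrite lee_fin.
Qed.

(** The image of Lebesgue measure under a translation gives each half-open interval its length,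
    which determines it. *)
Lemma ge0_integral_lebesgue_shift (f : R -> \bar R) (v : R) :
  measurable_fun setT f -> (forall x, 0 <= f x)%E ->
  (\int[lebesgue_measure]_t f (t + v)%R = \int[lebesgue_measure]_t f t)%E.
Proof.
move=> mf f0.
have mv : measurable_fun [set: measurableTypeR R]
    (fun t : measurableTypeR R => (t : R) + v : measurableTypeR R).
  by apply: (@measurable_funD _ (measurableTypeR R) R setT idfun (cst v)) => //; exact: measurable_id.
pose nu : {measure set (measurableTypeR R) -> \bar R} :=
  measure_function_pushforward__canonical__measure_function_Measure
    lebesgue_measure mv.
transitivity (\int[nu]_t f t)%E.
  by rewrite ge0_integral_pushforward.
apply: eq_measure_integral => A mA _.
apply/esym/lebesgue_measure_unique => //= _ [[a b] _ <-] /=.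
rewrite /pushforward (_ : _ @^-1` _ = `](a - v), (b - v)]%classic); last first.
  by apply/seteqP; split => t; rewrite /= !in_itv /= ltrBlDr lerBrDr.
rewrite !lebesgue_measure_itv /= !lte_fin ltrD2r.
by case: ifP => // _; congr EFin; ring.
Qed.

Lemma ge0_integral_leb_shift n (f : 'rV[R]_n -> \bar R) (v : 'rV[R]_n) :
  measurable_fun setT f -> (forall x, 0 <= f x)%E ->
  (\int[leb n]_x f (x + v)%R = \int[leb n]_x f x)%E.
Proof.
elim: n f v => [|n IH] f v mf f0.
  by congr (integral _ _ _); apply/funext => x; congr f; rewrite !thinmx0.
rewrite (ge0_integral_leb_cons mf f0) ge0_integral_leb_cons; last 2 first.
- by apply: (measurableT_comp mf); apply: measurable_rVD.
- by move=> x; exact: f0.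
pose F (t : R) := (\int[leb n]_y f (rV_cons (t, y)))%E.
have E t y : rV_cons (t, y) + v =
    rV_cons (t + v ord0 ord0, y + rsubmx (v : 'rV_(1 + n))).
  apply/rowP => i; rewrite mxE; case: (unliftP ord0 i) => [j|] ->.
    rewrite !rV_consS /= mxE [in RHS]mxE; congr (_ + v _ _); exact: val_inj.
  by rewrite !rV_cons0.
have mfc : measurable_fun setT (fun p : measurableTypeR R * 'rV[R]_n => f (rV_cons p)).
  by apply: measurableT_comp => //; exact: measurable_rV_cons.
transitivity (\int[@lebesgue_measure R]_t F (t + v ord0 ord0)%R)%E.
  apply: eq_integral => t _.
  under eq_integral do rewrite E.
  rewrite (IH (fun y => f (rV_cons (t + v ord0 ord0, y))))//.
  apply: (measurableT_comp mfc); exact: pair1_measurable.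
apply: ge0_integral_lebesgue_shift.
  apply: (@measurable_fun_fubini_tonelli_F _ _ _ _ _ (leb n)
     (fun p => f (rV_cons p))) => //.
by move=> t; exact: integral_ge0.
Qed.

End lebesgue_row.

(** * Translation continuity, in measure, of sets *)

Section translation.
Context {R : realType} {d : nat}.
Local Notation vec := 'rV[R]_d.
Local Notation leb := (@lebesgue_measure_rV R d).

Definition cube (M : R) : set vec := [set x | forall i, `|x ord0 i| <= M].

Lemma cubeE M : cube M = [set x : vec | forall i, `[- M, M]%classic (x ord0 i)].
Proof. by apply/seteqP; split=> x /= h i; move: (h i); rewrite in_itv /= ler_norml. Qed.

Lemma measurable_box (A : 'I_d -> set (measurableTypeR R)) :
  (forall i, measurable (A i)) -> measurable [set x : vec | forall i, A i (x ord0 i)].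
Proof.
move=> mA; rewrite [X in _ X](_ : _ = \bigcap_(i in [set: 'I_d])
    (@rV_coord R d i) @^-1` A i).
  apply: fin_bigcap_measurable => // i _.
  by rewrite -[X in measurable X]setTI; exact: measurable_rV_coord.
by apply/seteqP; split=> x /= xA i; [move=> _|]; exact: xA.
Qed.

Lemma measurable_cube M : measurable (cube M).
Proof.
rewrite cubeE; apply: (@measurable_box (fun=> `[- M, M]%classic)) => i.
exact: measurable_itv.
Qed.

Lemma leb_cube_lty M : (leb (cube M) < +oo)%E.
Proof.
rewrite cubeE (@lebesgue_measure_rV_box R d (fun=> `[- M, M]%classic)); last first.
  by move=> i; exact: measurable_itv.
rewrite -ge0_fin_numE; last by apply: prode_ge0 => i _; exact: measure_ge0.
elim/big_ind : _ => // [x y|i _]; first exact: fin_numM.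
by rewrite lebesgue_measure_itv /=; case: ifP.
Qed.

Lemma cube_le (M M' : R) : M <= M' -> cube M `<=` cube M'.
Proof. by move=> MM x /= h i; exact: le_trans (h i) MM. Qed.

Lemma le_leb (A B : set vec) : measurable A -> measurable B -> A `<=` B ->
  (leb A <= leb B)%E.
Proof. by move=> mA mB AB; apply: le_measure => //; exact: mem_set. Qed.

Lemma leb_setU_le (A B : set vec) : measurable A -> measurable B ->
  (leb (A `|` B) <= leb A + leb B)%E.
Proof. by move=> mA mB; exact: measureU2. Qed.

(** The symmetric difference of [B] and its translate by [-u]: the points whose membership changes
    when they move by [u]. *)
Definition flip (B : set vec) (u : vec) : set vec :=
  [set y | ~ (B (y + u) <-> B y)].

Lemma measurable_shift_preimage (B : set vec) (u : vec) :
  measurable B -> measurable [set y | B (y + u)].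
Proof.
move=> mB; have := @measurable_rVD R d _ vec id (cst u) (@measurable_id _ _ _) (measurable_cst _).
by move=> /(_ measurableT _ mB); rewrite setTI.
Qed.

Lemma leb_shift_preimage (B : set vec) (u : vec) :
  measurable B -> leb [set y | B (y + u)] = leb B.
Proof.
move=> mB.
have h (A : set vec) : measurable A -> (leb A = \int[leb]_x (\1_A x)%:E)%E.
  by move=> mA; rewrite integral_indic// setIT.
rewrite (h B)// (h [set y | B (y + u)]); last exact: measurable_shift_preimage.
rewrite -(@ge0_integral_leb_shift R d (fun x => (\1_B x)%:E) u).
- by apply: eq_integral => x _; rewrite !indicE; congr ((_ : bool)%:R%:E);
    apply/idP/idP; rewrite !inE.
- by apply/measurable_EFinP; exact: measurable_indic.
- by move=> x; rewrite lee_fin.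
Qed.

Lemma flipE (B : set vec) u :
  flip B u = ([set y | B (y + u)] `\` B) `|` (B `\` [set y | B (y + u)]).
Proof.
apply/seteqP; split => y /=.
  move=> h; have [By|nBy] := pselect (B y); [right|left].
    by split => // Byu; apply: h.
  by split => //; apply: contra_notP h => nB; split.
by case=> -[h1 h2] [h3 h4]; [apply/h2/h3|apply/h2/h4].
Qed.

Lemma measurable_flip B u : measurable B -> measurable (flip B u).
Proof.
move=> mB; have mBu := measurable_shift_preimage u mB.
by rewrite flipE; apply: measurableU; exact: measurableD.
Qed.

(** Local continuity of translations on the indicator of [B]. The sets with this property form a
    sigma-algebra, so it is enough to verify it on slabs. *)
Definition shift_cont (B : set vec) := measurable B /\
  forall M e : R, 0 < e -> exists2 delta : R, 0 < delta &
    forall u : vec, (forall i, `|u ord0 i| <= delta) ->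
    (leb (cube M `&` flip B u) <= e%:E)%E.

Lemma shift_contC B : shift_cont B -> shift_cont (~` B).
Proof.
move=> [mB h]; split; first exact: measurableC.
move=> M e e0; have [delta d0 hd] := h M e e0; exists delta => // u /hd.
rewrite (_ : flip (~` B) u = flip B u)//.
apply/seteqP; split => y /= hy [h1 h2]; apply: hy; split.
- by move=> nB By; apply: nB; exact: h2.
- by move=> nB By; apply: nB; exact: h1.
- by move=> Byu; apply: contrapT => nB; exact: (h2 nB).
- by move=> By; apply: contrapT => nB; exact: (h1 nB).
Qed.

Lemma shift_contU A B : shift_cont A -> shift_cont B -> shift_cont (A `|` B).
Proof.
move=> [mA hA] [mB hB]; split; first exact: measurableU.
move=> M e e0; have e20 : 0 < e / 2 by rewrite divr_gt0.
have [d1 d10 h1] := hA M _ e20; have [d2 d20 h2] := hB M _ e20.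
exists (Num.min d1 d2); first by rewrite lt_min d10.
move=> u hu.
have -> : e%:E = ((e / 2)%:E + (e / 2)%:E)%E by rewrite -EFinD; congr EFin; field.
have mAu : measurable (cube M `&` flip A u).
  by apply: measurableI; [exact: measurable_cube|exact: measurable_flip].
have mBu : measurable (cube M `&` flip B u).
  by apply: measurableI; [exact: measurable_cube|exact: measurable_flip].
apply: le_trans (leeD (h1 u _) (h2 u _)).
- apply: le_trans (leb_setU_le mAu mBu).
  apply: le_leb.
  + apply: measurableI; first exact: measurable_cube.
    by apply: measurable_flip; exact: measurableU.
  + exact: measurableU.
  + move=> y [Qy fy]; apply: contrapT => hn; apply: fy.
    have eA : A (y + u) <-> A y by apply: contrapT => hA'; apply: hn; left.
    have eB : B (y + u) <-> B y by apply: contrapT => hB'; apply: hn; right.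
    by split => -[/eA|/eB] ?; [left|right|left|right].
- by move=> i; apply: le_trans (hu i) _; rewrite ge_min lexx.
- by move=> i; apply: le_trans (hu i) _; rewrite ge_min lexx orbT.
Qed.

Lemma shift_cont0 : shift_cont set0.
Proof.
split; first exact: measurable0.
move=> M e e0; exists 1 => // u _.
rewrite (_ : _ `&` _ = set0) ?measure0 ?lee_fin ?ltW//.
by apply/seteqP; split => // y [_] /=; apply; split.
Qed.

(** Inside a cube the union differs from a finite union [V n] by a set of small measure. A point
    that changes sides for [B] but not for [V n] lies in that remainder or in its translate. *)
Lemma shift_cont_bigcup (F : (set vec)^nat) :
  (forall n, shift_cont (F n)) -> shift_cont (\bigcup_n F n).
Proof.
move=> hF; set B := \bigcup_n F n.
have mF n : measurable (F n) := (hF n).1.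
have mB : measurable B by exact: bigcup_measurable.
split => // M e e0.
pose V n := \big[setU/set0]_(k < n) F k.
have hV n : shift_cont (V n).
  rewrite /V; elim/big_ind : _ => [|X Y|k _]; [exact: shift_cont0| |exact: hF].
  exact: shift_contU.
have mV n : measurable (V n) := (hV n).1.
(* The cube is enlarged by 1 so that it still contains [y + u] when [y] is in [cube M] and the
   coordinates of [u] are at most 1. *)
pose E n := cube (M + 1) `&` (B `\` V n).
have mE n : measurable (E n).
  by apply: measurableI; [exact: measurable_cube|exact: measurableD].
have E0 : leb \o E @ \oo --> leb (\bigcap_n E n).
  apply: nonincreasing_cvg_mu => //.
  - apply: le_lt_trans (leb_cube_lty (M + 1)); apply: le_leb => //.
    + exact: measurable_cube.
    + by move=> x [].
  - exact: bigcap_measurable.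
  - move=> n m nm; apply/subsetPset => x [Qx [Bx nV]]; split => //; split => //.
    apply: contra_not nV; rewrite /V -!bigcup_mkord => -[k /= kn Fk].
    by exists k => //=; exact: leq_trans kn nm.
have capE : \bigcap_n E n = set0.
  apply/seteqP; split => // x h.
  have [_ [[n _ Fn] _]] := h 0%N I.
  have [_ [_ nV]] := h n.+1 I; apply: nV.
  by rewrite /V -bigcup_mkord; exists n => /=.
rewrite capE measure0 in E0.
have e40 : 0 < e / 4 by rewrite divr_gt0.
have [n En] : exists n, (leb (E n) <= (e / 4)%:E)%E.
  have /E0 : nbhs (0 : \bar R)%E [set x | (x < (e / 4)%:E)%E].
    exact: (@open_nbhs_nbhs _ _ _ (conj (@open_ereal_lt_ereal _ _) _)).
  by move=> [n _ /(_ n (leqnn n)) /= /ltW h]; exists n.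
have e20 : 0 < e / 2 by rewrite divr_gt0.
have [_ /(_ M _ e20) [d1 d10 h1]] := hV n.
exists (Num.min d1 1); first by rewrite lt_min d10 ltr01.
move=> u hu.
have hu1 i : `|u ord0 i| <= 1.
  by apply: le_trans (hu i) _; rewrite ge_min lexx orbT.
have {h1}h1 : (leb (cube M `&` flip (V n) u) <= (e / 2)%:E)%E.
  by apply: h1 => i; apply: le_trans (hu i) _; rewrite ge_min lexx.
have VB : V n `<=` B.
  by rewrite /V -bigcup_mkord => x [k _ Fk]; exists k.
have mEu := measurable_shift_preimage u (mE n).
have mVu : measurable (cube M `&` flip (V n) u).
  by apply: measurableI; [exact: measurable_cube|exact: measurable_flip].
(* Half for the finite union, a quarter for the remainder and a quarter for its translate, which has
   the same measure. *)
have -> : e%:E = ((e / 2)%:E + ((e / 4)%:E + (e / 4)%:E))%E.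
  by rewrite -!EFinD; congr EFin; field.
rewrite -(leb_shift_preimage u (mE n)) in En.
have En' := En; rewrite leb_shift_preimage// in En'.
apply: le_trans (leeD h1 (leeD En En')).
apply: (@le_trans _ _ (leb (cube M `&` flip (V n) u) +
    leb ([set y | E n (y + u)%R] `|` E n))%E); last first.
  by rewrite leeD2l//; exact: leb_setU_le.
have mEE : measurable ([set y | E n (y + u)] `|` E n) by exact: measurableU.
apply: le_trans (leb_setU_le mVu mEE).
apply: le_leb.
- apply: measurableI; first exact: measurable_cube.
  exact: measurable_flip.
- exact: measurableU.
move=> y [Qy fy]; apply: contrapT => hn.
have Q1 : cube (M + 1) y by apply: (@cube_le M) => //; rewrite lerDl.
have Q2 : cube (M + 1) (y + u).
  by move=> i /=; rewrite mxE; apply: le_trans (ler_normD _ _) _; rewrite lerD.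
apply: fy.
have e1 : B y <-> V n y.
  split; last exact: VB.
  by move=> By; apply: contrapT => nV; apply: hn; right; right.
have e2 : B (y + u) <-> V n (y + u).
  split; last exact: VB.
  by move=> By; apply: contrapT => nV; apply: hn; right; left.
rewrite /mkset e1 e2; apply: contrapT => hV'; apply: hn; left; split => //.
Qed.

End translation.

(** * Translation continuity for all Borel sets and for bounded functions *)

Section translation_fun.
Context {R : realType} {d : nat}.
Local Notation vec := 'rV[R]_d.
Local Notation leb := (@lebesgue_measure_rV R d).

Lemma lebesgue_measure_itvcc (a b : R) : a <= b ->
  lebesgue_measure `[a, b]%classic = (b - a)%:E.
Proof.
move=> ab; rewrite lebesgue_measure_itv /= lte_fin.
case: ltP => [_|ba]; first by rewrite EFinB.
suff -> : a = b by rewrite subrr.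
by apply/eqP; rewrite eq_le ab ba.
Qed.

Lemma leb_slab_le (M c delta : R) (i : 'I_d) : 0 <= M -> 0 <= delta ->
  (leb (cube M `&` [set y : vec | (`|y ord0 i - c| <= delta)%R]) <=
   ((2 * M) ^+ d.-1 * (2 * delta))%:E)%E.
Proof.
move=> M0 d0.
pose A (j : 'I_d) : set (measurableTypeR R) :=
  if j == i then `[c - delta, c + delta]%classic else `[- M, M]%classic.
have mA j : measurable (A j) by rewrite /A; case: ifP => _; exact: measurable_itv.
apply: (@le_trans _ _ (leb [set x | forall j, A j (x ord0 j)])).
  apply: le_leb.
  - apply: measurableI; first exact: measurable_cube.
    have := @measurable_itv R `[c - delta, c + delta] => mI.
    have := @measurable_rV_coord R d i measurableT _ mI; rewrite setTI.
    congr (_ _); apply/seteqP; split => y /=; rewrite /rV_coord in_itv /= ler_distl//.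
  - exact: measurable_box.
  - move=> y [Qy /= yi] j; rewrite /A; case: eqP => [->|_] /=.
      by rewrite in_itv /= -ler_distl.
    by rewrite in_itv /= -ler_norml; exact: Qy.
rewrite lebesgue_measure_rV_box// (bigD1 i)//= {1}/A eqxx.
rewrite lebesgue_measure_itvcc; last by lra.
rewrite (eq_bigr (fun=> (2 * M)%:E)); last first.
  move=> j ji; rewrite /A (negbTE ji) lebesgue_measure_itvcc; last by lra.
  by congr EFin; ring.
rewrite prodEFin prodr_const -EFinM lee_fin mulrC.
rewrite (_ : #|_| = d.-1); last first.
  by rewrite -[in RHS](card_ord d) -(cardC1 i); apply: eq_card => j; rewrite !inE.
by rewrite le_eqVlt; apply/orP; left; apply/eqP; ring.
Qed.

(** A move by at most [delta] changes sides only for points within [delta] of one of the two faces,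
    and these fill two thin slabs of the cube. *)
Lemma shift_cont_coord (i : 'I_d) (a b : R) :
  shift_cont [set x : vec | a < x ord0 i <= b].
Proof.
have mB : measurable [set x : vec | a < x ord0 i <= b].
  have := @measurable_itv R `]a, b] => mI.
  have := @measurable_rV_coord R d i measurableT _ mI; rewrite setTI.
  by congr (_ _); apply/seteqP; split => y /=; rewrite /rV_coord in_itv.
have mS (c delta : R) : measurable [set y : vec | `|y ord0 i - c| <= delta].
  have := @measurable_itv R `[c - delta, c + delta] => mI.
  have := @measurable_rV_coord R d i measurableT _ mI; rewrite setTI.
  by congr (_ _); apply/seteqP; split => y /=; rewrite /rV_coord in_itv /= ler_distl.
split => // M e e0; pose K := (2 * `|M|) ^+ d.-1 + 1.
have K0 : 0 < K by rewrite ltr_pwDr// exprn_ge0// mulr_ge0.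
(* Each thin slab has thickness [2 * delta] and cross-section less than [K], so the two together
   measure at most [4 * K * delta = e]. *)
exists (e / (4 * K)); first by rewrite divr_gt0// mulr_gt0.
move=> u hu; set delta := e / (4 * K) in hu *.
have d0 : 0 <= delta by rewrite divr_ge0 ?ltW// mulr_gt0.
pose S (c : R) : set vec := cube `|M| `&` [set y : vec | `|y ord0 i - c| <= delta].
have mSc c : measurable (S c) by apply: measurableI => //; exact: measurable_cube.
apply: (@le_trans _ _ (leb (S a `|` S b))).
  apply: le_leb.
  - by apply: measurableI; [exact: measurable_cube|exact: measurable_flip].
  - exact: measurableU.
  - move=> y [Qy fy].
    have Qy' : cube `|M| y by apply: cube_le Qy; exact: ler_norm.
    have [ha|ha] := leP `|y ord0 i - a| delta; first by left.
    have [hb|hb] := leP `|y ord0 i - b| delta; first by right.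
    exfalso; apply: fy; rewrite /= mxE.
    have := hu i; rewrite ler_norml => /andP[u1 u2].
    move: ha hb; rewrite !ltr_normr => /orP[]ha /orP[]hb.
    + by split => /andP[h1 h2]; lra.
    + by split => /andP[h1 h2]; apply/andP; split; lra.
    + by split => /andP[h1 h2]; lra.
    + by split => /andP[h1 h2]; lra.
apply: le_trans (leb_setU_le (mSc a) (mSc b)) _.
apply: le_trans (leeD (leb_slab_le a i (normr_ge0 M) d0)
  (leb_slab_le b i (normr_ge0 M) d0)) _.
rewrite -EFinD lee_fin.
set k := (2 * `|M|) ^+ d.-1.
have -> : e = 4 * K * delta by rewrite /delta; field; rewrite gt_eqF.
rewrite /K -/k; have : 0 <= k by rewrite exprn_ge0// mulr_ge0.
by move=> k0; have := mulr_ge0 k0 d0; lra.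
Qed.

(** Two nested generation arguments: the Borel sets of rows are generated by preimages under
    coordinates, and the Borel sets of the line by half-open intervals, whose preimages are
    slabs. *)
Lemma shift_cont_measurable (B : set vec) : measurable B -> shift_cont B.
Proof.
have sa : sigma_algebra setT (@shift_cont R d).
  split; first exact: shift_cont0.
  - by move=> A hA; rewrite setTD; exact: shift_contC.
  - by move=> F hF; exact: shift_cont_bigcup.
apply: (smallest_sub sa) => A; rewrite -bigcup_seq => -[i _ [Y mY <-]].
rewrite setTI.
have sb : sigma_algebra setT
    [set Y : set R | shift_cont (@rV_coord R d i @^-1` Y)].
  split => /=; first by rewrite preimage_set0; exact: shift_cont0.
  - by move=> X hX; rewrite setTD preimage_setC; exact: shift_contC.
  - by move=> F hF; rewrite preimage_bigcup; exact: shift_cont_bigcup.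
apply: (smallest_sub sb) mY => _ [[a b] _ <-] /=.
rewrite [X in shift_cont X](_ : _ = [set x : vec | a < x ord0 i <= b]).
  exact: shift_cont_coord.
by apply/seteqP; split => y /=; rewrite /rV_coord in_itv.
Qed.

Lemma shift_cont_fun (g : vec -> R) (K : R) :
  measurable_fun setT g -> (forall x, `|g x| <= K) ->
  forall M eps e : R, 0 < eps -> 0 < e -> exists2 delta : R, 0 < delta &
    forall u : vec, (forall i, `|u ord0 i| <= delta) ->
    (leb (cube M `&` [set y | (eps < `|g (y + u) - g y|)%R]) <= e%:E)%E.
Proof.
move=> mg gK M eps e eps0 e0.
have K0 : 0 <= K by exact: le_trans (normr_ge0 _) (gK 0).
(* [n] levels spaced by [eps], starting at [-K], cover the range of [g]. A change of [g] by more
   than [eps] crosses one of them, so the point changes sides for one of the superlevel sets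
   [B k]. *)
pose n := (Num.truncn (2 * K / eps)).+1.
pose t (k : nat) : R := - K + k%:R * eps.
pose B (k : nat) : set vec := [set x | t k <= g x].
have mB k : measurable (B k).
  have := @measurable_itv R `[t k, +oo[ => mI.
  have := mg measurableT _ mI; rewrite setTI.
  by congr (_ _); apply/seteqP; split => y /=; rewrite in_itv /= andbT.
have e'0 : 0 < e / n%:R by rewrite divr_gt0.
have hd k : exists delta : R, 0 < delta /\ forall u : vec,
    (forall i, `|u ord0 i| <= delta) ->
    (leb (cube M `&` flip (B k) u) <= (e / n%:R)%:E)%E.
  by have [_ /(_ M _ e'0)[dl d0 h]] := shift_cont_measurable (mB k); exists dl.
have [dl dlP] := choice hd.
exists (\big[Num.min/1]_(k < n) dl k).
  by elim/big_ind : _ => //[x y x0 y0|k _]; [rewrite lt_min x0|exact: (dlP k).1].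
move=> u hu.
have mF k : measurable (cube M `&` flip (B k) u).
  by apply: measurableI; [exact: measurable_cube|exact: measurable_flip].
have sub : cube M `&` [set y | eps < `|g (y + u) - g y|] `<=`
    \bigcup_(k < n) (cube M `&` flip (B k) u).
  move=> y [Qy /= hy].
  (* The witness is the highest level not above [q]: it exceeds [q - eps], hence also [p]. *)
  have key (p q : R) : `|p| <= K -> `|q| <= K -> p + eps < q ->
      exists k, [/\ (k < n)%N, t k <= q & p < t k].
    move=> pK qK pq; move: pK qK; rewrite !ler_norml => /andP[p1 p2] /andP[q1 q2].
    have z0 : 0 <= (q + K) / eps by rewrite divr_ge0 ?ltW//; lra.
    exists (Num.truncn ((q + K) / eps)); split.
    - rewrite ltnS; apply: le_truncn; rewrite ler_pM2r ?invr_gt0//; lra.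
    - have := truncn_le ((q + K) / eps); rewrite z0 /t.
      by rewrite ler_pdivlMr// => h; lra.
    - have := truncnS_gt ((q + K) / eps); rewrite /t ltr_pdivrMr// -natr1 => h.
      by lra.
  move: hy; rewrite ltr_normr => /orP[hy|hy].
    have [|k [kn k1 k2]] := key (g y) (g (y + u)) (gK _) (gK _); first by lra.
    exists k => //; split => // -[h1 _]; have := h1 k1.
    by rewrite /B /= leNgt k2.
  have [|k [kn k1 k2]] := key (g (y + u)) (g y) (gK _) (gK _); first by lra.
  exists k => //; split => // -[_ h1]; have := h1 k1.
  by rewrite /B /= leNgt k2.
have mS : measurable (cube M `&` [set y | eps < `|g (y + u) - g y|]).
  apply: measurableI; first exact: measurable_cube.
  have mh : measurable_fun setT (fun y : vec => `|g (y + u) - g y|).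
    apply: measurableT_comp => //; apply: measurable_funB => //.
    by apply: measurableT_comp => //; exact: measurable_rVD.
  have := @measurable_itv R `]eps, +oo[ => mI.
  have := mh measurableT _ mI; rewrite setTI.
  by congr (_ _); apply/seteqP; split => y /=; rewrite in_itv /= andbT.
apply: (@le_trans _ _ (leb (\big[setU/set0]_(k < n) (cube M `&` flip (B k) u)))).
  by rewrite bigcup_mkord in sub; apply: le_leb => //; exact: bigsetU_measurable.
apply: (@le_trans _ _ (\sum_(k < n) (e / n%:R)%:E)%E); last first.
  rewrite sumEFin sumr_const card_ord lee_fin -[X in X <= _]mulr_natr.
  by rewrite divfK// pnatr_eq0.
apply: (@le_trans _ _ (\sum_(k < n) leb (cube M `&` flip (B k) u))%E).
  apply: (@Boole_inequality _ _ _ leb (fun k => cube M `&` flip (B k) u)) => k _.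
  exact: mF.
apply: lee_sum => k _; apply: (dlP k).2 => i; apply: le_trans (hu i) _.
by rewrite (bigminD1 k)// ge_min lexx.
Qed.

End translation_fun.

(** * Squared norms and autocorrelations of bounded, compactly supported functions *)

Section autocorrelation.
Context {R : realType} {d : nat}.
Local Notation vec := 'rV[R]_d.
Local Notation leb := (@lebesgue_measure_rV R d).
Implicit Types (f g h H : vec -> R[i]).

Lemma integral_leb_indic (A : set vec) : measurable A ->
  (\int[leb]_x (\1_A x)%:E)%E = leb A.
Proof. by move=> mA; rewrite integral_indic// setIT. Qed.

Definition N2 f : \bar R := (\int[leb]_x (normc (f x) ^+ 2)%:E)%E.

Lemma N2_ge0 f : (0 <= N2 f)%E.
Proof. by apply: integral_ge0 => x _; rewrite lee_fin sqr_ge0. Qed.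

Lemma measurable_normc2E f : cmeas f ->
  measurable_fun setT (fun x : vec => (normc (f x) ^+ 2)%:E).
Proof. by move=> mf; apply/measurable_EFinP; exact: measurable_normc2. Qed.

Lemma measurable_shift (u : vec) : measurable_fun setT (fun x : vec => x + u).
Proof. exact: measurable_rVD. Qed.

Lemma cmeas_shift f (u : vec) : cmeas f -> cmeas (fun x : vec => f (x + u)).
Proof. by move=> mf; exact: (cmeas_comp mf (measurable_shift u)). Qed.

Lemma N2_shift f (u : vec) : cmeas f -> N2 (fun x : vec => f (x + u)) = N2 f.
Proof.
move=> mf; rewrite /N2.
rewrite (@ge0_integral_leb_shift R d (fun x : vec => (normc (f x) ^+ 2)%:E) u)//.
  exact: measurable_normc2E.
by move=> x; rewrite lee_fin sqr_ge0.
Qed.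

Lemma Rintegral_leb_shift (g : vec -> R) (u : vec) : measurable_fun setT g ->
  \int[leb]_x g (x + u) = \int[leb]_x g x.
Proof.
move=> mg; rewrite /Rintegral; congr fine; rewrite integralE [RHS]integralE.
have mg' : measurable_fun setT (EFin \o g) by exact/measurable_EFinP.
rewrite -(@ge0_integral_leb_shift R d ((EFin \o g)^\+%E) u)//; last first.
  exact: measurable_funepos.
rewrite -(@ge0_integral_leb_shift R d ((EFin \o g)^\-%E) u)//; last first.
  exact: measurable_funeneg.
by congr (_ - _)%E; apply: eq_integral => x _; rewrite ?funeposE ?funenegE.
Qed.

Lemma cint_shift f (u : vec) : cmeas f ->
  cint leb (fun x : vec => f (x + u)) = cint leb f.
Proof.
move=> [f1 f2]; apply: complex_ext => /=.
  exact: (Rintegral_leb_shift u f1).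
exact: (Rintegral_leb_shift u f2).
Qed.

Lemma cintble_shift f (u : vec) : cintble leb f ->
  cintble leb (fun x : vec => f (x + u)).
Proof.
move=> [mf foo]; split; first exact: cmeas_shift.
rewrite (@ge0_integral_leb_shift R d (fun x : vec => (normc (f x))%:E) u)//.
  by apply/measurable_EFinP; exact: measurable_normc.
by move=> x; rewrite lee_fin normc_ge0.
Qed.

(** The working class on the frequency side: such functions are integrable, so that [ift] is a
    genuine integral, they are square integrable, and their autocorrelations have compact
    support. *)
Definition bounded_in_cube (M K : R) H := [/\ cmeas H,
  forall x, normc (H x) <= K & forall x, ~ cube M x -> H x = 0].

Lemma integral_cube_lty (M K : R) : 0 <= K ->
  (\int[leb]_x (K * \1_(cube M) x)%:E < +oo)%E.
Proof.
move=> K0; under eq_integral do rewrite EFinM.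
rewrite ge0_integralZl_EFin//; last first.
  apply/measurable_EFinP; apply: measurable_indic; exact: measurable_cube.
rewrite integral_leb_indic; last exact: measurable_cube.
by rewrite lte_mul_pinfty// ?lee_fin//; exact: leb_cube_lty.
Qed.

Lemma bounded_in_cube_sqr_lty M K H : bounded_in_cube M K H -> (N2 H < +oo)%E.
Proof.
move=> [mH HK H0]; apply: le_lt_trans (integral_cube_lty M (sqr_ge0 K)).
apply: ge0_le_integral => //.
- by move=> x _; rewrite lee_fin sqr_ge0.
- exact: measurable_normc2E.
- apply/measurable_EFinP; apply: measurable_funM => //.
  by apply: measurable_indic; exact: measurable_cube.
move=> x _; rewrite lee_fin indicE; have [xM|xM] := boolP (x \in cube M).
  have K0 : 0 <= K by exact: le_trans (normc_ge0 _) (HK x).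
  by rewrite mulr1 lerXn2r ?nnegrE ?normc_ge0.
by rewrite H0 ?normc0 ?expr0n ?mulr0//; rewrite notin_setE in xM.
Qed.

Lemma bounded_in_cube_cintble M K H : bounded_in_cube M K H -> cintble leb H.
Proof.
move=> [mH HK H0].
apply: (@cintble_le _ _ _ _ _ (fun x : vec => K * \1_(cube M) x)) => //.
- apply: measurable_funM => //.
  by apply: measurable_indic; exact: measurable_cube.
- move=> x; rewrite indicE; have [xM|xM] := boolP (x \in cube M).
    by rewrite mulr1.
  by rewrite H0 ?normc0 ?mulr0//; rewrite notin_setE in xM.
- apply: integral_cube_lty; exact: le_trans (normc_ge0 _) (HK 0).
Qed.

(** The real part of the autocorrelation is kept because it is paired with a real kernel and the
    outcome is a real sum of squares. *)
Definition acorr H (u : vec) : R :=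
  \int[leb]_y complex.Re (H (y + u) * ((H y)^*)%R).

Lemma acorr0 H : (N2 H < +oo)%E -> (acorr H 0)%:E = N2 H.
Proof.
move=> Hoo; rewrite /acorr /Rintegral.
under eq_integral do rewrite addr0 mulcJ /=.
by rewrite fineK// ge0_fin_numE//; exact: N2_ge0.
Qed.

(** Apply [2xy <= x^2 + y^2] to the two values of [h]; both squares have the same integral by
    translation invariance. Keeping [h] apart from [H] lets [w] carry all the decay in [u]. *)
Lemma acorr_le H h (u : vec) (w : R) : cmeas H -> cmeas h -> 0 <= w ->
  (forall y, normc (H (y + u)) * normc (H y) <=
     w * (normc (h (y + u)) * normc (h y))) ->
  (N2 h < +oo)%E -> (`|acorr H u|%:E <= w%:E * N2 h)%E.
Proof.
move=> mH mh w0 Hh hoo.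
have mHH : cmeas (fun y : vec => H (y + u) * ((H y)^*)%R).
  by apply: cmeasM; [exact: cmeas_shift|exact: cmeasJ].
pose b (y : vec) := w * ((normc (h (y + u)) ^+ 2 + normc (h y) ^+ 2) / 2).
have ib : (\int[leb]_y (b y)%:E = w%:E * N2 h)%E.
  rewrite /b; under eq_integral do rewrite EFinM.
  have m1 := measurable_normc2 (cmeas_shift u mh).
  have m2 := measurable_normc2 mh.
  rewrite ge0_integralZl_EFin//; last 2 first.
  - by move=> y _; rewrite lee_fin divr_ge0// addr_ge0// sqr_ge0.
  - by apply/measurable_EFinP; apply: measurable_funM => //; exact: measurable_funD.
  congr (_ * _)%E; under eq_integral do rewrite mulrC EFinM.
  rewrite ge0_integralZl_EFin//; last 2 first.
  - by move=> y _; rewrite lee_fin addr_ge0// sqr_ge0.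
  - by apply/measurable_EFinP; exact: measurable_funD.
  under eq_integral do rewrite EFinD.
  rewrite ge0_integralD//; last 4 first.
  - by move=> y _; rewrite lee_fin sqr_ge0.
  - exact/measurable_EFinP.
  - by move=> y _; rewrite lee_fin sqr_ge0.
  - exact/measurable_EFinP.
  rewrite [X in (X + _)%E](N2_shift u mh) -/(N2 h).
  have : N2 h \is a fin_num by rewrite ge0_fin_numE//; exact: N2_ge0.
  by case: (N2 h) => // r _; rewrite -EFinD -EFinM; congr EFin; field.
have iHH : cintble leb (fun y : vec => H (y + u) * ((H y)^*)%R).
  apply: (@cintble_le _ _ _ _ _ b) => //.
  - apply: measurable_funM => //; apply: measurable_funM => //.
    by apply: measurable_funD; apply: measurable_normc2 => //; exact: cmeas_shift.
  - move=> y; rewrite normcM normcJ; apply: le_trans (Hh y) _.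
    rewrite /b ler_wpM2l// ler_pdivlMr//.
    by have := sqr_ge0 (normc (h (y + u)) - normc (h y)); nra.
  - by rewrite ib lte_mul_pinfty// lee_fin.
have -> : acorr H u = complex.Re (cint leb (fun y : vec => H (y + u) * ((H y)^*)%R)).
  by [].
apply: (@le_trans _ _ (normc (cint leb (fun y : vec => H (y + u) * ((H y)^*)%R)))%:E).
  by rewrite lee_fin; exact: normr_Re_le.
apply: le_trans (normc_cint_le iHH) _; rewrite -ib.
apply: ge0_le_integral => //.
- by move=> y _; rewrite lee_fin normc_ge0.
- by apply/measurable_EFinP; exact: measurable_normc.
- apply/measurable_EFinP; apply: measurable_funM => //; apply: measurable_funM => //.
  by apply: measurable_funD; apply: measurable_normc2 => //; exact: cmeas_shift.
move=> y _; rewrite lee_fin normcM normcJ; apply: le_trans (Hh y) _.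
rewrite /b ler_wpM2l// ler_pdivlMr//.
by have := sqr_ge0 (normc (h (y + u)) - normc (h y)); nra.
Qed.

Lemma acorr_far M K H (u : vec) : bounded_in_cube M K H ->
  ~ cube (2 * M) u -> acorr H u = 0.
Proof.
move=> [_ _ H0] hu; rewrite /acorr.
have -> : (fun y : vec => complex.Re (H (y + u) * (H y)^*)) = (cst 0 : vec -> R).
  apply/funext => y /=; have [yM|yM] := pselect (cube M y); last first.
    by rewrite (H0 _ yM) conjC0 mulr0.
  rewrite (H0 (y + u)) ?mul0r// => yuM; apply: hu => i /=.
  have := yuM i; have := yM i; rewrite /= mxE => h1 h2.
  have -> : u ord0 i = (y ord0 i + u ord0 i) - y ord0 i by ring.
  by apply: le_trans (ler_normB _ _) _; lra.
by rewrite Rintegral_cst// mul0r.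
Qed.

Lemma measurable_acorr H : cmeas H -> measurable_fun setT (acorr H).
Proof.
move=> mH.
apply: (@measurable_Rintegral_section _ _ _ _ R leb
  (fun p : vec * vec => complex.Re (H (p.2 + p.1) * (H p.2)^*))).
apply: (proj1 (@cmeasM _ _ R (fun p : vec * vec => H (p.2 + p.1))
  (fun p => (H p.2)^*) _ _)).
  apply: (cmeas_comp mH); apply: measurable_rVD => //.
by apply: cmeasJ; exact: (cmeas_comp mH).
Qed.

Lemma shift_cont_L1 (g : vec -> R) (M K : R) :
  measurable_fun setT g -> (forall x, `|g x| <= K) ->
  forall e : R, 0 < e -> exists2 delta : R, 0 < delta &
    forall u : vec, (forall i, `|u ord0 i| <= delta) ->
    (\int[leb]_y (`|g (y + u) - g y| * \1_(cube M) y)%:E <= e%:E)%E.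
Proof.
move=> mg gK e e0.
have K0 : 0 <= K by exact: le_trans (normr_ge0 _) (gK 0).
have mQ := @measurable_cube R d M.
pose c := fine (leb (cube M)).
have cE : leb (cube M) = c%:E.
  by rewrite fineK// ge0_fin_numE//; exact: leb_cube_lty.
have c0 : 0 <= c by rewrite fine_ge0.
(* [g] moves by at most [eps] off the exceptional set [S] and by at most [2 * K] on it. The choices
   of [eps] and [e2] bound each contribution by [e / 2]. *)
pose eps := e / (2 * (c + 1)).
have eps0 : 0 < eps by rewrite divr_gt0// mulr_gt0// ltr_pwDr.
pose e2 := e / (2 * (2 * K + 1)).
have e20 : 0 < e2 by rewrite divr_gt0// mulr_gt0// ltr_pwDr// mulr_ge0.
have [delta d0 hd] := shift_cont_fun mg gK M eps0 e20.
exists delta => // u /hd{hd}.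
set S := _ `&` _ => hS.
have mS : measurable S.
  apply: measurableI => //.
  have mh : measurable_fun setT (fun y : vec => `|g (y + u) - g y|).
    apply: measurableT_comp => //; apply: measurable_funB => //.
    by apply: measurableT_comp => //; exact: measurable_rVD.
  have := @measurable_itv R `]eps, +oo[ => mI.
  have := mh measurableT _ mI; rewrite setTI.
  by congr (_ _); apply/seteqP; split => y /=; rewrite in_itv /= andbT.
have mi (B : set vec) : measurable B -> measurable_fun setT (\1_B : vec -> R).
  by move=> mB; exact: measurable_indic.
apply: (@le_trans _ _ (\int[leb]_y ((eps * \1_(cube M) y)%:E +
   (2 * K * \1_S y)%:E))%E).
  apply: ge0_le_integral => //.
  - apply/measurable_EFinP; apply: measurable_funM; last exact: mi.
    apply: measurableT_comp => //; apply: measurable_funB => //.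
    by apply: (measurableT_comp mg); exact: measurable_shift.
  - by apply: emeasurable_funD; apply/measurable_EFinP; apply: measurable_funM => //;
      exact: mi.
  - move=> y _; rewrite -EFinD lee_fin !indicE.
    have [yQ|yQ] := boolP (y \in cube M); rewrite /= ?mulr0 ?mulr1; last first.
      by rewrite add0r !mulr_ge0.
    have [h|h] := leP `|g (y + u) - g y| eps.
      by apply: le_trans h _; rewrite lerDl !mulr_ge0.
    rewrite (_ : y \in S = true) ?mulr1; last first.
      by apply/mem_set; split => //; exact: set_mem.
    apply: le_trans (ler_normB _ _) _; have := gK y; have := gK (y + u).
    by move: (ltW eps0); lra.
have K20 : 0 <= 2 * K by rewrite mulr_ge0.
rewrite ge0_integralD//; last 4 first.
- by move=> y _; rewrite lee_fin mulr_ge0// ltW.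
- by apply/measurable_EFinP; apply: measurable_funM => //; exact: mi.
- by move=> y _; rewrite lee_fin mulr_ge0.
- by apply/measurable_EFinP; apply: measurable_funM => //; exact: mi.
under eq_integral do rewrite EFinM.
under [X in (_ + X)%E]eq_integral do rewrite EFinM.
rewrite !ge0_integralZl_EFin ?(ltW eps0)//;
  [|by apply/measurable_EFinP; exact: mi..].
rewrite !integral_leb_indic// cE.
apply: le_trans (leeD2l _ (lee_wpmul2l _ hS)) _; first by rewrite lee_fin.
rewrite -!EFinM -EFinD lee_fin.
have h1 : eps * (c + 1) = e / 2.
  by rewrite /eps; field; rewrite gt_eqF// ltr_pwDr.
have h2 : e2 * (2 * K + 1) = e / 2.
  by rewrite /e2; field; rewrite gt_eqF// ltr_pwDr.
by lra.
Qed.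

Lemma acorr_cont M K H : bounded_in_cube M K H ->
  forall e : R, 0 < e -> exists2 delta : R, 0 < delta &
    forall u : vec, (forall i, `|u ord0 i| <= delta) ->
    `|acorr H u - acorr H 0| <= e.
Proof.
move=> bH e e0; have [mH HK H0] := bH.
have K0 : 0 <= K by exact: le_trans (normc_ge0 _) (HK 0).
(* The change of the autocorrelation is at most [K] times the [L^1] changes of the real and of the
   imaginary part of [H] on the cube, each at most [e1]. *)
pose e1 := e / (2 * (K + 1)).
have e10 : 0 < e1 by rewrite divr_gt0// mulr_gt0// ltr_pwDr.
have [d1 d10 h1] := shift_cont_L1 M mH.1
  (fun x => le_trans (normr_Re_le _) (HK x)) e10.
have [d2 d20 h2] := shift_cont_L1 M mH.2
  (fun x => le_trans (normr_Im_le _) (HK x)) e10.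
exists (Num.min d1 d2); first by rewrite lt_min d10.
move=> u hu.
have m1 : Num.min d1 d2 <= d1 by rewrite ge_min lexx.
have m2 : Num.min d1 d2 <= d2 by rewrite ge_min lexx orbT.
have {}h1 := h1 u (fun i => le_trans (hu i) m1).
have {}h2 := h2 u (fun i => le_trans (hu i) m2).
have iH := bounded_in_cube_cintble bH.
have i1 (v : vec) : cintble leb (fun y : vec => H (y + v) * (H y)^*).
  apply: (@cintble_bndM _ _ _ _ K (fun y : vec => H (y + v))) => //.
  - exact: cmeas_shift.
  - exact: cintbleJ.
rewrite -lee_fin.
have -> : acorr H u - acorr H 0 =
  complex.Re (cint leb (fun y : vec => (H (y + u) - H y) * (H y)^*)).
  rewrite [in RHS](@cint_ext _ _ _ _ _
    (fun y : vec => H (y + u) * (H y)^* - H (y + 0) * (H y)^*)).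
    by rewrite cintB// ReD ReN.
  by move=> y; rewrite addr0 mulrBl.
have mD : cmeas (fun y : vec => H (y + u) - H y) by apply: cmeasB => //; exact: cmeas_shift.
have iD : cintble leb (fun y : vec => (H (y + u) - H y) * (H y)^*).
  under eq_fun do rewrite mulrBl.
  have := i1 0; under eq_fun do rewrite addr0.
  by move=> i0; exact: cintbleB.
apply: (@le_trans _ _
  (normc (cint leb (fun y : vec => (H (y + u) - H y) * (H y)^*)))%:E).
  by rewrite lee_fin; exact: normr_Re_le.
apply: le_trans (normc_cint_le iD) _.
have mi : measurable_fun setT (\1_(cube M) : vec -> R).
  by apply: measurable_indic; exact: measurable_cube.
pose r (y : vec) := `|complex.Re (H (y + u)) - complex.Re (H y)| * \1_(cube M) y.
pose s (y : vec) := `|complex.Im (H (y + u)) - complex.Im (H y)| * \1_(cube M) y.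
have mr : measurable_fun setT r.
  apply: measurable_funM => //; apply: measurableT_comp => //.
  by apply: measurable_funB; [exact: (cmeas_shift u mH).1|exact: mH.1].
have ms : measurable_fun setT s.
  apply: measurable_funM => //; apply: measurableT_comp => //.
  by apply: measurable_funB; [exact: (cmeas_shift u mH).2|exact: mH.2].
apply: (@le_trans _ _ (\int[leb]_y (K%:E * ((r y)%:E + (s y)%:E)))%E).
  apply: ge0_le_integral => //.
  - by move=> y _; rewrite lee_fin normc_ge0.
  - by apply/measurable_EFinP; apply: measurable_normc; exact: iD.1.
  - apply: emeasurable_funM => //.
    by apply: emeasurable_funD; exact/measurable_EFinP.
  - move=> y _; rewrite -EFinD -EFinM lee_fin normcM normcJ /r /s indicE.
    have [yQ|yQ] := boolP (y \in cube M); rewrite /= ?mulr0 ?mulr1; last first.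
      rewrite notin_setE in yQ; rewrite (H0 y)//.
      by rewrite (_ : normc 0 = 0) ?normc0// mulr0 addr0 mulr0.
    rewrite mulrC ler_pM ?normc_ge0//.
    by apply: le_trans (normc_le_ReIm _) _; rewrite !ReD !ImD !ReN !ImN.
rewrite ge0_integralZl_EFin//; last 2 first.
- by move=> y _; rewrite adde_ge0// lee_fin mulr_ge0.
- by apply: emeasurable_funD; exact/measurable_EFinP.
rewrite ge0_integralD//; last 4 first.
- by move=> y _; rewrite lee_fin mulr_ge0.
- exact/measurable_EFinP.
- by move=> y _; rewrite lee_fin mulr_ge0.
- exact/measurable_EFinP.
apply: le_trans (lee_wpmul2l _ (leeD h1 h2)) _; first by rewrite lee_fin.
rewrite -EFinD -EFinM lee_fin /e1.
have k1 : 0 < K + 1 by rewrite ltr_pwDr.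
have -> : e / (2 * (K + 1)) + e / (2 * (K + 1)) = e / (K + 1).
  by field; rewrite gt_eqF.
by rewrite mulrA ler_pdivrMr//; nra.
Qed.

End autocorrelation.

(** * The Fejer kernel of period [L] *)

Section fejer_kernel.
Context {R : realType}.
Variable L : R.
Hypothesis L0 : 0 < L.

(** Normalized to have mean 1 over a period. The double cosine sum has an explicit primitive, while
    [fejer_normc] shows the sign. *)
Definition fejer (n : nat) (t : R) : R := n%:R^-1 *
  \sum_(j < n) \sum_(k < n) cos (2 * pi / L * (j%:R - k%:R) * t).

Lemma fejer_normc n t : fejer n t =
  n%:R^-1 * normc (\sum_(j < n) cis (2 * pi / L * j%:R * t)) ^+ 2.
Proof.
rewrite /fejer; congr (_ * _).
have -> : normc (\sum_(j < n) cis (2 * pi / L * j%:R * t)) ^+ 2 =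
  complex.Re ((\sum_(j < n) cis (2 * pi / L * j%:R * t)) *
    ((\sum_(j < n) cis (2 * pi / L * j%:R * t))^*)%R) by rewrite mulcJ.
rewrite rmorph_sum mulr_suml Re_sum; apply: eq_bigr => j _.
rewrite mulr_sumr Re_sum; apply: eq_bigr => k _.
transitivity (complex.Re (cis (2 * pi / L * j%:R * t) *
    cis (- (2 * pi / L * k%:R * t)))); last by rewrite cisN.
by rewrite -cisD /=; congr cos; ring.
Qed.

Lemma fejer_ge0 n t : 0 <= fejer n t.
Proof. by rewrite fejer_normc mulr_ge0 ?invr_ge0 ?sqr_ge0. Qed.

Lemma fejer_le n t : fejer n t <= n%:R.
Proof.
rewrite /fejer; have [->|n0] := posnP n; first by rewrite big_ord0 mulr0.
rewrite mulrC ler_pdivrMr ?ltr0n//.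
apply: (@le_trans _ _ (\sum_(j < n) \sum_(k < n) 1)).
  by apply: ler_sum => j _; apply: ler_sum => k _; exact: cos_le1.
by rewrite !sumr_const !card_ord mulr_natr.
Qed.

Lemma continuous_fejer n : continuous (fejer n).
Proof.
have csum (I : Type) (s : seq I) (f : I -> R -> R) :
    (forall i, continuous (f i)) -> continuous (fun t => \sum_(i <- s) f i t).
  move=> cf; elim: s => [|i s IH] t.
    by under eq_fun do rewrite big_nil; exact: cvg_cst.
  by under eq_fun do rewrite big_cons; apply: cvgD; [exact: cf|exact: IH].
move=> t; apply: cvgM; first exact: cvg_cst.
apply: (csum) => j; apply: (csum) => k {}t.
apply: (@continuous_comp _ _ _ (fun s => 2 * pi / L * (j%:R - k%:R) * s) cos).
  exact: mulrl_continuous.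
exact: continuous_cos.
Qed.

Lemma measurable_fejer n : measurable_fun setT (fejer n).
Proof. by apply: continuous_measurable_fun; exact: continuous_fejer. Qed.

Let w0 : 0 < 2 * pi / L.
Proof. by rewrite divr_gt0// mulr_gt0// pi_gt0. Qed.

Let prim (j k : nat) (t : R) : R := if j == k then t else
  sin (2 * pi / L * (j%:R - k%:R) * t) / (2 * pi / L * (j%:R - k%:R)).

Let prim_derive (j k : nat) (t : R) :
  is_derive t 1 (prim j k) (cos (2 * pi / L * (j%:R - k%:R) * t)).
Proof.
rewrite /prim; case: eqP => [->|/eqP jk].
  rewrite subrr mulr0 mul0r cos0; exact: is_derive_id.
set a := 2 * pi / L * (j%:R - k%:R).
have a0 : a != 0.
  by rewrite mulf_neq0 ?(gt_eqF w0)// subr_eq0 eqr_nat.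
have h : is_derive t 1 (fun s : R => a * s) a.
  have := @is_deriveZ _ _ _ (@idfun R) a t 1 _ (is_derive_id t 1).
  by rewrite [a *: 1]mulr1.
have h2 := @is_derive1_comp R sin (fun s : R => a * s) t _ _ (is_derive_sin _) h.
have : is_derive t 1 (a^-1 *: (sin \o (fun s : R => a * s)))
    (a^-1 *: (cos (a * t) * a)) by apply: is_deriveZ.
rewrite [X in is_derive _ _ X _ -> _](_ : _ = (fun s => sin (a * s) / a)).
  suff -> : a^-1 *: (cos (a * t) * a) = cos (a * t) by [].
  by rewrite /GRing.scale /= mulrC mulfK.
by apply/funext => s; rewrite [RHS]mulrC.
Qed.

Let prim_period (j k : nat) (c : R) :
  prim j k (c + L) - prim j k c = if j == k then L else 0.
Proof.
rewrite /prim; case: eqP => [_|/eqP jk]; first by ring.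
have sinper (x : R) (m : nat) : sin (x + m%:R * (2 * pi)) = sin x.
  have -> : m%:R * (2 * pi) = (pi *+ 2) *+ m :> R by rewrite -[RHS]mulr_natl -[in RHS](mulr_natl pi 2).
  by apply: periodicn; exact: sinD2pi.
have -> : 2 * pi / L * (j%:R - k%:R) * (c + L) =
    2 * pi / L * (j%:R - k%:R) * c + (j%:R - k%:R) * (2 * pi).
  by field; rewrite gt_eqF.
rewrite (_ : sin (_ + _) = sin (2 * pi / L * (j%:R - k%:R) * c)) ?subrr//.
have [kj|jk'] := leqP k j; first by rewrite -natrB// sinper.
rewrite -[LHS](sinper _ (k - j)%N) natrB ?(ltnW jk')//; congr sin; ring.
Qed.

(** The primitives of the off-diagonal cosines are [L]-periodic and cancel; each of the [n] diagonal
    terms contributes [L]. *)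
Lemma fejer_integral n (c : R) : (0 < n)%N ->
  (\int[lebesgue_measure]_(t in `[c, (c + L)%R]) (fejer n t)%:E = L%:E)%E.
Proof.
move=> n0.
pose F (t : R) : R := n%:R^-1 * \sum_(j < n) \sum_(k < n) prim j k t.
have dF (t : R) : is_derive t 1 F (fejer n t).
  rewrite /F /fejer.
  have h : is_derive t 1 (\sum_(j < n) \sum_(k < n) prim j k)
    (\sum_(j < n) \sum_(k < n) cos (2 * pi / L * (j%:R - k%:R) * t)).
    have hs (N : nat) (f : 'I_N -> R -> R) (df : 'I_N -> R) :
        (forall i, is_derive t 1 (f i) (df i)) ->
        is_derive t 1 (\sum_(i < N) f i) (\sum_(i < N) df i).
      by move=> h; exact: is_derive_sum.
    by apply: (hs) => j; apply: (hs) => k; exact: prim_derive.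
  have := @is_deriveZ _ _ _ (\sum_(j < n) \sum_(k < n) prim j k) n%:R^-1 t 1 _ h.
  rewrite [X in is_derive _ _ X _ -> _](_ : _ = F)//.
  apply/funext => s /=; rewrite /F /GRing.scale /=; congr (_ * _).
  by rewrite fct_sumE; apply: eq_bigr => j _; rewrite fct_sumE.
rewrite (@continuous_FTC2 R (fejer n) F).
- rewrite -EFinB; congr EFin; rewrite /F -mulrBr -sumrB.
  rewrite (eq_bigr (fun=> L)); last first.
    move=> j _; rewrite -sumrB (bigD1 j)//= prim_period eqxx big1 ?addr0//.
    by move=> k kj; rewrite prim_period eq_sym (inj_eq val_inj) (negbTE kj).
  by rewrite sumr_const card_ord -[L *+ n]mulr_natl mulKf// pnatr_eq0 -lt0n.
- by rewrite ltrDl.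
- by apply: continuous_subspaceT => t; exact: continuous_fejer.
- split.
  + by move=> t _; have [] := dF t.
  + apply: cvg_at_right_filter; apply: differentiable_continuous.
    by apply/derivable1_diffP; have [] := dF c.
  + apply: cvg_at_left_filter; apply: differentiable_continuous.
    by apply/derivable1_diffP; have [] := dF (c + L).
- by move=> t _; rewrite derive1E; have [_ ->] := dF t.
Qed.

(** With [z] the character at [t], the geometric sum satisfies
    [|1 - z|^2 * |sum|^2 = |1 - z^n|^2 <= 4], and [|1 - z|^2 = 2 - 2 cos] is at least its value
    [kap] at [delta], since the cosine decreases on half a period. *)
Lemma fejer_away (delta : R) : 0 < delta -> delta <= L / 2 ->
  exists2 C : R, 0 <= C & forall n t, (0 < n)%N ->
    delta <= `|t| <= L / 2 -> fejer n t <= C / n%:R.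
Proof.
move=> d0 dL; pose kap : R := 2 - 2 * cos (2 * pi / L * delta).
have wL (x : R) : 0 <= x -> x <= L / 2 -> 2 * pi / L * x \in `[0, pi].
  move=> x0 xL; rewrite in_itv /=; apply/andP; split.
    by rewrite mulr_ge0// ltW.
  have e : pi = 2 * pi / L * (L / 2) :> R by field; rewrite gt_eqF.
  by rewrite [leRHS]e ler_wpM2l// ltW.
have kap0 : 0 < kap.
  rewrite /kap; have : cos (2 * pi / L * delta) < cos 0.
    rewrite ltr_cos ?wL ?(ltW d0)//.
      by rewrite mulr_gt0// divr_gt0// mulr_gt0// pi_gt0.
    by rewrite in_itv /= lexx pi_ge0.
  by rewrite cos0; lra.
exists (4 / kap); first by rewrite divr_ge0// ltW.
move=> n t n0 /andP[dt tL].
rewrite fejer_normc mulrC ler_wpM2r ?invr_ge0//.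
set z := cis (2 * pi / L * t).
have zX j : cis (2 * pi / L * j%:R * t) = z ^+ j.
  elim: j => [|j IH]; first by rewrite mulr0 mul0r cis0 expr0.
  by rewrite exprS -IH -cisD -natr1; congr cis; ring.
have z1 : normc (1 - z) ^+ 2 >= kap.
  have -> : normc (1 - z) ^+ 2 = 2 - 2 * cos (2 * pi / L * t).
    rewrite sqr_normc /z ReD ImD ReN ImN /=.
    by have := cos2Dsin2 (2 * pi / L * t); nra.
  rewrite /kap -[X in _ <= 2 - 2 * X]cos_norm normrM ger0_norm; last first.
    by rewrite divr_ge0 ?(ltW L0)// mulr_ge0// pi_ge0.
  have : cos (2 * pi / L * `|t|) <= cos (2 * pi / L * delta).
    rewrite leNgt ltr_cos ?wL// ?(ltW d0)// -leNgt.
    by rewrite ler_wpM2l// ltW.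
  by lra.
have zs : normc (\sum_(j < n) cis (2 * pi / L * j%:R * t)) ^+ 2 * kap <= 4.
  apply: (@le_trans _ _
    (normc (\sum_(j < n) cis (2 * pi / L * j%:R * t)) ^+ 2 * normc (1 - z) ^+ 2)).
    by rewrite ler_wpM2l ?sqr_ge0.
  rewrite -exprMn -normcM mulrC (eq_bigr (fun j : 'I_n => z ^+ j)) => [|j _]//.
  have -> : (1 - z) * (\sum_(j < n) z ^+ j) = 1 - z ^+ n.
    by rewrite -[RHS]opprB subrX1 -mulNr opprB.
  have -> : 4 = 2 ^+ 2 :> R by rewrite expr2; ring.
  rewrite lerXn2r ?nnegrE ?normc_ge0//.
  apply: le_trans (le_normcD _ _) _; rewrite normcN normcX normc_cis expr1n.
  by rewrite (_ : normc 1 = 1) ?normc1.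
by rewrite ler_pdivlMr.
Qed.

End fejer_kernel.

(** * Mass of the Fejer kernel on the central cell, away from 0, and against the tail weight *)

Section fejer_integrals.
Context {R : realType}.
Variable L : R.
Hypothesis L0 : 0 < L.
Local Notation mu := (@lebesgue_measure R).
Local Notation fejer := (@fejer R L).

Definition cell : set R := `[- (L / 2), L / 2]%classic.

Lemma measurable_fejerM n (g : R -> R) : measurable_fun setT g ->
  measurable_fun setT (fun t => fejer n t * g t).
Proof. by move=> mg; apply: measurable_funM => //; exact: measurable_fejer. Qed.

Lemma integral_indicM (A : set R) (g : R -> R) : measurable A ->
  (\int[mu]_t (g t * \1_A t)%:E = \int[mu]_(t in A) (g t)%:E)%E.
Proof.
move=> mA; rewrite [RHS]integral_mkcond; apply: eq_integral => t _.
by rewrite patchE indicE; case: ifP => _; rewrite ?mulr1 ?mulr0.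
Qed.

Lemma fejer_cell n : (0 < n)%N ->
  (\int[mu]_t (fejer n t * \1_cell t)%:E = L%:E)%E.
Proof.
move=> n0; rewrite integral_indicM; last exact: measurable_itv.
have e : L / 2 = - (L / 2) + L by field.
by rewrite /cell [X in `[_, X]%classic]e fejer_integral.
Qed.

Lemma fejer_shell (delta : R) : 0 < delta -> delta <= L / 2 ->
  exists2 C : R, 0 <= C & forall n, (0 < n)%N ->
  (\int[mu]_t (fejer n t * \1_(cell `&` [set t | delta < `|t|]) t)%:E
     <= (C / n%:R)%:E)%E.
Proof.
move=> d0 dL; have [C C0 hC] := fejer_away L0 d0 dL.
have mS : measurable (cell `&` [set t : R | delta < `|t|]).
  apply: measurableI; first exact: measurable_itv.
  have := @normr_measurable R setT measurableT _ (@measurable_itv R `]delta, +oo[).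
  by rewrite setTI; congr (_ _); apply/seteqP; split => t /=; rewrite in_itv /= andbT.
exists (C * L); first by rewrite mulr_ge0// ltW.
move=> n n0.
have Cn0 : 0 <= C / n%:R by rewrite divr_ge0.
apply: (@le_trans _ _ (\int[mu]_t ((C / n%:R)%:E * (\1_cell t)%:E))%E).
  apply: ge0_le_integral => //.
  - by move=> t _; rewrite lee_fin mulr_ge0// fejer_ge0.
  - by apply/measurable_EFinP; apply: measurable_fejerM; exact: measurable_indic.
  - apply/measurable_EFinP; apply: measurable_funM => //; apply: measurable_indic.
    exact: measurable_itv.
  - move=> t _; rewrite -EFinM lee_fin !indicE.
    have [tS|tS] := boolP (t \in _ `&` _); last by rewrite mulr0 mulr_ge0.
    move/set_mem : (tS) => -[tc /= td]; rewrite (mem_set tc) !mulr1.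
    apply: hC => //; rewrite (ltW td) /=.
    by move: tc; rewrite /cell /= in_itv /= -ler_norml.
rewrite ge0_integralZl_EFin//; last first.
  by apply/measurable_EFinP; apply: measurable_indic; exact: measurable_itv.
have -> : (\int[mu]_t (\1_cell t)%:E)%E = L%:E.
  rewrite integral_indic//; last exact: measurable_itv.
  rewrite setIT; transitivity (L / 2 - - (L / 2))%:E; last by congr EFin; field.
  by apply: lebesgue_measure_itvcc; lra.
by rewrite -EFinM lee_fin le_eqVlt; apply/orP; left; apply/eqP; field; rewrite pnatr_eq0 -lt0n.
Qed.

(* Dominates [min 4 ((L / t) ^+ 2)], while its mass against the Fejer kernel is
   bounded by a telescoping series over the periods. *)
Definition tailw (t : R) : R := 5 / (1 + (t / L) ^+ 2).

Lemma tailw_ge0 t : 0 <= tailw t.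
Proof. by rewrite divr_ge0// addr_ge0// sqr_ge0. Qed.

Lemma measurable_tailw : measurable_fun setT tailw.
Proof.
apply: continuous_measurable_fun => t; apply: cvgM; first exact: cvg_cst.
apply: cvgV; first by rewrite gt_eqF// ltr_pwDl// sqr_ge0.
apply: cvgD; first exact: cvg_cst.
under eq_fun do rewrite expr2; rewrite expr2.
by apply: cvgM; exact: mulrr_continuous.
Qed.

(** The 5 in [tailw] is [4 + 1]: [(L / s)^2 <= 4] because [s >= L / 2], and
    [(L / s)^2 * (t / L)^2 <= 1] because [|t| <= s]. With [s] the largest coordinate of a vector, a
    power of [L / s] is thus bounded by a product over the coordinates. *)
Lemma tailw_ge (t s : R) : L / 2 <= s -> `|t| <= s -> (L / s) ^+ 2 <= tailw t.
Proof.
move=> sL ts; have s0 : 0 < s by apply: lt_le_trans sL; rewrite divr_gt0.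
have p0 : 0 < 1 + (t / L) ^+ 2 by rewrite ltr_pwDl// sqr_ge0.
rewrite /tailw ler_pdivlMr// mulrDr mulr1.
have h1 : (L / s) ^+ 2 <= 4.
  have -> : 4 = 2 ^+ 2 :> R by rewrite expr2; ring.
  rewrite lerXn2r ?nnegrE ?divr_ge0 ?(ltW L0) ?(ltW s0)//.
  by rewrite ler_pdivrMr//; lra.
have h2 : (L / s) ^+ 2 * (t / L) ^+ 2 <= 1.
  rewrite -exprMn (_ : L / s * (t / L) = t / s); last first.
    by field; rewrite !gt_eqF.
  rewrite -real_normK ?num_real// normrM normfV (ger0_norm (ltW s0)).
  by rewrite exprn_ile1 ?divr_ge0 ?(ltW s0)// ler_pdivrMr// mul1r.
by lra.
Qed.

Lemma fejer_tailw n : (0 < n)%N ->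
  (\int[mu]_t (fejer n t * tailw t)%:E <= (30 * L)%:E)%E.
Proof.
move=> n0.
(* On the two periods at distance [m * L] from 0, one on each side, [tailw] is at most
   [5 / (1 + m^2)], hence at most [15 / ((m+1)(m+2)) = a m]. The [a m] telescope to 15, and each
   counts for two periods of mass [L]: this gives 30. *)
pose a (m : nat) : R := 15 * (m.+1%:R^-1 - m.+2%:R^-1).
have a0 m : 0 <= a m.
  by rewrite mulr_ge0// subr_ge0 lef_pV2 ?posrE ?ltr0n// ler_nat.
have mI (c : R) : measurable `[c, (c + L)]%classic by exact: measurable_itv.
pose G (m : nat) (t : R) : \bar R := (a m * (fejer n t * \1_`[(m%:R * L), (m%:R * L + L)] t) +
  a m * (fejer n t * \1_`[- (m.+1%:R * L), - (m.+1%:R * L) + L] t))%:E.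
have G1 m (c : R) : measurable_fun setT (fun t => a m * (fejer n t * \1_`[c, c + L] t)).
  apply: measurable_funM => //; apply: measurable_fejerM; exact: measurable_indic.
have G0 m t : (0 <= G m t)%E.
  by rewrite lee_fin addr_ge0// mulr_ge0// mulr_ge0// fejer_ge0.
have mG m : measurable_fun setT (G m).
  by apply/measurable_EFinP; exact: measurable_funD.
have iG m : (\int[mu]_t G m t = (2 * L * a m)%:E)%E.
  rewrite /G; under eq_integral do rewrite EFinD.
  have one (c : R) :
    (\int[mu]_t (a m * (fejer n t * \1_`[c, c + L] t))%:E = (a m * L)%:E)%E.
    under eq_integral do rewrite EFinM.
    rewrite ge0_integralZl_EFin//; last 2 first.
    - by move=> t _; rewrite lee_fin mulr_ge0// fejer_ge0.
    - by apply/measurable_EFinP; apply: measurable_fejerM; exact: measurable_indic.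
    by rewrite integral_indicM// fejer_integral// -EFinM.
  rewrite ge0_integralD//; last 4 first.
  - by move=> t _; rewrite lee_fin mulr_ge0// mulr_ge0// fejer_ge0.
  - by apply/measurable_EFinP; exact: G1.
  - by move=> t _; rewrite lee_fin mulr_ge0// mulr_ge0// fejer_ge0.
  - by apply/measurable_EFinP; exact: G1.
  by rewrite !one -EFinD; congr EFin; ring.
apply: (@le_trans _ _ (\int[mu]_t (\sum_(m <oo) G m t))%E).
  apply: ge0_le_integral => //.
  - by move=> t _; rewrite lee_fin mulr_ge0// ?fejer_ge0 ?tailw_ge0.
  - by apply/measurable_EFinP; apply: measurable_fejerM; exact: measurable_tailw.
  - by apply: (@ge0_emeasurable_sum _ _ _ _ G xpredT) => [m t _ _|m _]; [exact: G0|exact: mG].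
  move=> t _; pose m := Num.truncn (`|t| / L).
  have tL0 : 0 <= `|t| / L by rewrite divr_ge0// ltW.
  have m1 : m%:R * L <= `|t|.
    by rewrite -ler_pdivlMr//; have := truncn_le (`|t| / L); rewrite tL0.
  have m2 : `|t| <= m%:R * L + L.
    have := ltW (truncnS_gt (`|t| / L)); rewrite ler_pdivrMr// -/m -natr1.
    by rewrite mulrDl mul1r.
  have ta : tailw t <= a m.
    rewrite /tailw ler_pdivrMr ?ltr_pwDl ?sqr_ge0//.
    have M : m%:R ^+ 2 <= (t / L) ^+ 2.
      rewrite -[leRHS]real_normK ?num_real// normrM normfV (ger0_norm (ltW L0)).
      by rewrite lerXn2r ?nnegrE// ler_pdivlMr.
    have -> : a m = 15 / (m.+1%:R * m.+2%:R).
      rewrite /a -!natr1; field.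
      by rewrite !natr1 !pnatr_eq0.
    apply: (@le_trans _ _ (15 / (m.+1%:R * m.+2%:R) * (1 + m%:R ^+ 2))); last first.
      by rewrite ler_wpM2l ?divr_ge0 ?mulr_ge0// lerD2l.
    rewrite mulrAC ler_pdivlMr ?mulr_gt0 ?ltr0n//.
    (* This product is [3 (1 + m^2) - (m+1)(m+2)]; it is negative only strictly between 1/2 and 1,
       where there is no natural number. *)
    have : 0 <= (2 * m%:R - 1) * (m%:R - 1) :> R.
      case: (m) => [|k]; first by rewrite !sub0r mulr0 sub0r mulrNN mulr1.
      by rewrite -natr1 mulr_ge0//; have := ler0n R k; lra.
    by rewrite -!natr1; move: (m%:R : R) => x; nra.
  apply: (@le_trans _ _ (G m t)); last first.
    have := @nneseries_lim_ge R (fun k => G k t) xpredT 0%N m.+1 (fun k _ _ => G0 k t).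
    apply: le_trans; rewrite big_nat_recr//= leeDr//.
    apply: sume_ge0 => k _.
    exact: G0.
  rewrite /G -mulrDr lee_fin mulrC.
  apply: (@le_trans _ _ (a m * fejer n t)).
    by rewrite ler_wpM2r// fejer_ge0.
  rewrite -mulrDr mulrA ler_peMr//; first exact: (mulr_ge0 (a0 m) (fejer_ge0 L n t)).
  rewrite !indicE.
  have [t0|t0] := leP 0 t.
    rewrite (_ : t \in _ = true) ?lerDl//; apply/mem_set => /=; rewrite in_itv /=.
    by move: m1 m2; rewrite ger0_norm// => -> ->.
  rewrite (_ : (t \in `[- (m.+1%:R * L), _]%classic) = true) ?lerDr//.
  apply/mem_set => /=; rewrite in_itv /=.
  by move: m1 m2; rewrite ltr0_norm// -natr1 => ? ?; apply/andP; split; lra.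
rewrite integral_nneseries//.
under eq_eseriesr do rewrite iG.
apply: lime_le; first by apply: is_cvg_nneseries => m _ _; rewrite lee_fin mulr_ge0// mulr_ge0// ltW.
near=> N; rewrite sumEFin lee_fin -mulr_sumr -mulr_sumr.
have -> : \sum_(0 <= k < N) (k.+1%:R^-1 - k.+2%:R^-1 : R) = 1 - N.+1%:R^-1.
  rewrite (@telescope_sumr_eq _ 0 N (fun k => - (k.+1%:R^-1 : R)))//.
    by rewrite opprK invr1 addrC.
  by move=> k _; rewrite opprK addrC.
have : 0 <= N.+1%:R^-1 :> R by rewrite invr_ge0.
by move: (N.+1%:R^-1 : R) => q q0; have := mulr_ge0 (ltW L0) q0; lra.
Unshelve. all: by end_near. Qed.

End fejer_integrals.

(** * Products of Fejer kernels as an approximate identity on the central cube *)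

Section fejer_product.
Context {R : realType} {d : nat}.
Local Notation vec := 'rV[R]_d.
Local Notation leb := (@lebesgue_measure_rV R d).
Variable L : R.
Hypothesis L0 : 0 < L.

Definition fejerd n (u : vec) : R := \prod_(i < d) fejer L n (u ord0 i).

Lemma fejerd_ge0 n u : 0 <= fejerd n u.
Proof. by apply: prodr_ge0 => i _; exact: fejer_ge0. Qed.

Lemma fejerd_le n u : fejerd n u <= n%:R ^+ d.
Proof.
rewrite -[X in _ ^+ X]card_ord -prodr_const; apply: ler_prod => i _.
by rewrite fejer_ge0 fejer_le.
Qed.

Lemma measurable_fejerd n : measurable_fun setT (fejerd n).
Proof.
apply: measurable_prod => i _.
apply: (measurableT_comp (measurable_fejer L n)); exact: measurable_rV_coord.
Qed.

Let Q : set vec := cube (L / 2).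

Let mQ : measurable Q. Proof. exact: measurable_cube. Qed.

Lemma indic_cubeE (u : vec) : \1_Q u = \prod_(i < d) \1_(cell L) (u ord0 i) :> R.
Proof.
rewrite indicE; have [uQ|uQ] := boolP (u \in Q).
  rewrite big1// => i _; rewrite indicE mem_set// /cell /= in_itv /= -ler_norml.
  exact: (set_mem uQ).
have [i hi] : exists i, ~ cell L (u ord0 i).
  apply/existsNP => h; move/negP: uQ; apply; apply/mem_set => i /=.
  by have := h i; rewrite /cell /= in_itv /= -ler_norml.
by rewrite (bigD1 i)//= indicE memNset// mul0r.
Qed.

Lemma fejerd_cube n : (0 < n)%N ->
  (\int[leb]_u (fejerd n u * \1_Q u)%:E = (L ^+ d)%:E)%E.
Proof.
move=> n0; under eq_integral do rewrite indic_cubeE /fejerd -big_split /=.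
rewrite (@integral_leb_prod R d (fun _ t => fejer L n t * \1_(cell L) t)).
- rewrite (eq_bigr (fun=> L%:E)) => [|i _]; last exact: fejer_cell.
  by rewrite prodEFin prodr_const card_ord.
- by move=> _; apply: measurable_fejerM; apply: measurable_indic; exact: measurable_itv.
- by move=> _ t; rewrite mulr_ge0// fejer_ge0.
Qed.

Lemma fejerd_tailw n : (0 < n)%N ->
  (\int[leb]_u (fejerd n u * \prod_(i < d) tailw L (u ord0 i))%:E
    <= ((30 * L) ^+ d)%:E)%E.
Proof.
move=> n0; under eq_integral do rewrite /fejerd -big_split /=.
rewrite (@integral_leb_prod R d (fun _ t => fejer L n t * tailw L t)).
- rewrite -[X in _ ^+ X]card_ord -prodr_const -prodEFin.
  suff [] : (0 <= \prod_(i < d) \int[lebesgue_measure]_t (fejer L n t * tailw L t)%:E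
    /\ \prod_(i < d) \int[lebesgue_measure]_t (fejer L n t * tailw L t)%:E <=
       \prod_(i < d) (30 * L)%:E)%E by [].
  elim/big_ind2 : _ => [//|x1 x2 y1 y2 [x10 x12] [y10 y12]|i _].
    by split; [exact: mule_ge0|exact: lee_pmul].
  split; last exact: fejer_tailw.
  by apply: integral_ge0 => t _; rewrite lee_fin mulr_ge0 ?fejer_ge0 ?tailw_ge0.
- by move=> _; apply: measurable_fejerM; exact: measurable_tailw.
- by move=> _ t; rewrite mulr_ge0 ?fejer_ge0 ?tailw_ge0.
Qed.

Let S (delta : R) (i : 'I_d) : set vec := Q `&` [set u : vec | delta < `|u ord0 i|].

Let mS delta i : measurable (S delta i).
Proof.
apply: measurableI => //.
have mh : measurable_fun setT (fun u : vec => `|u ord0 i|).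
  by apply: measurableT_comp => //; exact: measurable_rV_coord.
have := mh measurableT _ (@measurable_itv R `]delta, +oo[).
by rewrite setTI; congr (_ _); apply/seteqP; split => y /=; rewrite in_itv /= andbT.
Qed.

Lemma fejerd_shell (delta : R) : 0 < delta -> delta <= L / 2 ->
  exists2 C : R, 0 <= C & forall n (i : 'I_d), (0 < n)%N ->
  (\int[leb]_u (fejerd n u * \1_(S delta i) u)%:E <= (C / n%:R)%:E)%E.
Proof.
move=> d0 dL; have [C C0 hC] := fejer_shell L0 d0 dL.
exists (C * L ^+ d.-1); first by rewrite mulr_ge0// exprn_ge0// ltW.
move=> n i n0.
pose A (j : 'I_d) : set R :=
  if j == i then cell L `&` [set t | delta < `|t|] else cell L.
have mA j : measurable (A j).
  rewrite /A; case: ifP => _; last exact: measurable_itv.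
  apply: measurableI; first exact: measurable_itv.
  have := @normr_measurable R setT measurableT _ (@measurable_itv R `]delta, +oo[).
  by rewrite setTI; congr (_ _); apply/seteqP; split => t /=; rewrite in_itv /= andbT.
have -> : (fun u => (fejerd n u * \1_(S delta i) u)%:E) =
    (fun u : vec => (\prod_(j < d) (fejer L n (u ord0 j) * \1_(A j) (u ord0 j)))%:E).
  apply/funext => u; rewrite big_split /=; congr (_ * _)%:E.
  rewrite indicE; have [uS|uS] := boolP (u \in S delta i).
    move/set_mem : uS => -[uQ ui].
    rewrite big1// => j _; rewrite indicE mem_set// /A.
    have cj : cell L (u ord0 j) by rewrite /cell /= in_itv /= -ler_norml; exact: uQ.
    by case: eqP => // ->; split => //; rewrite /cell /= in_itv /= -ler_norml; exact: uQ.
  have [j hj] : exists j, ~ A j (u ord0 j).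
    apply/existsNP => h; move/negP: uS; apply; apply/mem_set; split.
      move=> j; have := h j; rewrite /A; case: eqP => _ => [[]|];
        by rewrite /cell /= in_itv /= -ler_norml.
    by have := h i; rewrite /A eqxx => -[].
  by rewrite (bigD1 j)//= indicE memNset// mul0r.
rewrite (@integral_leb_prod R d (fun j t => fejer L n t * \1_(A j) t)).
- rewrite (bigD1 i)//= {1}/A eqxx.
  rewrite (eq_bigr (fun=> L%:E)); last first.
    by move=> j ji; rewrite /A (negbTE ji); exact: fejer_cell.
  rewrite prodEFin prodr_const (_ : #|_| = d.-1); last first.
    by rewrite -[in RHS](card_ord d) -(cardC1 i); apply: eq_card => j; rewrite !inE.
  rewrite mulrAC EFinM; apply: lee_wpmul2r; last exact: hC.
  by rewrite lee_fin exprn_ge0// ltW.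
- by move=> j; apply: measurable_fejerM; exact: measurable_indic.
- by move=> j t; rewrite mulr_ge0// fejer_ge0.
Qed.

(** Three regions: near 0 [A] is within [e] of [A0]; in the rest of the central cube the kernel has
    mass of order [1 / n]; outside that cube the kernel has its other periodic peaks, so smallness
    must come from [A]. Hence the term in [W] does not vanish as [n] grows. *)
Lemma fejerd_approx (A : vec -> R) (A0 e W delta C : R) n :
  (0 < n)%N -> measurable_fun setT A -> 0 <= e -> 0 <= W ->
  (forall n (i : 'I_d), (0 < n)%N ->
    (\int[leb]_u (fejerd n u * \1_(S delta i) u)%:E <= (C / n%:R)%:E)%E) ->
  (forall u, `|A u| <= A0) ->
  (forall u : vec, (forall i, `|u ord0 i| <= delta) -> `|A u - A0| <= e) ->
  (forall u, ~ Q u -> `|A u| <= W * \prod_(i < d) tailw L (u ord0 i)) ->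
  `|\int[leb]_u (fejerd n u * A u) - A0 * L ^+ d| <=
    e * L ^+ d + 2 * A0 * (d%:R * (C / n%:R)) + W * (30 * L) ^+ d.
Proof.
move=> n0 mA e0 W0 hS hA near far.
have A00 : 0 <= A0 by exact: le_trans (normr_ge0 _) (hA 0).
have mF := measurable_fejerd n.
have F0 := fejerd_ge0 n.
have mi (B : set vec) : measurable B -> measurable_fun setT (\1_B : vec -> R).
  by move=> mB; exact: measurable_indic.
have mFi (B : set vec) : measurable B -> measurable_fun setT (fun u => fejerd n u * \1_B u).
  by move=> mB; apply: measurable_funM => //; exact: mi.
have mT : measurable_fun setT (fun u : vec => fejerd n u * \prod_(i < d) tailw L (u ord0 i)).
  apply: measurable_funM => //; apply: measurable_prod => i _.
  apply: (measurableT_comp (measurable_tailw L)); exact: measurable_rV_coord.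
have T0 (u : vec) : 0 <= \prod_(i < d) tailw L (u ord0 i).
  by apply: prodr_ge0 => i _; exact: tailw_ge0.
(* The subtracted function integrates to exactly [A0 * L ^+ d], so [G] carries the whole error;
   [b1], [b2], [b3] dominate it on the three regions. *)
pose G (u : vec) := fejerd n u * A u - A0 * (fejerd n u * \1_Q u).
pose b1 (u : vec) := e * (fejerd n u * \1_Q u).
pose b2 (u : vec) := 2 * A0 * \sum_(i < d) fejerd n u * \1_(S delta i) u.
pose b3 (u : vec) := W * (fejerd n u * \prod_(i < d) tailw L (u ord0 i)).
have mG : measurable_fun setT G.
  apply: measurable_funB; first exact: measurable_funM.
  by apply: measurable_funM => //; exact: mFi.
have b10 u : 0 <= b1 u by rewrite mulr_ge0// mulr_ge0.
have s0 (u : vec) : 0 <= \sum_(i < d) fejerd n u * \1_(S delta i) u.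
  by apply: sumr_ge0 => i _; rewrite mulr_ge0.
have b20 u : 0 <= b2 u by rewrite mulr_ge0// mulr_ge0.
have b30 u : 0 <= b3 u by rewrite mulr_ge0// mulr_ge0.
have mb1 : measurable_fun setT b1.
  by apply: measurable_funM => //; exact: mFi.
have mb2 : measurable_fun setT b2.
  apply: measurable_funM => //; apply: measurable_sum => i; exact: mFi.
have mb3 : measurable_fun setT b3 by exact: measurable_funM.
have Gb u : `|G u| <= b1 u + b2 u + b3 u.
  rewrite /G; have [uQ|uQ] := pselect (Q u); last first.
    rewrite (_ : \1_Q u = 0 :> R) ?mulr0 ?subr0; last by rewrite indicE memNset.
    rewrite normrM ger0_norm//; apply: (@le_trans _ _ (b3 u)).
      rewrite /b3 mulrCA ler_wpM2l//; exact: far.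
    by rewrite lerDr addr_ge0.
  have Q1 : \1_Q u = 1 :> R by rewrite indicE mem_set.
  rewrite Q1 mulr1 [A0 * _]mulrC -mulrBr normrM ger0_norm//.
  apply: (@le_trans _ _ (b1 u + b2 u)); last by rewrite lerDl.
  have [h|/existsNP[i hi]] := pselect (forall i, `|u ord0 i| <= delta).
    apply: (@le_trans _ _ (b1 u)); last by rewrite lerDl.
    by rewrite /b1 Q1 mulr1 mulrC ler_wpM2r//; exact: near.
  apply: (@le_trans _ _ (b2 u)); last by rewrite lerDr.
  rewrite /b2 (bigD1 i)//= (_ : \1_(S delta i) u = 1 :> R); last first.
    by rewrite indicE mem_set//; split => //=; rewrite ltNge; exact/negP.
  apply: (@le_trans _ _ (2 * A0 * fejerd n u)).
    rewrite mulrC ler_wpM2r//; apply: le_trans (ler_normB _ _) _.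
    by rewrite (ger0_norm A00); have := hA u; lra.
  rewrite ler_wpM2l ?mulr_ge0// mulr1 lerDl; apply: sumr_ge0 => j _.
  by rewrite mulr_ge0.
have eE (g : vec -> R) : measurable_fun setT g -> measurable_fun setT (EFin \o g).
  by move=> mg; exact/measurable_EFinP.
have ib1 : (\int[leb]_u (b1 u)%:E = (e * L ^+ d)%:E)%E.
  rewrite /b1; under eq_integral do rewrite EFinM.
  rewrite ge0_integralZl_EFin//.
  - by rewrite fejerd_cube.
  - by move=> u _; rewrite lee_fin mulr_ge0.
  - by apply: eE; exact: mFi.
have ib2 : (\int[leb]_u (b2 u)%:E <= (2 * A0 * (d%:R * (C / n%:R)))%:E)%E.
  rewrite /b2; under eq_integral do rewrite EFinM.
  rewrite ge0_integralZl_EFin ?mulr_ge0//; last 2 first.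
  - by move=> u _; rewrite lee_fin.
  - by apply: eE; apply: measurable_sum => i; exact: mFi.
  rewrite [leRHS]EFinM; apply: lee_wpmul2l; first by rewrite lee_fin mulr_ge0.
  under eq_integral do rewrite -sumEFin.
  rewrite ge0_integral_sum//; last 2 first.
  - by move=> i; apply: eE; exact: mFi.
  - by move=> i u _; rewrite lee_fin mulr_ge0.
  apply: (@le_trans _ _ (\sum_(i < d) (C / n%:R)%:E)%E).
    by apply: lee_sum => i _; exact: hS.
  by rewrite sumEFin sumr_const card_ord mulr_natl.
have ib3 : (\int[leb]_u (b3 u)%:E <= (W * (30 * L) ^+ d)%:E)%E.
  rewrite /b3; under eq_integral do rewrite EFinM.
  rewrite ge0_integralZl_EFin//; last 2 first.
  - by move=> u _; rewrite lee_fin mulr_ge0.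
  - exact: eE.
  by rewrite [leRHS]EFinM; apply: lee_wpmul2l; rewrite ?lee_fin//; exact: fejerd_tailw.
have ib : (\int[leb]_u (b1 u + b2 u + b3 u)%:E <= (e * L ^+ d +
    2 * A0 * (d%:R * (C / n%:R)) + W * (30 * L) ^+ d)%:E)%E.
  under eq_integral do rewrite !EFinD.
  rewrite ge0_integralD//; last 4 first.
  - by move=> u _; rewrite -EFinD lee_fin addr_ge0.
  - by apply: emeasurable_funD; exact: eE.
  - by move=> u _; rewrite lee_fin.
  - exact: eE.
  rewrite ge0_integralD//; last 4 first.
  - by move=> u _; rewrite lee_fin.
  - exact: eE.
  - by move=> u _; rewrite lee_fin.
  - exact: eE.
  by rewrite !EFinD; apply: leeD => //; apply: leeD => //; rewrite ib1.
have Goo : (\int[leb]_u `|(G u)%:E| <= (e * L ^+ d +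
    2 * A0 * (d%:R * (C / n%:R)) + W * (30 * L) ^+ d)%:E)%E.
  apply: le_trans ib; apply: ge0_le_integral => //.
  - by apply: measurableT_comp => //; exact: eE.
  - by apply: eE; apply: measurable_funD => //; exact: measurable_funD.
  - by move=> u _; rewrite /= lee_fin.
have iG : leb.-integrable setT (EFin \o G).
  by apply/integrableP; split; [exact: eE|exact: le_lt_trans Goo (ltry _)].
have iQ : leb.-integrable setT (EFin \o (fun u => A0 * (fejerd n u * \1_Q u))).
  apply: (@eq_integrable _ _ _ leb setT measurableT
    (fun u => A0%:E * (fejerd n u * \1_Q u)%:E)%E) => //.
  apply: integrableZl => //; apply/integrableP; split; first by apply: eE; exact: mFi.
  under eq_integral do rewrite /= ger0_norm ?mulr_ge0//.
  by rewrite fejerd_cube// ltry.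
have -> : \int[leb]_u (fejerd n u * A u) - A0 * L ^+ d = \int[leb]_u G u.
  rewrite /G RintegralB//; last first.
    have := integrableD measurableT iG iQ; apply: eq_integrable => // u _ /=.
    by rewrite -EFinD /G subrK.
  congr (_ - _); rewrite /Rintegral; under eq_integral do rewrite EFinM.
  rewrite ge0_integralZl_EFin//.
  - by rewrite fejerd_cube.
  - by move=> u _; rewrite lee_fin mulr_ge0.
  - by apply: eE; exact: mFi.
rewrite -lee_fin; apply: le_trans Goo.
have := le_normr_Rintegral measurableT iG.
rewrite -lee_fin => /le_trans; apply.
rewrite /Rintegral fineK//.
by apply: integrable_fin_num => //; exact: (integrable_norm iG).
Qed.

End fejer_product.

(** * Inverse transforms and their squared samples summed over grid differences *)

Section sampling.
Context {R : realType} {d : nat}.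
Local Notation vec := 'rV[R]_d.
Local Notation leb := (@lebesgue_measure_rV R d).
Implicit Types (x y w : vec) (H : vec -> R[i]).

Lemma dotDl x y w : dot (x + y) w = dot x w + dot y w.
Proof. by rewrite /dot -big_split; apply: eq_bigr => i _; rewrite mxE mulrDl. Qed.

Lemma dotNl x w : dot (- x) w = - dot x w.
Proof. by rewrite /dot -sumrN; apply: eq_bigr => i _; rewrite mxE mulNr. Qed.

Lemma dotC x w : dot x w = dot w x.
Proof. by apply: eq_bigr => i _; rewrite mulrC. Qed.

Lemma dotDr x y w : dot w (x + y) = dot w x + dot w y.
Proof. by rewrite ![dot w _]dotC dotDl. Qed.

Lemma dotNr x w : dot w (- x) = - dot w x.
Proof. by rewrite ![dot w _]dotC dotNl. Qed.

Lemma dotBl x y w : dot (x - y) w = dot x w - dot y w.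
Proof. by rewrite dotDl dotNl. Qed.

Lemma dotBr x y w : dot w (x - y) = dot w x - dot w y.
Proof. by rewrite dotDr dotNr. Qed.

Lemma cmeas_cis_dot x : cmeas (fun w : vec => cis (2 * pi * dot x w)).
Proof.
apply: cmeas_cis; apply: measurable_funM => //.
by apply: measurable_dot => //; exact: measurable_cst.
Qed.

Definition ift H x : R[i] := cint leb (fun w => cis (2 * pi * dot x w) * H w).

Lemma cintble_cis H x : cintble leb H ->
  cintble leb (fun w => cis (2 * pi * dot x w) * H w).
Proof.
move=> iH; apply: (@cintble_bndM _ _ _ _ 1 (fun w => cis (2 * pi * dot x w))) => //.
  exact: cmeas_cis_dot.
by move=> w; rewrite normc_cis.
Qed.

Lemma cis_sum (I : Type) (s : seq I) (f : I -> R) :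
  cis (\sum_(i <- s) f i) = \prod_(i <- s) cis (f i).
Proof.
elim: s => [|i s IH]; first by rewrite !big_nil cis0.
by rewrite !big_cons cisD IH.
Qed.

Lemma normc_prod (I : Type) (s : seq I) (f : I -> R[i]) :
  normc (\prod_(i <- s) f i) = \prod_(i <- s) normc (f i).
Proof.
elim: s => [|i s IH]; first by rewrite !big_nil (_ : normc 1 = 1) ?normc1.
by rewrite !big_cons normcM IH.
Qed.

Variable L : R.
Hypothesis L0 : 0 < L.

Definition grid n (j : {ffun 'I_d -> 'I_n}) : vec := \row_s ((j s)%:R / L).

(** The double sum is the squared modulus of one sum over the grid, and that sum factors over the
    coordinates into the sums of [fejer_normc]. *)
Lemma grid_kernel n (t : vec) : (0 < n)%N ->
  \sum_(j : {ffun 'I_d -> 'I_n}) \sum_(k : {ffun 'I_d -> 'I_n})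
    cis (2 * pi * dot (grid j - grid k) t) =
  real_complex R (n%:R ^+ d * fejerd L n t).
Proof.
move=> n0.
pose E := \sum_(j : {ffun 'I_d -> 'I_n}) cis (2 * pi * dot (grid j) t).
have -> : \sum_(j : {ffun 'I_d -> 'I_n}) \sum_(k : {ffun 'I_d -> 'I_n})
    cis (2 * pi * dot (grid j - grid k) t) = E * (E^*)%R.
  rewrite /E rmorph_sum mulr_suml; apply: eq_bigr => j _.
  rewrite mulr_sumr; apply: eq_bigr => k _.
  transitivity (cis (2 * pi * dot (grid j) t) * cis (- (2 * pi * dot (grid k) t))).
    by rewrite -cisD dotBl mulrBr.
  by rewrite cisN.
have EE : E = \prod_(i < d) \sum_(k < n) cis (2 * pi / L * k%:R * t ord0 i).
  rewrite bigA_distr_bigA /=; apply: eq_bigr => j _.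
  rewrite /dot mulr_sumr cis_sum; apply: eq_bigr => i _.
  by rewrite mxE; congr cis; field; rewrite gt_eqF.
rewrite mulcJ EE normc_prod -prodrXl; congr (real_complex R _).
rewrite -[X in _ ^+ X]card_ord -prodr_const -big_split /=; apply: eq_bigr => i _.
by rewrite fejer_normc mulVKf// pnatr_eq0 -lt0n.
Qed.

Lemma sqr_ift H x : cintble leb H ->
  real_complex R (normc (ift H x) ^+ 2) =
  cint leb (fun w' => ((H w')^*)%R *
    cint leb (fun w => cis (2 * pi * dot x (w - w')) * H w)).
Proof.
move=> iH; rewrite -mulcJ.
transitivity (ift H x * cint leb (fun w' => ((cis (2 * pi * dot x w') * H w')^*)%R)).
  by rewrite cintJ//; exact: cintble_cis.
rewrite -cintZ; last by apply: cintbleJ; exact: cintble_cis.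
apply: cint_ext => w'.
rewrite (@cint_ext _ _ _ _ _ (fun w => (cis (2 * pi * dot x w'))^* *
   (cis (2 * pi * dot x w) * H w))).
  rewrite cintZ; last exact: cintble_cis.
  by rewrite -/(ift H x) rmorphM /=; ring.
by move=> w; rewrite mulrA -cisN -cisD; congr (cis _ * _); rewrite dotBr; ring.
Qed.

Lemma acorr_le0 M K H u : bounded_in_cube M K H -> `|acorr H u| <= acorr H 0.
Proof.
move=> bH; have Hoo := bounded_in_cube_sqr_lty bH; have [mH _ _] := bH.
rewrite -lee_fin acorr0// -[leRHS]mul1e; apply: acorr_le => // y.
by rewrite mul1r.
Qed.

Lemma integrable_fejerd_acorr n M K H : bounded_in_cube M K H ->
  leb.-integrable setT (EFin \o (fun u => fejerd L n u * acorr H u)).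
Proof.
move=> bH; have [mH _ _] := bH.
suff : bounded_in_cube (2 * M) (n%:R ^+ d * acorr H 0)
    (fun u => real_complex R (fejerd L n u * acorr H u)).
  by move=> /bounded_in_cube_cintble/cintble_Re.
split.
- apply: cmeas_real; apply: measurable_funM; first exact: measurable_fejerd.
  exact: measurable_acorr.
- move=> u; rewrite normc_real normrM (ger0_norm (fejerd_ge0 _ _ _)).
  by rewrite ler_pM// ?fejerd_ge0 ?fejerd_le//; exact: acorr_le0 bH.
- by move=> u hu; rewrite (acorr_far bH hu) mulr0.
Qed.

(** Each square is a double integral in [w] and [w'], and summing over the grid turns its characters
    into a kernel in [w - w']. The substitution [u = w - w'] followed by Fubini leaves the
    autocorrelation against that kernel. *)
Lemma grid_sum M K H n : (0 < n)%N -> bounded_in_cube M K H ->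
  \sum_(j : {ffun 'I_d -> 'I_n}) \sum_(k : {ffun 'I_d -> 'I_n})
    normc (ift H (grid j - grid k)) ^+ 2 =
  n%:R ^+ d * \int[leb]_u (fejerd L n u * acorr H u).
Proof.
move=> n0 bH; have iH := bounded_in_cube_cintble bH; have [mH HK H0] := bH.
pose D (t : vec) := real_complex R (n%:R ^+ d * fejerd L n t).
have ic (x w' : vec) : cintble leb (fun w => cis (2 * pi * dot x (w - w')) * H w).
  apply: (@cintble_bndM _ _ _ _ 1 (fun w => cis (2 * pi * dot x (w - w')))) => //.
    apply: cmeas_cis; apply: measurable_funM => //; apply: measurable_dot.
      exact: measurable_cst.
    by apply: measurable_rVB => //; exact: measurable_cst.
  by move=> w; rewrite normc_cis.
have icc (x : vec) : cintble leb (fun w' => ((H w')^*)%R *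
    cint leb (fun w => cis (2 * pi * dot x (w - w')) * H w)).
  rewrite (_ : (fun w' => _) = (fun w' => ift H x *
      ((cis (2 * pi * dot x w') * H w')^*)%R)).
    by apply: cintbleZ; apply: cintbleJ; exact: cintble_cis.
  apply/funext => w'.
  rewrite (@cint_ext _ _ _ _ _ (fun w => (cis (2 * pi * dot x w'))^* *
     (cis (2 * pi * dot x w) * H w))).
    rewrite cintZ; last exact: cintble_cis.
    by rewrite -/(ift H x) rmorphM /=; ring.
  by move=> w; rewrite mulrA -cisN -cisD; congr (cis _ * _); rewrite dotBr; ring.
have sumE : real_complex R (\sum_(j : {ffun 'I_d -> 'I_n})
    \sum_(k : {ffun 'I_d -> 'I_n}) normc (ift H (grid j - grid k)) ^+ 2) =
    cint leb (fun w' => ((H w')^*)%R * cint leb (fun w => D (w - w') * H w)).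
  rewrite rmorph_sum /=; under eq_bigr do rewrite rmorph_sum /=.
  under eq_bigr do under eq_bigr do rewrite sqr_ift//.
  under eq_bigr do rewrite -cint_sum//.
  rewrite -cint_sum; last by move=> j; apply: cintble_sum => k; exact: icc.
  apply: cint_ext => w'.
  under eq_bigr do rewrite -mulr_sumr.
  rewrite -mulr_sumr; congr (_ * _).
  under eq_bigr do rewrite -cint_sum//.
  rewrite -cint_sum; last by move=> j; apply: cintble_sum => k; exact: ic.
  apply: cint_ext => w; under eq_bigr do rewrite -mulr_suml.
  by rewrite -mulr_suml grid_kernel.
have mD : cmeas D.
  by apply: cmeas_real; apply: measurable_funM => //; exact: measurable_fejerd.
have nd0 : 0 <= n%:R ^+ d :> R by rewrite exprn_ge0.
have Db t : normc (D t) <= n%:R ^+ d * n%:R ^+ d.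
  rewrite normc_real ger0_norm ?mulr_ge0 ?fejerd_ge0//.
  by rewrite ler_wpM2l// fejerd_le.
(* [D] is periodic; it is cut off to a cube containing all differences of points of the support,
   which changes no value that matters and makes the swap legitimate. *)
pose h (u : vec) := D u * real_complex R (\1_(cube (2 * M)) u).
have ih : cintble leb h.
  apply: (@cintble_bndM _ _ _ _ (n%:R ^+ d * n%:R ^+ d) D) => //.
  apply: (@bounded_in_cube_cintble _ _ (2 * M) 1); split.
  - by apply: cmeas_indic; exact: measurable_cube.
  - by move=> u; rewrite normc_real indicE ger0_norm// lern1 leq_b1.
  - by move=> u hu; rewrite indicE memNset.
have shiftE (w' : vec) : ((H w')^*)%R * cint leb (fun w => D (w - w') * H w) =
    ((H w')^*)%R * cint leb (fun u => H (u + w') * h u).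
  have [w'M|w'M] := pselect (cube M w'); last by rewrite H0// conjC0 !mul0r.
  congr (_ * _); rewrite -(@cint_shift _ _ (fun w => D (w - w') * H w) w'); last first.
    apply: cmeasM => //; apply: (cmeas_comp mD).
    by apply: measurable_rVB => //; exact: measurable_cst.
  apply: cint_ext => u; rewrite addrK /h indicE.
  have [uM|uM] := boolP (u \in cube (2 * M)); first by rewrite mulr1 mulrC.
  rewrite (H0 (u + w')) ?mulr0 ?mul0r// => uw; move/negP: uM; apply.
  apply/mem_set => i /=; have := uw i; have := w'M i; rewrite /= mxE => h1 h2.
  have -> : u ord0 i = (u ord0 i + w' ord0 i) - w' ord0 i by ring.
  by apply: le_trans (ler_normB _ _) _; lra.
have swap : cint leb (fun w' => ((H w')^*)%R * cint leb (fun u => H (u + w') * h u)) =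
   cint leb (fun u => h u * cint leb (fun w' => H (u + w') * ((H w')^*)%R)).
  apply: (@cint_kernel_swap _ _ _ _ _ leb leb K (fun w' => ((H w')^*)%R) h
    (fun p => H (p.2 + p.1))) => //.
  - exact: cintbleJ.
  - by apply: (cmeas_comp mH); apply: measurable_rVD.
move: sumE; rewrite (cint_ext leb shiftE) swap.
move: (\sum_(j : {ffun 'I_d -> 'I_n}) _) => s /(congr1 (@complex.Re R)) sE.
transitivity (complex.Re (cint leb (fun u => h u *
  cint leb (fun w' => H (u + w') * ((H w')^*)%R)))); first exact: sE.
transitivity (\int[leb]_u (n%:R ^+ d * (fejerd L n u * acorr H u))); last first.
  exact: (RintegralZl _ measurableT (integrable_fejerd_acorr n bH)).
apply: eq_Rintegral => u _.
have -> : cint leb (fun w' => H (u + w') * ((H w')^*)%R) =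
    cint leb (fun w' => H (w' + u) * ((H w')^*)%R).
  by apply: cint_ext => w'; rewrite addrC.
rewrite /h /D ReM -[complex.Re (cint _ _)]/(acorr H u) indicE.
move: (complex.Im (cint _ _)) => z.
have [uM|uM] := boolP (u \in cube (2 * M)); first by rewrite /=; ring.
rewrite (acorr_far bH) ?mulr0 /=; first by ring.
by move=> h'; move/negP: uM; apply; exact/mem_set.
Qed.

End sampling.

(** * Comparison of extended sums with finite sums *)

Section esum_seq.
Context {R : realType} {T : choiceType}.
Local Open Scope ereal_scope.
Implicit Types (S : set T) (a : T -> \bar R).

Lemma sum_le_esum S a (r : seq T) : uniq r -> (forall i, i \in r -> S i) ->
  \sum_(i <- r) a i <= \esum_(i in S) a i.
Proof.
move=> ur rS; apply: esum_ge; exists [set` r].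
  by split; [exact: finite_seq|move=> i /= ir; exact: rS].
by rewrite -fsbig_seq.
Qed.

Lemma esum_le_bound S a (x : \bar R) :
  (forall r : seq T, uniq r -> (forall i, i \in r -> S i) ->
    \sum_(i <- r) a i <= x) -> \esum_(i in S) a i <= x.
Proof.
move=> h; apply: ge_ereal_sup => _ [X [fX XS] <-].
rewrite fsbig_finite//; apply: h => // i; rewrite in_fset_set// => iX.
by apply: XS; exact: set_mem.
Qed.

End esum_seq.

(** * Recovering a sum over the integer lattice from averages over grid differences *)

Section lattice_average.
Context {R : realType} {d : nat}.
Local Notation zvec := 'rV[int]_d.
Local Notation vec := 'rV[R]_d.
Variable s : zvec -> R.
Hypothesis s0 : forall m, 0 <= s m.

Definition zgrid n (j : {ffun 'I_d -> 'I_n}) : zvec := \row_i (j i : nat)%:Z.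

Lemma zgrid_inj n : injective (@zgrid n).
Proof.
move=> j k /rowP jk; apply/ffunP => i; apply: val_inj => /=.
by have := jk i; rewrite !mxE => -[].
Qed.

Lemma ler_sum_finType (I : finType) (T : eqType) (f : I -> T) (g : T -> R)
    (r : seq T) : (forall t, 0 <= g t) -> injective f -> uniq r ->
  (forall t, t \in r -> exists i, f i = t) ->
  \sum_(t <- r) g t <= \sum_(i : I) g (f i).
Proof.
move=> g0 fI ur rf.
rewrite [leRHS](_ : _ = \sum_(t <- [seq f i | i <- enum I]) g t); last first.
  by rewrite big_map big_enum.
have uf : uniq [seq f i | i <- enum I] by rewrite map_inj_uniq ?enum_uniq.
rewrite [leRHS](bigID (fun t => t \in r) xpredT) /=.
rewrite [X in _ <= X + _](_ : _ = \sum_(t <- r) g t).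
  by rewrite lerDl sumr_ge0.
rewrite -big_filter; apply: perm_big; apply: uniq_perm => //.
  by rewrite filter_uniq.
move=> t; rewrite mem_filter andb_idr// => /rf[i <-].
by rewrite map_f// mem_enum.
Qed.

(** For a fixed [j] the differences [j - k] are distinct lattice points, so each of the [n ^ d]
    inner sums is at most the full sum. *)
Lemma lattice_average_le n : (0 < n)%N ->
  (((n%:R ^+ d)^-1 * \sum_(j : {ffun 'I_d -> 'I_n}) \sum_(k : {ffun 'I_d -> 'I_n})
    s (zgrid j - zgrid k))%:E <= \esum_(m in setT) (s m)%:E)%E.
Proof.
move=> n0; have nd0 : 0 < (n%:R ^+ d : R) by rewrite exprn_gt0// ltr0n.
case TE : (\esum_(m in _) _)%E => [t| |]; last 2 first.
- by rewrite leey.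
- have := @esum_ge0 R _ setT (fun m => (s m)%:E) (fun m _ => s0 m).
  by rewrite TE.
rewrite lee_fin mulrC ler_pdivrMr//.
apply: (@le_trans _ _ (\sum_(j : {ffun 'I_d -> 'I_n}) t)).
  apply: ler_sum => j _; rewrite -lee_fin -TE -sumEFin.
  rewrite -(@big_map _ _ _ _ _ (fun k => zgrid j - zgrid k) (index_enum _) xpredT (fun m => (s m)%:E)).
  apply: sum_le_esum => //.
  rewrite map_inj_uniq ?index_enum_uniq// => k k' /addrI/oppr_inj.
  exact: zgrid_inj.
by rewrite sumr_const card_ffun !card_ord -natrX mulr_natr.
Qed.

Lemma bernoulli (x : R) n : 0 <= x -> x <= 1 -> 1 - n%:R * x <= (1 - x) ^+ n.
Proof.
move=> x0 x1; elim: n => [|n IH]; first by rewrite mul0r subr0 expr0.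
rewrite exprS; apply: (@le_trans _ _ ((1 - x) * (1 - n%:R * x))).
  by rewrite -natr1; have := ler0n R n; nra.
by rewrite ler_wpM2l// subr_ge0.
Qed.

(** The [n ^ d] central points of a grid of side [n + 2M] are far enough from the boundary to reach,
    for each [m] of [r], another grid point at difference [m]. The map [io] embeds the small grid as
    that centre. *)
Lemma lattice_average_ge (r : seq zvec) (M n : nat) : uniq r -> (0 < n)%N ->
  (forall m, m \in r -> forall i, `|m ord0 i| <= M%:Z) ->
  n%:R ^+ d * \sum_(m <- r) s m <=
  \sum_(j : {ffun 'I_d -> 'I_(n + M + M)}) \sum_(k : {ffun 'I_d -> 'I_(n + M + M)})
    s (zgrid j - zgrid k).
Proof.
move=> ur n0 rM; set N := (n + M + M)%N.
have NP (i : 'I_n) : (i + M < N)%N.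
  by rewrite /N; have := ltn_ord i; lia.
pose io (j : {ffun 'I_d -> 'I_n}) : {ffun 'I_d -> 'I_N} :=
  [ffun i => Ordinal (NP (j i))].
have ioI : injective io.
  move=> j k /ffunP jk; apply/ffunP => i; apply: val_inj => /=.
  have := jk i; rewrite !ffunE => /(congr1 val) /= /eqP.
  by rewrite eqn_add2r => /eqP.
rewrite -natrX.
have -> : (n ^ d)%N%:R * \sum_(m <- r) s m =
    \sum_(j : {ffun 'I_d -> 'I_n}) \sum_(m <- r) s m.
  by rewrite sumr_const card_ffun !card_ord mulr_natl.
apply: (@le_trans _ _ (\sum_(j : {ffun 'I_d -> 'I_n})
    \sum_(k : {ffun 'I_d -> 'I_N}) s (zgrid (io j) - zgrid k))).
  apply: ler_sum => j _.
  apply: (@ler_sum_finType _ _ (fun k => zgrid (io j) - zgrid k)) => //.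
    by move=> k k' /addrI/oppr_inj; exact: zgrid_inj.
  move=> m mr.
  have mM i : - M%:Z <= m ord0 i <= M%:Z by rewrite -ler_norml; exact: rM.
  have z0 i : 0 <= (j i : nat)%:Z + M%:Z - m ord0 i.
    by have /andP[m1 m2] := mM i; lia.
  have kP i : (`|((j i : nat)%:Z + M%:Z - m ord0 i)%R| < N)%N.
    rewrite -ltz_nat gez0_abs ?z0// /N; have jn := ltn_ord (j i).
    by have /andP[m1 m2] := mM i; lia.
  exists [ffun i => Ordinal (kP i)].
  apply/rowP => i; rewrite !mxE !ffunE /= PoszD gez0_abs ?z0//.
  by rewrite (_ : 0 = ord0)//; ring.
rewrite -(@big_map _ _ _ _ _ io (index_enum _) xpredT
  (fun j => \sum_(k : {ffun 'I_d -> 'I_N}) s (zgrid j - zgrid k))).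
apply: (@ler_sum_finType _ _ id) => //.
- by move=> j; rewrite sumr_ge0.
- by rewrite map_inj_uniq// index_enum_uniq.
- by move=> j _; exists j.
Qed.

(** Boundary effects cost a finite partial sum only the factor [(n / (n + 2M)) ^ d], which
    Bernoulli's inequality shows to be close to 1. *)
Lemma esum_le_lattice_average (U : R) :
  (forall e : R, 0 < e -> exists N0, forall n, (N0 <= n)%N -> (0 < n)%N ->
    (n%:R ^+ d)^-1 * \sum_(j : {ffun 'I_d -> 'I_n}) \sum_(k : {ffun 'I_d -> 'I_n})
      s (zgrid j - zgrid k) <= U + e) ->
  (\esum_(m in setT) (s m)%:E <= U%:E)%E.
Proof.
move=> hU; apply: esum_le_bound => r ur _; rewrite sumEFin lee_fin.
set X := \sum_(m <- r) s m.
have X0 : 0 <= X by rewrite sumr_ge0.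
apply/ler_addgt0Pr => e e0.
have e20 : 0 < e / 2 by rewrite divr_gt0.
have [N0 hN] := hU _ e20.
have [M rM] : exists M : nat, forall m, m \in r -> forall i, `|m ord0 i| <= M%:Z.
  exists (\sum_(m <- r) \sum_(i < d) absz (m ord0 i))%N => m mr i.
  rewrite (perm_big _ (perm_to_rem mr)) big_cons (bigD1 i)//=.
  by rewrite !PoszD -abszE -addrA lerDl addr_ge0.
pose B := X * (d%:R * (2 * M%:R)).
have B0 : 0 <= B by rewrite !mulr_ge0.
(* The loss in Bernoulli's inequality is [B / N], and this [n] makes it at most [e / 2]. *)
pose n := (maxn N0 (Num.truncn (B / (e / 2)))).+1.
have n0 : (0 < n)%N by [].
pose N := (n + M + M)%N.
have N0' : 0 < N%:R :> R by rewrite ltr0n /N -addnA addn_gt0.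
have NN0 : (N0 <= N)%N by rewrite /N /n; have := leq_maxl N0 (Num.truncn (B / (e / 2))); lia.
have hn : B / (e / 2) < N%:R.
  apply: lt_le_trans (truncnS_gt _) _; rewrite ler_nat /N /n.
  by rewrite -addnA; apply: leq_trans (leq_addr _ _); rewrite ltnS leq_maxr.
have := hN N NN0; rewrite ltr0n in N0' => /(_ N0') h.
have N0R : 0 < N%:R :> R by rewrite ltr0n.
have h2 := lattice_average_ge ur n0 rM; rewrite -/N -/X in h2.
have h3 : (n%:R / N%:R) ^+ d * X <= U + e / 2.
  apply: le_trans h; rewrite exprMn exprVn mulrAC mulrC.
  by rewrite ler_wpM2l// invr_ge0 exprn_ge0.
pose x : R := (2 * M%:R) / N%:R.
have nx : n%:R / N%:R = 1 - x :> R.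
  apply: (mulIf (lt0r_neq0 N0R)); rewrite /x mulrBl mul1r !divfK ?gt_eqF//.
  by rewrite /N !natrD; ring.
have x0 : 0 <= x by rewrite divr_ge0// mulr_ge0.
have x1 : x <= 1 by rewrite -subr_ge0 -nx divr_ge0.
have := bernoulli d x0 x1; rewrite -nx => h4.
have h5 : X - d%:R * x * X <= U + e / 2.
  apply: le_trans h3; apply: le_trans (ler_wpM2r X0 h4); rewrite mulrBl mul1r//.
have h6 : d%:R * x * X <= e / 2.
  rewrite (_ : d%:R * x * X = B / N%:R); last by rewrite /x /B; ring.
  by rewrite ler_pdivrMr// mulrC -ler_pdivrMr// ltW.
by lra.
Qed.

Lemma lattice_average_le_esum (U : R) :
  (forall e : R, 0 < e -> exists N0, forall n, (N0 <= n)%N -> (0 < n)%N ->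
    U - e <= (n%:R ^+ d)^-1 * \sum_(j : {ffun 'I_d -> 'I_n})
      \sum_(k : {ffun 'I_d -> 'I_n}) s (zgrid j - zgrid k)) ->
  (U%:E <= \esum_(m in setT) (s m)%:E)%E.
Proof.
move=> hU; apply/lee_addgt0Pr => e e0; have [N0 hN] := hU e e0.
have n0 : (0 < N0.+1)%N by [].
rewrite -leeBlDr//; apply: le_trans (lattice_average_le n0).
by rewrite -EFinB lee_fin; exact: hN.
Qed.

End lattice_average.

(** * Two-sided estimates for the sum of squared samples on the lattice of step [1 / L] *)

Section sampling_theorem.
Context {R : realType} {d : nat}.
Local Notation vec := 'rV[R]_d.
Local Notation zvec := 'rV[int]_d.
Local Notation leb := (@lebesgue_measure_rV R d).
Implicit Types (H : vec -> R[i]).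
Variable L : R.
Hypothesis L0 : 0 < L.

Definition lat (m : zvec) : vec := L^-1 *: vec_of_int m.

Lemma grid_zgrid n (j k : {ffun 'I_d -> 'I_n}) :
  grid L j - grid L k = lat (zgrid j - zgrid k).
Proof.
apply/rowP => i; rewrite !mxE rmorphB /= -!pmulrn.
by rewrite [RHS]mulrC mulrBl.
Qed.

(** [grid_sum] expresses the average as a Fejer integral and [fejerd_approx] evaluates it. Only the
    error in [W] persists as [n] grows; the others fit into [e]. *)
Lemma sampling_near M K H W : bounded_in_cube M K H -> 0 <= W ->
  (forall u : vec, ~ cube (L / 2) u ->
    `|acorr H u| <= W * \prod_(i < d) tailw L (u ord0 i)) ->
  forall e : R, 0 < e -> exists N0, forall n, (N0 <= n)%N -> (0 < n)%N ->
  `|(n%:R ^+ d)^-1 * \sum_(j : {ffun 'I_d -> 'I_n}) \sum_(k : {ffun 'I_d -> 'I_n})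
      normc (ift H (lat (zgrid j - zgrid k))) ^+ 2 - acorr H 0 * L ^+ d| <=
  W * (30 * L) ^+ d + e.
Proof.
move=> bH W0 far e e0; have [mH _ _] := bH.
have Ld : 0 < L ^+ d by rewrite exprn_gt0.
(* The continuity error [e1 * L ^+ d] takes [e / 2]; the shell error [B / n] takes the other half by
   the choice of the threshold on [n]. *)
pose e1 := e / 2 / L ^+ d.
have e10 : 0 < e1 by rewrite !divr_gt0.
have [delta d0 hd] := acorr_cont bH e10.
pose dl := Num.min delta (L / 2).
have dl0 : 0 < dl by rewrite lt_min d0 divr_gt0.
have dlL : dl <= L / 2 by rewrite /dl ge_min lexx orbT.
have [C C0 hC] := @fejerd_shell R d L L0 dl dl0 dlL.
pose B := 2 * acorr H 0 * (d%:R * C).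
have A0 : 0 <= acorr H 0 by exact: le_trans (normr_ge0 _) (acorr_le0 0 bH).
exists (Num.truncn (B / (e / 2))).+1 => n Nn n0.
under eq_bigr do under eq_bigr do rewrite -grid_zgrid.
rewrite (grid_sum L0 n0 bH) mulKf; last by rewrite gt_eqF// exprn_gt0// ltr0n.
have nR : 0 < n%:R :> R by rewrite ltr0n.
have := @fejerd_approx R d L L0 (acorr H) (acorr H 0) e1 W dl C n n0
  (measurable_acorr mH) (ltW e10) W0 hC (fun u => acorr_le0 u bH).
move=> /(_ _ far) h.
apply: le_trans (h _) _.
  move=> u hu; apply: hd => i; apply: le_trans (hu i) _.
  by rewrite /dl ge_min lexx.
have -> : e1 * L ^+ d = e / 2 by rewrite /e1 divfK// gt_eqF.
have -> : 2 * acorr H 0 * (d%:R * (C / n%:R)) = B / n%:R by rewrite /B; ring.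
have : B / n%:R <= e / 2.
  rewrite ler_pdivrMr// mulrC -ler_pdivrMr ?divr_gt0//.
  apply: le_trans (ltW (truncnS_gt _)) _; by rewrite ler_nat.
by lra.
Qed.

Lemma sampling_le M K H W : bounded_in_cube M K H -> 0 <= W ->
  (forall u : vec, ~ cube (L / 2) u ->
    `|acorr H u| <= W * \prod_(i < d) tailw L (u ord0 i)) ->
  (\esum_(m in setT) (normc (ift H (lat m)) ^+ 2)%:E <=
    (acorr H 0 * L ^+ d + W * (30 * L) ^+ d)%:E)%E.
Proof.
move=> bH W0 far; apply: (@esum_le_lattice_average _ _
  (fun m => normc (ift H (lat m)) ^+ 2)) => [m|e e0]; first exact: sqr_ge0.
have [N0 hN] := sampling_near bH W0 far e0.
by exists N0 => n /hN h /h; rewrite ler_distl => /andP[_]; lra.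
Qed.

Lemma sampling_ge M K H W : bounded_in_cube M K H -> 0 <= W ->
  (forall u : vec, ~ cube (L / 2) u ->
    `|acorr H u| <= W * \prod_(i < d) tailw L (u ord0 i)) ->
  ((acorr H 0 * L ^+ d - W * (30 * L) ^+ d)%:E <=
    \esum_(m in setT) (normc (ift H (lat m)) ^+ 2)%:E)%E.
Proof.
move=> bH W0 far; apply: (@lattice_average_le_esum _ _
  (fun m => normc (ift H (lat m)) ^+ 2)) => [m|e e0]; first exact: sqr_ge0.
have [N0 hN] := sampling_near bH W0 far e0.
by exists N0 => n /hN h /h; rewrite ler_distl => /andP[+ _]; lra.
Qed.

End sampling_theorem.

(** * Exchange of integrals and countable sums of nonnegative functions *)

Section integral_esum.
Context d (T : measurableType d) {R : realType} (mu : {measure set T -> \bar R}).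
Local Open Scope ereal_scope.

(** Transport through [pickle] to a series over the naturals, where monotone convergence is
    available; numbers that encode no element contribute 0. *)
Lemma esum_nneseries (I : countType) (a : I -> \bar R) : (forall i, 0 <= a i) ->
  \esum_(i in [set: I]) a i =
  \sum_(n <oo) (if pickle_inv n is Some i then a i else 0).
Proof.
move=> a0; pose g n := if @pickle_inv I n is Some i then a i else 0.
have g0 n : 0 <= g n by rewrite /g; case: pickle_inv.
rewrite nneseries_esumT//.
transitivity (\esum_(i in [set: I]) g (choice.pickle i)).
  by apply: eq_esum => i _; rewrite /g pickleK_inv.
rewrite -(@esum_image _ _ _ [set: I] (@choice.pickle I) g); last first.
  by move=> x y _ _; exact: (pcan_inj (@choice.pickleK I)).
rewrite esum_mkcond; apply: eq_esum => n _; rewrite /g.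
case: ifPn => // nr; case E : (pickle_inv n) => [i|//]; exfalso.
move/negP: nr; apply; apply/mem_set; exists i => //.
by have := @pickle_invK I n; rewrite E.
Qed.

Lemma integral_esum (I : countType) (S : set I) (f : I -> T -> \bar R) :
  (forall i, S i -> measurable_fun setT (f i)) ->
  (forall i x, S i -> 0 <= f i x) ->
  \int[mu]_x (\esum_(i in S) f i x) = \esum_(i in S) \int[mu]_x f i x.
Proof.
move=> mf f0.
pose g n x := if @pickle_inv I n is Some i then (if i \in S then f i x else 0) else 0.
have g0 n x : 0 <= g n x.
  by rewrite /g; case: pickle_inv => // i; case: ifPn => // /set_mem iS; exact: f0.
have mg n : measurable_fun setT (g n).
  rewrite /g; case: pickle_inv => [i|]; last exact: measurable_cst.
  case: (boolP (i \in S)) => [/set_mem iS|_]; last exact: measurable_cst.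
  exact: mf.
transitivity (\int[mu]_x \sum_(n <oo) g n x).
  apply: eq_integral => x _; rewrite esum_mkcond esum_nneseries// => i.
  by case: ifPn => // /set_mem; exact: f0.
rewrite integral_nneseries//.
rewrite [RHS]esum_mkcond esum_nneseries; last first.
  move=> i; case: ifPn => // /set_mem iS.
  by apply: integral_ge0 => x _; exact: f0.
apply: eq_eseriesr => n _; rewrite /g; case: pickle_inv => [i|].
  by case: ifPn => // _; rewrite integral0.
by rewrite integral0.
Qed.

Lemma measurable_esum (I : countType) (S : set I) (f : I -> T -> \bar R) :
  (forall i, S i -> measurable_fun setT (f i)) ->
  (forall i x, S i -> 0 <= f i x) ->
  measurable_fun setT (fun x => \esum_(i in S) f i x).
Proof.
move=> mf f0.
pose g n x := if @pickle_inv I n is Some i then (if i \in S then f i x else 0) else 0.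
have g0 n x : 0 <= g n x.
  by rewrite /g; case: pickle_inv => // i; case: ifPn => // /set_mem iS; exact: f0.
have mg n : measurable_fun setT (g n).
  rewrite /g; case: pickle_inv => [i|]; last exact: measurable_cst.
  case: (boolP (i \in S)) => [/set_mem iS|_]; last exact: measurable_cst.
  exact: mf.
rewrite (_ : (fun x => _) = (fun x => \sum_(n <oo) g n x)).
  by apply: (@ge0_emeasurable_sum _ _ _ _ g xpredT) => // n x _ _; exact: g0.
apply/funext => x; rewrite esum_mkcond esum_nneseries// => i.
by case: ifPn => // /set_mem; exact: f0.
Qed.

End integral_esum.

(** * Plancherel's formula for inverse transforms, by sampling and tiling *)

Section plancherel.
Context {R : realType} {d : nat}.
Local Notation vec := 'rV[R]_d.
Local Notation zvec := 'rV[int]_d.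
Local Notation leb := (@lebesgue_measure_rV R d).
Implicit Types (H : vec -> R[i]).

Definition tile (L : R) : set vec := [set x | forall i, 0 <= x ord0 i < L^-1].

Lemma tileE L : tile L = [set x : vec | forall i, `[0, L^-1[%classic (x ord0 i)].
Proof. by apply/seteqP; split => x /= h i; have := h i; rewrite in_itv. Qed.

Lemma measurable_tile L : measurable (tile L).
Proof.
rewrite tileE; apply: (@measurable_box R d (fun=> `[0, L^-1[%classic)) => i.
exact: measurable_itv.
Qed.

Lemma leb_tile L : 0 < L -> leb (tile L) = ((L^-1) ^+ d)%:E.
Proof.
move=> L0; rewrite tileE (@lebesgue_measure_rV_box R d (fun=> `[0, L^-1[%classic)); last first.
  by move=> i; exact: measurable_itv.
rewrite (eq_bigr (fun=> (L^-1)%:E)); first by rewrite prodEFin prodr_const card_ord.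
move=> i _; rewrite lebesgue_measure_itv /= lte_fin invr_gt0 L0.
by rewrite -EFinB subr0.
Qed.

Lemma integral_tiling (L : R) (f : vec -> \bar R) : 0 < L ->
  measurable_fun setT f -> (forall x, 0 <= f x)%E ->
  (\int[leb]_x f x = \int[leb]_(y in tile L)
    \esum_(m in setT) f (y + lat L m)%R)%E.
Proof.
move=> L0 mf f0.
have mt : measurable_fun setT (EFin \o (\1_(tile L) : vec -> R)).
  by apply/measurable_EFinP; apply: measurable_indic; exact: measurable_tile.
have ms (v : vec) : measurable_fun setT (fun x : vec => f (x + v)).
  by apply: (measurableT_comp mf); exact: measurable_shift.
have mts (v : vec) : measurable_fun setT (fun x : vec => (\1_(tile L) (x - v))%:E : \bar R).
  by apply: (measurableT_comp mt); exact: measurable_shift.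
transitivity (\int[leb]_x (\esum_(m in [set: zvec]) (f x * (\1_(tile L) (x - lat L m))%:E)))%E.
  apply: eq_integral => x _.
  (* Exactly one translate of the tile contains [x], so multiplying by the sum of the indicators of
     all translates changes nothing. *)
  pose m0 : zvec := \row_i Num.floor (L * x ord0 i).
  have key (m : zvec) : tile L (x - lat L m) <-> m = m0.
    have one (i : 'I_d) : (0 <= (x - lat L m) ord0 i < L^-1) =
        ((m ord0 i)%:~R <= L * x ord0 i < (m ord0 i + 1)%:~R).
      rewrite !mxE subr_ge0 ltrBlDr intrD ![L^-1 * _]mulrC.
      rewrite ler_pdivrMr// [x ord0 i * L]mulrC; congr (_ && _).
      rewrite (_ : L^-1 + _ = ((m ord0 i)%:~R + 1%:~R) / L).
        by rewrite ltr_pdivlMr// [x ord0 i * L]mulrC.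
      by rewrite mulrDl addrC mul1r.
    split=> [h|e i]; last by rewrite one e mxE floor_itv.
    apply/rowP => i; rewrite mxE; apply/esym/floor_def.
    by have := h i; rewrite one.
  rewrite (@esumID _ _ [set m0]); last by move=> m _; rewrite mule_ge0// lee_fin.
  rewrite setTI esum_set1; last by rewrite mule_ge0// lee_fin.
  rewrite esum1 ?adde0; last first.
    move=> m [_ /= mm0]; rewrite indicE memNset ?mule0//.
    by move=> /key.
  by rewrite indicE mem_set ?mule1//; exact/key.
rewrite integral_esum; last 2 first.
- by move=> m _; exact: emeasurable_funM.
- by move=> m x _; rewrite mule_ge0// lee_fin.
transitivity (\esum_(m in [set: zvec]) \int[leb]_y (f (y + lat L m)%R * (\1_(tile L) y)%:E))%E.
  apply: eq_esum => m _.
  rewrite -(@ge0_integral_leb_shift R d (fun x => f x * (\1_(tile L) (x - lat L m)%R)%:E)%E (lat L m)).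
  - by apply: eq_integral => y _; rewrite addrK.
  - exact: emeasurable_funM.
  - by move=> x; rewrite mule_ge0// lee_fin.
rewrite -integral_esum; last 2 first.
- by move=> m _; exact: emeasurable_funM.
- by move=> m x _; rewrite mule_ge0// lee_fin.
rewrite [RHS]integral_mkcond; apply: eq_integral => y _.
rewrite patchE indicE; case: (y \in tile L).
  by apply: eq_esum => m _; rewrite mule1.
by apply: esum1 => m _; rewrite mule0.
Qed.

Lemma ift_modulate H (th x : vec) :
  ift (fun w => cis (2 * pi * dot th w) * H w) x = ift H (x + th).
Proof.
apply: cint_ext => w; rewrite mulrA -cisD; congr (cis _ * _).
by rewrite dotDl; ring.
Qed.

Lemma cmeas_ift H : cmeas H -> cmeas (ift H).
Proof.
move=> mH.
apply: (@cmeas_cint_section _ _ _ _ R leb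
  (fun p : vec * vec => cis (2 * pi * dot p.1 p.2) * H p.2)).
apply: cmeasM; last exact: (cmeas_comp mH).
by apply: cmeas_cis; apply: measurable_funM => //; exact: measurable_dot.
Qed.

(** On a fine lattice the sampling estimate is an equality. Applied to all modulations of [H] it
    gives the same value on every translate of the lattice, and integrating over a tile of volume
    [L ^- d] yields the squared norm. *)
Lemma plancherel_ift M K H : bounded_in_cube M K H -> N2 (ift H) = N2 H.
Proof.
move=> bH; have [mH HK H0] := bH.
have Hoo := bounded_in_cube_sqr_lty bH.
(* Then [L / 2] exceeds [2 * M]: the autocorrelation is supported in the central cube and the far
   bound holds with [W = 0]. The 1 keeps [L] positive. *)
pose L := 4 * `|M| + 1.
have L0 : 0 < L by rewrite ltr_pwDr// mulr_ge0.
rewrite /N2 (@integral_tiling L); last 3 first.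
- by [].
- by apply: measurable_normc2E; exact: cmeas_ift.
- by move=> x; rewrite lee_fin sqr_ge0.
have tot (th : vec) : (\esum_(m in [set: zvec])
    (normc (ift H (th + lat L m)) ^+ 2)%:E = (acorr H 0 * L ^+ d)%:E)%E.
  pose G w := cis (2 * pi * dot th w) * H w.
  have bG : bounded_in_cube M K G.
    split.
    - by apply: cmeasM => //; exact: cmeas_cis_dot.
    - by move=> w; rewrite normcM normc_cis mul1r.
    - by move=> w hw; rewrite /G H0// mulr0.
  have aG : acorr G 0 = acorr H 0.
    apply: EFin_inj; rewrite !acorr0//; last exact: bounded_in_cube_sqr_lty bG.
    by apply: eq_integral => w _; rewrite /G normcM normc_cis mul1r.
  have far (u : vec) : ~ cube (L / 2) u ->
      `|acorr G u| <= 0 * \prod_(i < d) tailw L (u ord0 i).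
    move=> hu; rewrite mul0r (acorr_far bG) ?normr0// => h; apply: hu.
    apply: cube_le h; rewrite /L; have := ler_norm M; lra.
  have h1 := sampling_le L0 bG (lexx 0) far.
  have h2 := sampling_ge L0 bG (lexx 0) far.
  rewrite aG mul0r addr0 in h1; rewrite aG mul0r subr0 in h2.
  rewrite (@eq_esum _ _ _ _ (fun m => (normc (ift G (lat L m)) ^+ 2)%:E)).
    by apply/eqP; rewrite eq_le h1 h2.
  by move=> m _; rewrite /G ift_modulate addrC.
under eq_integral do rewrite tot.
rewrite integral_cst; last exact: measurable_tile.
transitivity ((acorr H 0 * L ^+ d)%:E * (L^-1 ^+ d)%:E)%E.
  by congr (_ * _)%E; exact: leb_tile.
rewrite -/(N2 H) -acorr0// -EFinM; congr EFin.
by rewrite -mulrA -exprMn divff ?gt_eqF// expr1n mulr1.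
Qed.

End plancherel.

(** * The atoms, their integrability and their Fourier transforms *)

Section atoms.
Context {R : realType} {d : nat}.
Local Notation vec := 'rV[R]_d.
Local Notation zvec := 'rV[int]_d.
Local Notation leb := (@lebesgue_measure_rV R d).
Implicit Types (f g h phi : vec -> R[i]).

Lemma cLnorm1E f : cLnorm 1%:E f = (\int[leb]_x (normc (f x))%:E)%E.
Proof.
rewrite /cLnorm Lnorm1; apply: eq_integral => x _.
by rewrite /= ger0_norm// normc_ge0.
Qed.

Lemma cLp1_cintble f : cLp 1%:E f -> cintble leb f.
Proof. by move=> [mf]; rewrite cLnorm1E. Qed.

Lemma cLnorm2_poweR f : (cLnorm 2%:E f `^ 2)%E = N2 f.
Proof.
rewrite /cLnorm poweR_Lnorm ?pnatr_eq0//; apply: eq_integral => x _.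
by rewrite gee0_abs ?lee_fin ?normc_ge0// poweR_EFin powR_mulrn// normc_ge0.
Qed.

Lemma cLnorm2_sqr f : (cLnorm 2%:E f ^+ 2)%E = N2 f.
Proof.
rewrite -cLnorm2_poweR; have : (0 <= cLnorm 2%:E f)%E by exact: Lnorm_ge0.
case: (cLnorm 2%:E f) => [r| |//] r0.
  by rewrite poweR_EFin powR_mulrn.
by rewrite expe2 mulyy poweRyr// pnatr_eq0.
Qed.

Lemma cLp2E f : cLp 2%:E f <-> cmeas f /\ (N2 f < +oo)%E.
Proof.
split => -[mf h]; split => //.
  rewrite -cLnorm2_sqr expe2; have : (0 <= cLnorm 2%:E f)%E by exact: Lnorm_ge0.
  by move: h; case: (cLnorm 2%:E f) => // r _ _; rewrite -EFinM ltry.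
move: h; rewrite -cLnorm2_sqr expe2; have : (0 <= cLnorm 2%:E f)%E by exact: Lnorm_ge0.
by case: (cLnorm 2%:E f) => // r _; rewrite ?ltry// mulyy.
Qed.

Lemma beta_gt0 p : (0 < beta p)%N.
Proof. by case: p => // p; rewrite expn_gt0. Qed.

Lemma beta_gt0R p : 0 < (beta p)%:R :> R.
Proof. by rewrite ltr0n beta_gt0. Qed.

Lemma boxZ_bound p l (m : zvec) : Lambda (p, l) -> boxZ (R := R) p l m ->
  forall i, `|m ord0 i| <= (2 * beta p)%:Z.
Proof.
rewrite /boxZ /box; case: p l => [|p] [l|]//=.
  move=> _ h i; have := h i; rewrite mxE -[1]/(1%:~R) -mulrNz !ler_int ler_norml.
  by move=> /andP[h1 h2]; apply/andP; split; lia.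
move=> [lJ _] h i; have /andP[l1 l2] := lJ i.
have /andP[h1 h2] := h i; rewrite mxE in h1 h2.
have b0 := beta_gt0 p.+1; set B := (2 ^ p)%N in h1 h2 *; rewrite -/B in b0.
move: h1; rewrite -[B%:R]/((B%:Z)%:~R) -intrM ler_int => h1.
move: h2; rewrite -[B%:R]/((B%:Z)%:~R) -[1]/(1%:~R) -intrD -intrM ltr_int => h2.
have /= b0' : 0 < B%:Z by [].
rewrite ler_norml; apply/andP; split; first by rewrite PoszM; nia.
by rewrite PoszM; nia.
Qed.

Definition boxlist p : seq zvec :=
  map (fun j : {ffun 'I_d -> 'I_((4 * beta p).+1)} =>
    \row_i ((j i : nat)%:Z - (2 * beta p)%:Z)) (enum predT).

Lemma boxlistP p l (m : zvec) : Lambda (p, l) -> boxZ (R := R) p l m ->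
  m \in boxlist p.
Proof.
move=> pl pm; have hm := boxZ_bound pl pm.
have mB i : - (2 * beta p)%:Z <= m ord0 i <= (2 * beta p)%:Z.
  by rewrite -ler_norml.
have z0 i : 0 <= m ord0 i + (2 * beta p)%:Z by have /andP[h1 h2] := mB i; lia.
have zN i : (`|(m ord0 i + (2 * beta p)%:Z)%R| < (4 * beta p).+1)%N.
  by rewrite -ltz_nat gez0_abs ?z0//; have /andP[h1 h2] := mB i; lia.
apply/mapP; exists [ffun i => Ordinal (zN i)]; first by rewrite mem_enum.
apply/rowP => i; rewrite !mxE ffunE /= gez0_abs ?z0// addrK.
by congr (m _ _); exact: val_inj.
Qed.

(** Each coordinate ranges over [4 * beta p + 1] integers, and [beta p >= 1] absorbs the 1 into a
    fifth [beta p]. *)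
Lemma size_boxlist p : (size (boxlist p) <= (5 * beta p) ^ d)%N.
Proof.
rewrite size_map -cardE card_ffun !card_ord.
have [->|d0] := posnP d; first by rewrite !expn0.
by rewrite leq_exp2r//; have := beta_gt0 p; lia.
Qed.

Variables (phi : vec -> R[i]) (mu nu : R).
Hypotheses (phi_L1 : cintble leb phi) (phi_L2 : (N2 phi < +oo)%E).

Lemma scaled_boxZ_finite p l : Lambda (p, l) -> finite_set (scaled_boxZ mu p l : set vec).
Proof.
move=> pl; apply: finite_image; apply: (@sub_finite_set _ _ [set` boxlist p]).
  by move=> m /= pm; exact: boxlistP pl pm.
exact: finite_seq.
Qed.

Definition freqs p l : seq vec := fset_set (scaled_boxZ mu p l).

Lemma mem_freqs p l eta : Lambda (p, l) ->
  eta \in freqs p l -> exists2 m, boxZ (R := R) p l m & eta = mu *: vec_of_int m.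
Proof.
move=> pl; rewrite /freqs in_fset_set; last exact: scaled_boxZ_finite.
by move=> /set_mem[m pm <-]; exists m.
Qed.

Lemma size_freqs p l : Lambda (p, l) -> (size (freqs p l) <= (5 * beta p) ^ d)%N.
Proof.
move=> pl; apply: leq_trans (size_boxlist p).
rewrite -(size_map (fun m : zvec => mu *: vec_of_int m : vec)).
apply: uniq_leq_size; first exact: fset_uniq.
move=> eta /(mem_freqs pl)[m pm ->].
by apply: map_f; exact: boxlistP pl pm.
Qed.

Lemma PhiE p l w : Lambda (p, l) ->
  Phi phi mu p l w = \sum_(eta <- freqs p l) fourier phi (w - eta).
Proof. by move=> pl; rewrite /Phi fsbig_finite//; exact: scaled_boxZ_finite. Qed.

(** The atom before translation and normalization; its modulations of [phi] become shifts under the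
    Fourier transform, which is therefore [Phi]. *)
Definition Psi p l (y : vec) : R[i] :=
  \sum_(eta <- freqs p l) cis (2 * pi * dot eta y) * phi y.

Lemma atomE p k l x : Lambda (p, l) ->
  atom phi mu nu (p, k, l) x =
  real_complex R ((beta p)%:R `^ (- (d%:R / 2))) *
  Psi p l (x - (nu / (beta p)%:R) *: vec_of_int k).
Proof. by move=> pl; rewrite /= fsbig_finite//; exact: scaled_boxZ_finite. Qed.

Lemma cintble_Psi p l : cintble leb (Psi p l).
Proof. by apply: cintble_sum => eta; exact: cintble_cis. Qed.

Lemma cintble_atom p k l : Lambda (p, l) -> cintble leb (atom phi mu nu (p, k, l)).
Proof.
move=> pl; rewrite (_ : atom _ _ _ _ = fun x : vec =>
  real_complex R ((beta p)%:R `^ (- (d%:R / 2))) *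
  Psi p l (x - (nu / (beta p)%:R) *: vec_of_int k)); last first.
  by apply/funext => x; rewrite atomE.
apply: cintbleZ; exact: (@cintble_shift _ _ _ (- _) (cintble_Psi p l)).
Qed.

Lemma N2_atom_lty p k l : Lambda (p, l) -> (N2 (atom phi mu nu (p, k, l)) < +oo)%E.
Proof.
move=> pl; pose c : R := (beta p)%:R `^ (- (d%:R / 2)).
pose n : R := (size (freqs p l))%:R.
have mphi : cmeas phi := phi_L1.1.
apply: (@le_lt_trans _ _ (\int[leb]_x (((c * n) ^+ 2)%:E *
   (normc (phi (x - (nu / (beta p)%:R) *: vec_of_int k)) ^+ 2)%:E))%E).
  apply: ge0_le_integral => //.
  - by move=> x _; rewrite lee_fin sqr_ge0.
  - by apply: measurable_normc2E; exact: (cintble_atom k pl).1.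
  - apply: emeasurable_funM => //; apply: measurable_normc2E.
    exact: (cmeas_shift (- _) mphi).
  - move=> x _; rewrite -EFinM lee_fin -exprMn.
    rewrite lerXn2r ?nnegrE ?normc_ge0 ?mulr_ge0 ?normc_ge0 ?powR_ge0//.
    rewrite atomE// normcM normc_real ger0_norm ?powR_ge0// -mulrA.
    rewrite ler_wpM2l ?powR_ge0//; apply: le_trans (normc_sum_le _ _ _) _.
    under eq_bigr do rewrite normcM normc_cis mul1r.
    by rewrite big_const_seq count_predT iter_addr_0 mulr_natl.
rewrite ge0_integralZl_EFin ?sqr_ge0//; last 2 first.
- by move=> x _; rewrite lee_fin sqr_ge0.
- by apply: measurable_normc2E; exact: (cmeas_shift (- _) mphi).
rewrite lte_mul_pinfty ?lee_fin ?sqr_ge0//.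
by rewrite -[X in (X < _)%E]/(N2 _) (N2_shift (- _) mphi).
Qed.

Lemma fourier_shift f (u w : vec) : cintble leb f ->
  fourier (fun x => f (x - u)) w = cis (- (2 * pi * dot u w)) * fourier f w.
Proof.
move=> fi.
have i1 : cintble leb (fun x => cis (- (2 * pi * dot x w)) * f x).
  rewrite (_ : (fun x => _) = (fun x => cis (2 * pi * dot (- w) x) * f x)).
    exact: cintble_cis.
  by apply/funext => x; rewrite dotNl dotC mulrN.
rewrite -[RHS]cintZ// -(@cint_shift _ _
  (fun x => cis (- (2 * pi * dot u w)) * (cis (- (2 * pi * dot x w)) * f x)) (- u)).
  apply: cint_ext => x; rewrite mulrA -cisD; congr (cis _ * _).
  by rewrite dotDl dotNl; ring.
by apply: cmeasM; [exact: cmeas_cst|exact: i1.1].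
Qed.

Lemma fourier_Psi p l w : Lambda (p, l) -> fourier (Psi p l) w = Phi phi mu p l w.
Proof.
move=> pl; rewrite PhiE// /fourier /Psi.
rewrite -[LHS]/(cint leb _).
under cint_ext do rewrite mulr_sumr.
rewrite cint_sum; last first.
  move=> eta; rewrite (_ : (fun x => _) = (fun x => cis (2 * pi * dot (eta - w) x) * phi x)).
    exact: cintble_cis.
  apply/funext => x; rewrite mulrA -cisD; congr (cis _ * _).
  by rewrite dotBl [dot x w]dotC; ring.
apply: eq_bigr => eta _; apply: cint_ext => x; rewrite mulrA -cisD.
by congr (cis _ * _); rewrite dotBr [dot x eta]dotC; ring.
Qed.

Lemma fourier_atom p k l w : Lambda (p, l) ->
  fourier (atom phi mu nu (p, k, l)) w =
  real_complex R ((beta p)%:R `^ (- (d%:R / 2))) *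
  (cis (- (2 * pi * dot ((nu / (beta p)%:R) *: vec_of_int k) w)) * Phi phi mu p l w).
Proof.
move=> pl; rewrite -fourier_Psi// -fourier_shift; last exact: cintble_Psi.
set c := real_complex R _.
rewrite -[RHS]cintZ; last first.
  rewrite (_ : (fun x => _) = (fun x => cis (2 * pi * dot (- w) x) *
     Psi p l (x - (nu / (beta p)%:R) *: vec_of_int k))).
    apply: cintble_cis; exact: (@cintble_shift _ _ _ (- _) (cintble_Psi p l)).
  by apply/funext => x; rewrite dotNl dotC mulrN.
by apply: cint_ext => x; rewrite atomE// mulrCA.
Qed.

(** The multiplication formula: the exponential is a bounded kernel between two integrable
    functions, so the order of integration can be exchanged. *)
Lemma inner_ift M K h g : bounded_in_cube M K h -> cintble leb g ->
  inner (ift h) g = cint leb (fun w => h w * ((fourier g w)^*)%R).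
Proof.
move=> bh gi; have ih := bounded_in_cube_cintble bh.
transitivity (cint leb (fun x => ((g x)^*)%R *
    cint leb (fun w => cis (2 * pi * dot x w) * h w))).
  by apply: cint_ext => x; rewrite mulrC.
have mk : cmeas (fun z : vec * vec => cis (2 * pi * dot z.1 z.2)).
  by apply: cmeas_cis; apply: measurable_funM => //; exact: measurable_dot.
have k1 (z : vec * vec) : normc (cis (2 * pi * dot z.1 z.2)) <= 1.
  by rewrite normc_cis.
apply: (etrans (cint_kernel_swap (cintbleJ gi) ih mk k1)).
apply: cint_ext => w; congr (_ * _).
have ig : cintble leb (fun x : vec => cis (- (2 * pi * dot x w)) * g x).
  rewrite (_ : (fun x => _) = (fun x => cis (2 * pi * dot (- w) x) * g x)).
    exact: cintble_cis.
  by apply/funext => x; rewrite dotNl dotC mulrN.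
transitivity (cint leb (fun x : vec => ((cis (- (2 * pi * dot x w)) * g x)^*)%R)).
  by apply: cint_ext => x; rewrite rmorphM /= cisN conjCK.
exact: cintJ.
Qed.

End atoms.

(** * Main term and error for the atoms of a single box *)

Section box_sums.
Context {R : realType} {d : nat}.
Local Notation vec := 'rV[R]_d.
Local Notation zvec := 'rV[int]_d.
Local Notation leb := (@lebesgue_measure_rV R d).
Variables (phi : vec -> R[i]) (mu nu b N C : R).
Hypotheses (d_ge1 : (1 <= d)%N) (phi_L1 : cintble leb phi) (mu_gt0 : 0 < mu)
  (b_gt0 : 0 < b)
  (Phi_ub : forall w : vec,
    (\esum_(pl in @Lambda d) (normc (Phi phi mu pl.1 pl.2 w) ^+ 2)%:E <= b%:E)%E)
  (N_gt : 2 * d%:R < N) (C_gt0 : 0 < C)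
  (phi_decay : forall w : vec, normc (fourier phi w) <= C / (1 + enorm w) `^ N)
  (nu_gt0 : 0 < nu) (nu_le : nu <= (16 * mu)^-1).

Lemma Phi_le p l w : Lambda (p, l) -> normc (Phi phi mu p l w) <= Num.sqrt b.
Proof.
move=> pl.
rewrite -(@ler_pXn2r _ 2%N)// ?nnegrE ?normc_ge0 ?sqrtr_ge0// sqr_sqrtr; last exact: ltW.
rewrite -lee_fin; apply: le_trans (Phi_ub w).
have := @sum_le_esum R _ (@Lambda d) (fun pl => (normc (Phi phi mu pl.1 pl.2 w) ^+ 2)%:E)
  [:: (p, l)] isT.
rewrite big_seq1; apply => i; rewrite inE => /eqP ->; exact: pl.
Qed.

Lemma cmeas_fourier f : cmeas f -> cmeas (@fourier R d f).
Proof.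
move=> mf; apply: (@cmeas_cint_section _ _ _ _ R leb
  (fun p : vec * vec => cis (- (2 * pi * dot p.2 p.1)) * f p.2)).
apply: cmeasM; last exact: (cmeas_comp mf).
apply: cmeas_cis; apply: measurableT_comp => //; apply: measurable_funM => //.
exact: measurable_dot.
Qed.

Lemma cmeas_Phi p l : Lambda (p, l) -> cmeas (Phi phi mu p l).
Proof.
move=> pl; rewrite (_ : Phi _ _ _ _ = fourier (Psi phi mu p l)).
  by apply: cmeas_fourier; exact: (cintble_Psi mu phi_L1 p l).1.
by apply/funext => w; rewrite fourier_Psi.
Qed.

Lemma enorm_ge (x : vec) i : `|x ord0 i| <= enorm x.
Proof.
rewrite -(@ler_pXn2r _ 2%N)// ?nnegrE ?sqrtr_ge0//.
rewrite sqr_sqrtr; last by apply: sumr_ge0 => j _; rewrite -expr2 sqr_ge0.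
rewrite real_normK ?num_real// /dot (bigD1 i)//= -expr2 lerDl.
by apply: sumr_ge0 => j _; rewrite -expr2 sqr_ge0.
Qed.

(** As the base is at least 1, the exponent may be lowered from [N] to the integer [2 * d], which
    later splits into an exponent 2 per coordinate. *)
Lemma fourier_phi_le (x : vec) i (r : R) : 0 < r -> r <= `|x ord0 i| ->
  normc (fourier phi x) <= C * r ^- (2 * d).
Proof.
move=> r0 rx; apply: le_trans (phi_decay x) _; rewrite ler_wpM2l ?(ltW C_gt0)//.
have r1 : 1 + r <= 1 + enorm x by rewrite lerD2l; exact: le_trans rx (enorm_ge x i).
have x1 : 1 <= 1 + enorm x by rewrite lerDl sqrtr_ge0.
rewrite lef_pV2 ?posrE ?exprn_gt0 ?powR_gt0//; last by rewrite (lt_le_trans _ x1).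
apply: (@le_trans _ _ ((1 + enorm x) `^ ((2 * d)%:R))); last first.
  by apply: ler_powR => //; rewrite natrM ltW.
rewrite powR_mulrn; last by apply: le_trans x1.
by rewrite lerXn2r ?nnegrE ?(ltW r0)//; [apply: le_trans x1|lra].
Qed.

(** All frequencies of the box have coordinates at most [2 * mu * beta p <= s / 4], so after
    subtracting one from [z] the coordinate [i] is still at least [s / 4]. *)
Lemma Phi_far1 p l (z : vec) i (s : R) : Lambda (p, l) -> 0 < s ->
  8 * mu * (beta p)%:R <= s -> s / 2 <= `|z ord0 i| ->
  normc (Phi phi mu p l z) <= ((5 * beta p) ^ d)%:R * (C * (s / 4) ^- (2 * d)).
Proof.
move=> pl s0 hs hz; rewrite PhiE//; apply: le_trans (normc_sum_le _ _ _) _.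
have s40 : 0 < s / 4 by rewrite divr_gt0.
have B0 : 0 <= C * (s / 4) ^- (2 * d).
  by rewrite mulr_ge0 ?(ltW C_gt0)// invr_ge0 exprn_ge0// ltW.
apply: (@le_trans _ _ (\sum_(eta <- freqs mu p l) C * (s / 4) ^- (2 * d))).
  rewrite big_seq [leRHS]big_seq; apply: ler_sum => eta etaf.
  have [m pm ->] := mem_freqs pl etaf.
  apply: (@fourier_phi_le _ i) => //; rewrite !mxE.
  have hm : `|(m ord0 i)%:~R : R| <= 2 * (beta p)%:R.
    rewrite -intr_norm (_ : 2 * (beta p)%:R = ((2 * beta p)%:Z)%:~R :> R).
      by rewrite ler_int; exact: (boxZ_bound pl pm).
    by rewrite -natrM pmulrn.
  have h1 : `|mu * (m ord0 i)%:~R| <= s / 4.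
    rewrite normrM gtr0_norm//; apply: (@le_trans _ _ (mu * (2 * (beta p)%:R))).
      by rewrite ler_wpM2l// ltW.
    by lra.
  by have := lerB_dist (z ord0 i) (mu * (m ord0 i)%:~R); lra.
rewrite big_const_seq count_predT iter_addr_0 -[X in X <= _]mulr_natl ler_wpM2r// ler_nat.
exact: size_freqs.
Qed.

(* There are at most [(5 * beta p) ^ d] frequencies, each at distance at least a
   quarter of the largest coordinate: hence [80 = 5 * 4 ^ 2]. *)
Definition farK : R := Num.sqrt b * C * 80 ^+ d.

(** With [s] the largest coordinate of [u] in modulus, [y] or [y + u] has a coordinate of modulus at
    least [s / 2]. The value of [Phi] there decays, and the other value is at most [Num.sqrt b]. *)
Lemma Phi_far p l (y u : vec) : Lambda (p, l) ->
  ~ cube ((beta p)%:R / nu / 2) u ->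
  normc (Phi phi mu p l (y + u)) * normc (Phi phi mu p l y) <=
  farK * (beta p)%:R ^+ d * ((beta p)%:R / nu) ^- (2 * d) *
    \prod_(i < d) tailw ((beta p)%:R / nu) (u ord0 i).
Proof.
move=> pl hu; set L := (beta p)%:R / nu.
have be0 := @beta_gt0R R p.
have L0 : 0 < L by rewrite divr_gt0.
pose i0 : 'I_d := [arg max_(i > Ordinal d_ge1) `|u ord0 i|]%O.
have hmax j : `|u ord0 j| <= `|u ord0 i0|.
  by rewrite /i0; case: arg_maxP => // i _ h; exact: h.
pose s := `|u ord0 i0|.
have sL : L / 2 < s.
  by rewrite ltNge; apply/negP => h; apply: hu => j /=; exact: le_trans (hmax j) h.
have s0 : 0 < s by apply: lt_trans sL; rewrite divr_gt0.
(* Here [nu <= (16 * mu)^-1] enters: it makes half a cell, [beta p / (2 * nu)], at least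
   [8 * mu * beta p]. *)
have s8 : 8 * mu * (beta p)%:R <= s.
  apply: le_trans (ltW sL); rewrite /L ler_pdivlMr// ler_pdivlMr//.
  apply: (@le_trans _ _ (8 * mu * (beta p)%:R * 2 * (16 * mu)^-1)).
    by rewrite ler_wpM2l// !mulr_ge0 ?(ltW mu_gt0) ?(ltW be0).
  by rewrite le_eqVlt; apply/orP; left; apply/eqP; field; rewrite gt_eqF.
have sb0 : 0 <= Num.sqrt b := sqrtr_ge0 b.
have Q0 : 0 <= ((5 * beta p) ^ d)%:R * (C * (s / 4) ^- (2 * d)).
  by rewrite !mulr_ge0 ?(ltW C_gt0)// invr_ge0 exprn_ge0// divr_ge0// ltW.
apply: (@le_trans _ _ (Num.sqrt b * (((5 * beta p) ^ d)%:R * (C * (s / 4) ^- (2 * d))))).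
  have [h|h] := leP (s / 2) `|y ord0 i0|.
    by rewrite ler_pM ?normc_ge0 ?Phi_le//; exact: (Phi_far1 pl s0 s8 h).
  rewrite mulrC ler_pM ?normc_ge0 ?Phi_le//; apply: (Phi_far1 pl s0 s8 (i := i0)).
  rewrite mxE addrC; have := lerB_normD (u ord0 i0) (y ord0 i0); rewrite -/s; lra.
rewrite /farK.
have -> : Num.sqrt b * (((5 * beta p) ^ d)%:R * (C * (s / 4) ^- (2 * d))) =
   Num.sqrt b * C * 80 ^+ d * (beta p)%:R ^+ d * s ^- (2 * d).
  rewrite natrX natrM exprMn (_ : 80 = 5 * 4 ^+ 2 :> R); last by ring.
  rewrite [(5 * 4 ^+ 2) ^+ d]exprMn -exprM exprMn exprVn invfM invrK; ring.
rewrite -[leRHS]mulrA ler_wpM2l//.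
  by rewrite !mulr_ge0 ?(ltW C_gt0) ?exprn_ge0 ?(ltW be0).
(* One factor [(L / s)^2] per coordinate, so that [tailw_ge] gives a product to which the
   one-dimensional Fejer estimate applies. *)
have -> : s ^- (2 * d) = L ^- (2 * d) * \prod_(i < d) (L / s) ^+ 2.
  rewrite prodr_const card_ord -exprM -exprVn -exprMn mulKf ?gt_eqF//.
  by rewrite exprVn.
rewrite ler_wpM2l ?invr_ge0 ?exprn_ge0 ?(ltW L0)//.
apply: ler_prod => i _; rewrite sqr_ge0 /=.
by apply: tailw_ge => //; exact: ltW.
Qed.


Definition wcoef (p : nat) : R := (beta p)%:R `^ (- (d%:R / 2)).

Lemma wcoef_sqr p : wcoef p ^+ 2 = ((beta p)%:R ^+ d)^-1.
Proof.
have b0 := @beta_gt0R R p; rewrite /wcoef -powR_mulrn ?powR_ge0// -powRrM.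
by rewrite mulNr divfK ?pnatr_eq0// powRN powR_mulrn// ltW.
Qed.

Lemma wcoef_ge0 p : 0 <= wcoef p. Proof. exact: powR_ge0. Qed.

Definition boxed (h : vec -> R[i]) p l (w : vec) : R[i] :=
  real_complex R (wcoef p) * (h w * ((Phi phi mu p l w)^*)%R).

Lemma normc_boxed h p l w :
  normc (boxed h p l w) = wcoef p * (normc (h w) * normc (Phi phi mu p l w)).
Proof. by rewrite !normcM normc_real normcJ ger0_norm// wcoef_ge0. Qed.

Lemma boxed_bounded M K h p l : bounded_in_cube M K h -> Lambda (p, l) ->
  bounded_in_cube M (wcoef p * (K * Num.sqrt b)) (boxed h p l).
Proof.
move=> [mh hK h0] pl; split.
- apply: cmeasM; first exact: cmeas_cst.
  by apply: cmeasM => //; apply: cmeasJ; exact: cmeas_Phi.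
- move=> w; rewrite normc_boxed ler_wpM2l ?wcoef_ge0//.
  by rewrite ler_pM ?normc_ge0 ?Phi_le.
- by move=> w hw; rewrite /boxed h0// mul0r mulr0.
Qed.

Lemma inner_ift_atom M K h p k l : bounded_in_cube M K h -> Lambda (p, l) ->
  inner (ift h) (atom phi mu nu (p, k, l)) =
  ift (boxed h p l) (lat ((beta p)%:R / nu) k).
Proof.
move=> bh pl; rewrite (inner_ift bh); last exact: cintble_atom.
apply: cint_ext => w; rewrite fourier_atom// !rmorphM /= cisN conjCK.
have -> : lat ((beta p)%:R / nu) k = (nu / (beta p)%:R) *: vec_of_int k :> vec.
  by rewrite /lat invfM invrK mulrC.
have -> : ((real_complex R (wcoef p))^*)%R = real_complex R (wcoef p).
  by apply: complex_ext; rewrite ?ReJ ?ImJ //= oppr0.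
by rewrite /boxed; ring.
Qed.

(** The factor [beta p ^ d] that counts the frequencies is cancelled by the square of the
    normalization [wcoef p], leaving [L ^- (2 * d)] with [L = beta p / nu]. *)
Lemma acorr_boxed_far M K h p l (u : vec) : bounded_in_cube M K h -> Lambda (p, l) ->
  ~ cube ((beta p)%:R / nu / 2) u ->
  `|acorr (boxed h p l) u| <= farK * ((beta p)%:R / nu) ^- (2 * d) * fine (N2 h) *
    \prod_(i < d) tailw ((beta p)%:R / nu) (u ord0 i).
Proof.
move=> bh pl hu; have [mh _ _] := bh; set L := _ / nu.
have hoo := bounded_in_cube_sqr_lty bh.
have be0 := @beta_gt0R R p.
have L0 : 0 < L by rewrite divr_gt0.
have f0 : 0 <= farK.
  by rewrite !mulr_ge0 ?sqrtr_ge0 ?(ltW C_gt0) ?exprn_ge0.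
have T0 : 0 <= \prod_(i < d) tailw L (u ord0 i).
  by apply: prodr_ge0 => i _; exact: tailw_ge0.
have [mH _ _] := boxed_bounded bh pl.
pose w := farK * L ^- (2 * d) * \prod_(i < d) tailw L (u ord0 i).
have w0 : 0 <= w.
  apply: mulr_ge0 => //; apply: mulr_ge0 => //.
  by rewrite invr_ge0 exprn_ge0// ltW.
have := @acorr_le R d (boxed h p l) h u w mH mh w0.
have Hh (y : vec) : normc (boxed h p l (y + u)) * normc (boxed h p l y) <=
    w * (normc (h (y + u)) * normc (h y)).
  rewrite !normc_boxed.
  have -> : wcoef p * (normc (h (y + u)) * normc (Phi phi mu p l (y + u))) *
      (wcoef p * (normc (h y) * normc (Phi phi mu p l y))) =
    (wcoef p ^+ 2 * (normc (Phi phi mu p l (y + u)) * normc (Phi phi mu p l y))) *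
      (normc (h (y + u)) * normc (h y)) by ring.
  rewrite ler_wpM2r ?mulr_ge0 ?normc_ge0//.
  apply: le_trans (ler_wpM2l (sqr_ge0 _) (Phi_far y pl hu)) _.
  rewrite wcoef_sqr /w -/L le_eqVlt; apply/orP; left; apply/eqP; field.
  by rewrite !expf_neq0 ?gt_eqF.
move=> /(_ Hh hoo) h1; rewrite -lee_fin; apply: le_trans h1 _.
rewrite -{1}(@fineK _ (N2 h)); last by rewrite ge0_fin_numE// N2_ge0.
by rewrite -EFinM lee_fin /w mulrAC.
Qed.

(** The main term of the sampling estimate as an integral over frequencies. The powers of [beta p]
    have cancelled, so the weight [nu ^- d] is common to all boxes and the sum over boxes acts on
    [|Phi|^2] alone. *)
Definition boxterm (h : vec -> R[i]) p l : \bar R :=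
  (\int[leb]_w ((nu ^- d * normc (h w) ^+ 2)%:E *
     (normc (Phi phi mu p l w) ^+ 2)%:E))%E.

Lemma boxtermE M K h p l : bounded_in_cube M K h -> Lambda (p, l) ->
  boxterm h p l = (acorr (boxed h p l) 0 * ((beta p)%:R / nu) ^+ d)%:E.
Proof.
move=> bh pl; have bH := boxed_bounded bh pl; have [mH _ _] := bH.
have be0 := @beta_gt0R R p.
have L0 : 0 <= ((beta p)%:R / nu) ^+ d by rewrite exprn_ge0// divr_ge0// ltW.
rewrite mulrC EFinM acorr0; last exact: bounded_in_cube_sqr_lty bH.
rewrite -ge0_integralZl_EFin//; last 2 first.
- by move=> w _; rewrite lee_fin sqr_ge0.
- exact: measurable_normc2E.
apply: eq_integral => w _; rewrite -!EFinM; congr EFin.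
rewrite normc_boxed !exprMn wcoef_sqr exprVn; field.
by rewrite !expf_neq0 ?gt_eqF.
Qed.

(** The error [W * (30 * L) ^+ d] of the sampling estimate at [L = beta p / nu]: the powers
    [L ^- (2 * d)] and [L ^ d] combine to [(nu / beta p) ^ d]. *)
Definition boxerr (h : vec -> R[i]) (p : nat) : R :=
  farK * 30 ^+ d * nu ^+ d * fine (N2 h) * ((beta p)%:R ^+ d)^-1.

Lemma boxerrE h p : boxerr h p =
  farK * ((beta p)%:R / nu) ^- (2 * d) * fine (N2 h) * (30 * ((beta p)%:R / nu)) ^+ d.
Proof.
have be0 := @beta_gt0R R p.
rewrite /boxerr mul2n -addnn exprD !exprMn exprVn; field.
by rewrite !expf_neq0 ?gt_eqF.
Qed.

Lemma farK_ge0 : 0 <= farK.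
Proof. by rewrite !mulr_ge0 ?sqrtr_ge0 ?(ltW C_gt0) ?exprn_ge0. Qed.

Lemma box_upper M K h p l : bounded_in_cube M K h -> Lambda (p, l) ->
  (\esum_(k in setT) (normc (inner (ift h) (atom phi mu nu (p, k, l))) ^+ 2)%:E <=
    boxterm h p l + (boxerr h p)%:E)%E.
Proof.
move=> bh pl; have bH := boxed_bounded bh pl.
have L0 : 0 < (beta p)%:R / nu by rewrite divr_gt0// beta_gt0R.
rewrite (boxtermE bh pl) boxerrE -EFinD.
under eq_esum do rewrite (inner_ift_atom _ bh pl).
apply: (sampling_le L0 bH) => [|u]; last exact: (acorr_boxed_far bh pl).
apply: mulr_ge0; last by rewrite fine_ge0// N2_ge0.
by apply: mulr_ge0; [exact: farK_ge0|rewrite invr_ge0 exprn_ge0// ltW].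
Qed.

Lemma box_lower M K h p l : bounded_in_cube M K h -> Lambda (p, l) ->
  (boxterm h p l <= \esum_(k in setT)
    (normc (inner (ift h) (atom phi mu nu (p, k, l))) ^+ 2)%:E + (boxerr h p)%:E)%E.
Proof.
move=> bh pl; have bH := boxed_bounded bh pl.
have L0 : 0 < (beta p)%:R / nu by rewrite divr_gt0// beta_gt0R.
rewrite (boxtermE bh pl) boxerrE -leeBlDr// -EFinB.
under eq_esum do rewrite (inner_ift_atom _ bh pl).
apply: (sampling_ge L0 bH) => [|u]; last exact: (acorr_boxed_far bh pl).
apply: mulr_ge0; last by rewrite fine_ge0// N2_ge0.
by apply: mulr_ge0; [exact: farK_ge0|rewrite invr_ge0 exprn_ge0// ltW].
Qed.

End box_sums.

(** * Scaling of extended sums *)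

Section esum_scale.
Context {R : realType} {T : choiceType}.
Local Open Scope ereal_scope.

(** One inequality, proved for every nonnegative constant, gives the other when applied to the
    inverse of [c]. *)
Lemma esumZl (S : set T) (c : R) (f : T -> \bar R) : (0 <= c)%R ->
  (forall i, S i -> 0 <= f i) ->
  \esum_(i in S) (c%:E * f i) = c%:E * \esum_(i in S) f i.
Proof.
move=> c0 f0.
have up (c' : R) (g : T -> \bar R) : (0 <= c')%R -> (forall i, S i -> 0 <= g i) ->
    \esum_(i in S) (c'%:E * g i) <= c'%:E * \esum_(i in S) g i.
  move=> c'0 g0; apply: esum_le_bound => r ur rS.
  rewrite big_seq -ge0_sume_distrr; last by move=> i ir; apply: g0; exact: rS.
  by rewrite -big_seq; apply: lee_wpmul2l; [rewrite lee_fin|exact: sum_le_esum].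
apply/eqP; rewrite eq_le up//=.
have [->|cn0] := eqVneq c 0%R.
  by rewrite mul0e; apply: esum_ge0 => i Si; rewrite mul0e.
have cp : (0 < c)%R by rewrite lt_neqAle eq_sym cn0.
rewrite -lee_pdivlMl//.
rewrite [leLHS](@eq_esum _ _ _ _ (fun i => c^-1%:E * (c%:E * f i))).
  by apply: up => [|i Si]; [rewrite invr_ge0|rewrite mule_ge0// f0].
by move=> i Si; rewrite muleA -EFinM mulVf// mul1e.
Qed.

End esum_scale.

(** * Summability over the index set of boxes *)

Section Lambda_sum.
Context {R : realType} (d : nat).
Local Notation zvec := 'rV[int]_d.

Definition Jlist : seq zvec :=
  map (fun j : {ffun 'I_d -> 'I_4} => \row_i ((j i : nat)%:Z - 2)) (enum predT).

Lemma JlistP (l : zvec) : J l -> l \in Jlist.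
Proof.
move=> [lJ _].
have z0 i : 0 <= l ord0 i + 2 by have /andP[h1 h2] := lJ i; lia.
have zN i : (`|(l ord0 i + 2)%R| < 4)%N.
  by rewrite -ltz_nat gez0_abs ?z0//; have /andP[h1 h2] := lJ i; lia.
apply/mapP; exists [ffun i => Ordinal (zN i)]; first by rewrite mem_enum.
apply/rowP => i; rewrite !mxE ffunE /= gez0_abs ?z0// addrK.
by congr (l _ _); exact: val_inj.
Qed.

Lemma ler_sum_subset (T : eqType) (g : T -> R) (r r' : seq T) :
  (forall t, 0 <= g t) -> uniq r -> {subset r <= r'} ->
  \sum_(t <- r) g t <= \sum_(t <- r') g t.
Proof.
move=> g0; elim: r r' => [|x r IH] r' /= => [_ _|/andP[xr ur] sub].
  by rewrite big_nil sumr_ge0.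
have xr' : x \in r' by apply: sub; rewrite mem_head.
rewrite (perm_big _ (perm_to_rem xr')) !big_cons lerD2l; apply: IH => // t tr.
have : t \in r' by apply: sub; rewrite inE tr orbT.
rewrite (perm_mem (perm_to_rem xr')) inE => /orP[/eqP tx|//].
by rewrite -tx tr in xr.
Qed.

(** [beta 0] and [beta 1] are both 1, so the sum is 1 plus a partial sum of a geometric series with
    total 2. *)
Lemma beta_inv_sum P : \sum_(p <- iota 0 P) ((beta p)%:R)^-1 <= 3 :> R.
Proof.
have h q : \sum_(p <- iota 1 q) ((beta p)%:R)^-1 <= 2 - 2 / (2 ^ q)%:R :> R.
  elim: q => [|q IH]; first by rewrite big_nil expn0 divr1 subrr.
  rewrite -(addn1 q) iotaD big_cat /= big_seq1 add1n /=.
  have -> : (2 / (2 ^ (q + 1))%:R : R) = ((2 ^ q)%:R)^-1.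
    by rewrite addn1 expnS natrM invfM mulrA divff// mul1r.
  have e : (2 / (2 ^ q)%:R : R) = ((2 ^ q)%:R)^-1 + ((2 ^ q)%:R)^-1 by ring.
  by rewrite e in IH; lra.
case: P => [|P]; first by rewrite big_nil.
rewrite /= big_cons /= invr1; have := h P.
have : 0 <= 2 / (2 ^ P)%:R :> R by rewrite divr_ge0.
by lra.
Qed.

(** At each scale at most [4 ^ d] multi-indices and the dummy index, times the bound 3 of
    [beta_inv_sum]. *)
Definition LambdaC : R := (4 ^ d).+1%:R * 3.

Lemma Lambda_sum_le (g : nat -> R) : (forall p, 0 <= g p <= ((beta p)%:R)^-1) ->
  (\esum_(pl in @Lambda d) (g pl.1)%:E <= LambdaC%:E)%E.
Proof.
move=> hg; apply: esum_le_bound => r ur rL; rewrite sumEFin lee_fin.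
pose P := (\max_(pl <- r) pl.1).+1.
pose ls : seq (option zvec) := None :: map Some Jlist.
pose r' : seq (nat * option zvec) := [seq (p, l) | p <- iota 0 P, l <- ls].
have g0 p : 0 <= g p by have /andP[] := hg p.
apply: (@le_trans _ _ (\sum_(pl <- r') g pl.1)).
  apply: ler_sum_subset => // -[p l] plr; apply/allpairsP; exists (p, l); split => //.
    rewrite mem_iota add0n /P ltnS.
    exact: (@leq_bigmax_seq _ r (fun=> true) (fun pl => pl.1) (p, l)).
  have := rL _ plr; rewrite /ls; case: p l {plr} => [|p] [l|]//= lJ.
  rewrite inE /=; apply: map_f; exact: JlistP.
rewrite /r' big_allpairs_dep.
have sz : size ls = (4 ^ d).+1.
  rewrite -[LHS]/(size (map Some Jlist)).+1 size_map /Jlist size_map -cardE.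
  by rewrite card_ffun !card_ord.
rewrite (eq_bigr (fun p => (4 ^ d).+1%:R * g p)); last first.
  by move=> p _ /=; rewrite big_const_seq count_predT iter_addr_0 sz mulr_natl.
rewrite -mulr_sumr ler_wpM2l//; apply: le_trans (beta_inv_sum P).
by apply: ler_sum => p _; have /andP[] := hg p.
Qed.

End Lambda_sum.

Definition frame_sum {R : realType} {d : nat} {I : choiceType} (S : set I)
    (psi : I -> 'rV[R]_d -> R[i]) (f : 'rV[R]_d -> R[i]) : \bar R :=
  (\esum_(i in S) (normc (inner f (psi i)) ^+ 2)%:E)%E.

(** * The frame inequality on inverse transforms *)

Section frame_energy.
Context {R : realType} {d : nat}.
Local Notation vec := 'rV[R]_d.
Local Notation zvec := 'rV[int]_d.
Local Notation leb := (@lebesgue_measure_rV R d).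
Variables (phi : vec -> R[i]) (mu nu a b N C : R).
Hypotheses (d_ge1 : (1 <= d)%N) (phi_L1 : cintble leb phi) (mu_gt0 : 0 < mu)
  (a_gt0 : 0 < a) (b_gt0 : 0 < b)
  (Phi_bounds : forall w : vec,
    (a%:E <= \esum_(pl in @Lambda d) (normc (Phi phi mu pl.1 pl.2 w) ^+ 2)%:E
          <= b%:E)%E)
  (N_gt : 2 * d%:R < N) (C_gt0 : 0 < C)
  (phi_decay : forall w : vec, normc (fourier phi w) <= C / (1 + enorm w) `^ N)
  (nu_gt0 : 0 < nu) (nu_le : nu <= (16 * mu)^-1) (nu_le1 : nu <= 1)
  (nu_small : @farK R d b C * 30 ^+ d * @LambdaC R d * nu <= a / 2).

Local Notation energy := (frame_sum (@Gamma d) (atom phi mu nu)).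

Lemma frame_sum_atomE f : energy f = (\esum_(pl in @Lambda d) \esum_(k in setT)
  (normc (inner f (atom phi mu nu (pl.1, k, pl.2))) ^+ 2)%:E)%E.
Proof.
rewrite esum_esum; last by move=> pl k _ _; rewrite lee_fin sqr_ge0.
rewrite /frame_sum; apply: (@reindex_esum R _ _ _ _ (fun x : (nat * option zvec) * zvec => (x.1.1, x.2, x.1.2))).
split.
- by move=> [[p l] k] [].
- by move=> [[p l] k] [[p' l'] k'] _ _ /= [-> -> ->].
- by move=> [[p k] l] /= gl; exists ((p, l), k).
Qed.

Let Phi_ub w : (\esum_(pl in @Lambda d) (normc (Phi phi mu pl.1 pl.2 w) ^+ 2)%:E <= b%:E)%E.
Proof. by have /andP[] := Phi_bounds w. Qed.

Let mPhi pl : Lambda pl -> measurable_fun setT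
  (fun w : vec => (normc (Phi phi mu pl.1 pl.2 w) ^+ 2)%:E).
Proof.
by case: pl => p l pl; apply: measurable_normc2E; exact: (cmeas_Phi mu phi_L1 pl).
Qed.

Lemma boxterm_sum h : cmeas h ->
  ((a * nu ^- d)%:E * N2 h <= \esum_(pl in @Lambda d) boxterm phi mu nu h pl.1 pl.2
    <= (b * nu ^- d)%:E * N2 h)%E.
Proof.
move=> mh; have nd0 : 0 <= nu ^- d by rewrite invr_ge0 exprn_ge0// ltW.
have mh2 : measurable_fun setT (fun w : vec => (nu ^- d * normc (h w) ^+ 2)%:E).
  by apply/measurable_EFinP; apply: measurable_funM => //; exact: measurable_normc2.
have h0 (w : vec) : 0 <= nu ^- d * normc (h w) ^+ 2 by rewrite mulr_ge0// sqr_ge0.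
have sE : (\esum_(pl in @Lambda d) boxterm phi mu nu h pl.1 pl.2 =
  \int[leb]_w ((nu ^- d * normc (h w) ^+ 2)%:E *
    \esum_(pl in @Lambda d) (normc (Phi phi mu pl.1 pl.2 w) ^+ 2)%:E))%E.
  rewrite -integral_esum; last 2 first.
  - by move=> pl Lpl; apply: emeasurable_funM => //; exact: mPhi.
  - by move=> pl w _; rewrite mule_ge0 ?lee_fin ?sqr_ge0//.
  apply: eq_integral => w _; rewrite esumZl// => pl _.
  by rewrite lee_fin sqr_ge0.
have cE (c : R) : 0 <= c -> ((c * nu ^- d)%:E * N2 h =
    \int[leb]_w ((nu ^- d * normc (h w) ^+ 2)%:E * c%:E))%E.
  move=> c0; rewrite /N2 -ge0_integralZl_EFin ?mulr_ge0//.
  - by apply: eq_integral => w _; rewrite -!EFinM; congr EFin; ring.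
  - by move=> w _; rewrite lee_fin sqr_ge0.
  - exact: measurable_normc2E.
have ms : measurable_fun setT (fun w : vec => (nu ^- d * normc (h w) ^+ 2)%:E *
    \esum_(pl in @Lambda d) (normc (Phi phi mu pl.1 pl.2 w) ^+ 2)%:E)%E.
  apply: emeasurable_funM => //; apply: measurable_esum => //.
  by move=> pl w _; rewrite lee_fin sqr_ge0.
have s0 (w : vec) : (0 <= \esum_(pl in @Lambda d) (normc (Phi phi mu pl.1 pl.2 w) ^+ 2)%:E)%E.
  by apply: esum_ge0 => pl _; rewrite lee_fin sqr_ge0.
rewrite sE (cE a (ltW a_gt0)) (cE b (ltW b_gt0)); apply/andP; split; apply: ge0_le_integral => //.
- by move=> w _; rewrite mule_ge0// lee_fin// ltW.
- exact: emeasurable_funM.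
- by move=> w _; apply: lee_wpmul2l; rewrite ?lee_fin//; have /andP[] := Phi_bounds w.
- by move=> w _; rewrite mule_ge0// lee_fin.
- exact: emeasurable_funM.
- by move=> w _; apply: lee_wpmul2l; rewrite ?lee_fin//; have /andP[] := Phi_bounds w.
Qed.

Lemma boxerr_sum h : (N2 h < +oo)%E ->
  (\esum_(pl in @Lambda d) (@boxerr R d nu b C h pl.1)%:E <=
    (a / 2 * nu ^- d)%:E * N2 h)%E.
Proof.
move=> hoo; have nE : N2 h = (fine (N2 h))%:E.
  by rewrite fineK// ge0_fin_numE// N2_ge0.
have n0 : 0 <= fine (N2 h) by rewrite fine_ge0// N2_ge0.
have f0 : 0 <= @farK R d b C by rewrite !mulr_ge0 ?sqrtr_ge0 ?(ltW C_gt0) ?exprn_ge0.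
pose c := @farK R d b C * 30 ^+ d * nu ^+ d * fine (N2 h).
have c0 : 0 <= c.
  by apply: mulr_ge0 => //; rewrite mulr_ge0 ?exprn_ge0 ?(ltW nu_gt0)// mulr_ge0 ?exprn_ge0.
have hg p : 0 <= (((beta p)%:R : R) ^+ d)^-1 <= ((beta p)%:R : R)^-1.
  have b0 := @beta_gt0R R p.
  rewrite invr_ge0 exprn_ge0 ?(ltW b0)//= lef_pV2 ?posrE ?exprn_gt0//.
  by rewrite -[leLHS]expr1 ler_weXn2l// ler1n beta_gt0.
apply: (@le_trans _ _ (c%:E * (@LambdaC R d)%:E)%E).
  apply: le_trans (lee_wpmul2l _ (Lambda_sum_le d hg)); last by rewrite lee_fin.
  by rewrite -esumZl.
rewrite nE -!EFinM lee_fin /c.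
(* As [0 < nu <= 1] and [d >= 1], one factor [nu] is kept from [nu ^ d] to meet the smallness
   condition, and [nu ^- d >= 1] is then supplied for free. *)
have nud : nu ^+ d <= nu.
  by rewrite -[leRHS]expr1 ler_wiXn2l// ltW.
have nud0 : 0 < nu ^+ d by rewrite exprn_gt0.
have nui : 1 <= nu ^- d by rewrite invf_ge1// exprn_ile1// ltW.
have LC0 : 0 <= @LambdaC R d by rewrite mulr_ge0.
rewrite mulrAC ler_wpM2r//.
apply: (@le_trans _ _ (@farK R d b C * 30 ^+ d * @LambdaC R d * nu)).
  by rewrite mulrAC ler_wpM2l// !mulr_ge0 ?(ltW C_gt0)//.
by apply: le_trans nu_small _; rewrite ler_peMr// divr_ge0// ltW.
Qed.

(** The total error is at most [a / 2 * nu ^- d] times the squared norm, so it uses up half of the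
    lower bound on the main term. *)
Lemma frame_sum_ift M K h : bounded_in_cube M K h ->
  ((a / 2 * nu ^- d)%:E * N2 h <= energy (ift h) <=
    ((b + a / 2) * nu ^- d)%:E * N2 h)%E.
Proof.
move=> bh; have [mh _ _] := bh; have hoo := bounded_in_cube_sqr_lty bh.
have /andP[s1 s2] := boxterm_sum mh; have e1 := boxerr_sum hoo.
have nE : N2 h = (fine (N2 h))%:E.
  by rewrite fineK// ge0_fin_numE// N2_ge0.
have err0 p : 0 <= @boxerr R d nu b C h p.
  have f0 : 0 <= @farK R d b C by rewrite !mulr_ge0 ?sqrtr_ge0 ?(ltW C_gt0) ?exprn_ge0.
  rewrite /boxerr; apply: mulr_ge0; last by rewrite invr_ge0 exprn_ge0.
  apply: mulr_ge0; last by rewrite fine_ge0// N2_ge0.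
  by rewrite mulr_ge0 ?exprn_ge0 ?(ltW nu_gt0)// mulr_ge0 ?exprn_ge0.
have bt0 pl : (0 <= boxterm phi mu nu h pl.1 pl.2)%E.
  apply: integral_ge0 => w _; rewrite mule_ge0// lee_fin ?sqr_ge0//.
  by rewrite mulr_ge0 ?sqr_ge0// invr_ge0 exprn_ge0// ltW.
have en0 pl : (0 <= \esum_(k in setT)
    (normc (inner (ift h) (atom phi mu nu (pl.1, k, pl.2))) ^+ 2)%:E)%E.
  by apply: esum_ge0 => k _; rewrite lee_fin sqr_ge0.
have lo : (\esum_(pl in @Lambda d) boxterm phi mu nu h pl.1 pl.2 <=
    energy (ift h) + \esum_(pl in @Lambda d) (@boxerr R d nu b C h pl.1)%:E)%E.
  rewrite frame_sum_atomE -esumD; [|by move=> pl _; exact: en0|by move=> pl _; rewrite lee_fin; exact: err0].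
  apply: le_esum => -[p l] pl.
  exact: (box_lower d_ge1 phi_L1 mu_gt0 b_gt0 Phi_ub N_gt C_gt0 phi_decay nu_gt0 nu_le bh pl).
have up : (energy (ift h) <= \esum_(pl in @Lambda d) boxterm phi mu nu h pl.1 pl.2 +
    \esum_(pl in @Lambda d) (@boxerr R d nu b C h pl.1)%:E)%E.
  rewrite frame_sum_atomE -esumD; [|by move=> pl _; exact: bt0|by move=> pl _; rewrite lee_fin; exact: err0].
  apply: le_esum => -[p l] pl.
  exact: (box_upper d_ge1 phi_L1 mu_gt0 b_gt0 Phi_ub N_gt C_gt0 phi_decay nu_gt0 nu_le bh pl).
have {}lo := le_trans s1 (le_trans lo (leeD (lexx _) e1)).
have {}up := le_trans up (leeD s2 e1).
move: lo up; rewrite nE -!EFinM => lo up; apply/andP; split.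
  (* The error is moved across the inequality in the reals; an infinite energy has to be set aside
     for this. *)
  move: lo; have : (0 <= energy (ift h))%E by apply: esum_ge0 => g _; rewrite lee_fin sqr_ge0.
  case: (energy (ift h)) => [r _|_ _|].
  - by rewrite -EFinD !lee_fin; lra.
  - by rewrite leey.
  - by rewrite leeNy_eq.
by apply: le_trans up _; rewrite -EFinD lee_fin; lra.
Qed.

End frame_energy.

(** * Square-integrable functions: squared norm, inner product, Cauchy-Schwarz *)

Section square_integrable.
Context {R : realType} {d : nat}.
Local Notation vec := 'rV[R]_d.
Local Notation leb := (@lebesgue_measure_rV R d).
Implicit Types (f g h : vec -> R[i]).

(** Equivalent to [cLp 2%:E f] by [cLp2E], but stated with the squared norm. *)
Definition L2 f := cmeas f /\ (N2 f < +oo)%E.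

(** An infinite squared norm would be sent to 0 by [fine], so this is meaningful only together with
    [L2]. *)
Definition n2 f : R := fine (N2 f).

Lemma n2_ge0 f : 0 <= n2 f.
Proof. by rewrite fine_ge0// N2_ge0. Qed.

Lemma n2E f : L2 f -> N2 f = (n2 f)%:E.
Proof. by move=> [_ foo]; rewrite fineK// ge0_fin_numE// N2_ge0. Qed.

Lemma integral_sqr_sum f g : cmeas f -> cmeas g ->
  (\int[leb]_x (2 * normc (f x) ^+ 2 + 2 * normc (g x) ^+ 2)%:E =
   2%:E * N2 f + 2%:E * N2 g)%E.
Proof.
move=> mf mg; have mf2 := measurable_normc2 mf; have mg2 := measurable_normc2 mg.
under eq_integral do rewrite EFinD.
rewrite ge0_integralD//; last 4 first.
- by move=> x _; rewrite lee_fin mulr_ge0// sqr_ge0.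
- by apply/measurable_EFinP; exact: measurable_funM.
- by move=> x _; rewrite lee_fin mulr_ge0// sqr_ge0.
- by apply/measurable_EFinP; exact: measurable_funM.
congr (_ + _)%E; under eq_integral do rewrite EFinM.
- rewrite ge0_integralZl_EFin//; last exact: measurable_normc2E.
  by move=> x _; rewrite lee_fin sqr_ge0.
- rewrite ge0_integralZl_EFin//; last exact: measurable_normc2E.
  by move=> x _; rewrite lee_fin sqr_ge0.
Qed.

Lemma N2D f g : cmeas f -> cmeas g ->
  (N2 (fun x : vec => (f x + g x)%R) <= 2%:E * N2 f + 2%:E * N2 g)%E.
Proof.
move=> mf mg; have mf2 := measurable_normc2 mf; have mg2 := measurable_normc2 mg.
rewrite -integral_sqr_sum//; apply: ge0_le_integral => //.
- by move=> x _; rewrite lee_fin sqr_ge0.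
- by apply: measurable_normc2E; exact: cmeasD.
- by apply/measurable_EFinP; apply: measurable_funD; exact: measurable_funM.
- by move=> x _; rewrite lee_fin sqr_normcD.
Qed.

Lemma N2N f : N2 (fun x : vec => - f x) = N2 f.
Proof. by apply: eq_integral => x _; rewrite normcN. Qed.

Lemma N2_sym f g : N2 (fun x : vec => f x - g x) = N2 (fun x : vec => g x - f x).
Proof. by apply: eq_integral => x _; rewrite -normcN opprB. Qed.

Lemma N2J f : N2 (fun x : vec => ((f x)^*)%R) = N2 f.
Proof. by apply: eq_integral => x _; rewrite normcJ. Qed.

Lemma N2Z (z : R[i]) f : cmeas f ->
  N2 (fun x : vec => z * f x) = ((normc z ^+ 2)%:E * N2 f)%E.
Proof.
move=> mf; rewrite /N2 -ge0_integralZl_EFin ?sqr_ge0//; last 2 first.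
- by move=> x _; rewrite lee_fin sqr_ge0.
- exact: measurable_normc2E.
by apply: eq_integral => x _; rewrite normcM exprMn EFinM.
Qed.

Lemma N20 : N2 (fun _ : vec => 0 : R[i]) = 0%E.
Proof. by apply: integral0_eq => x _; rewrite normc0 expr0n. Qed.

Lemma L2D f g : L2 f -> L2 g -> L2 (fun x => f x + g x).
Proof.
move=> [mf foo] [mg goo]; split; first exact: cmeasD.
apply: le_lt_trans (N2D mf mg) _.
by rewrite lte_add_pinfty// lte_mul_pinfty// lee_fin.
Qed.

Lemma L2N f : L2 f -> L2 (fun x => - f x).
Proof. by move=> [mf foo]; split; [exact: cmeasN|rewrite N2N]. Qed.

Lemma L2B f g : L2 f -> L2 g -> L2 (fun x => f x - g x).
Proof. by move=> fL gL; apply: L2D => //; exact: L2N. Qed.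

Lemma L2Z (z : R[i]) f : L2 f -> L2 (fun x => z * f x).
Proof.
move=> [mf foo]; split; first by apply: cmeasM => //; exact: cmeas_cst.
by rewrite N2Z// lte_mul_pinfty// lee_fin sqr_ge0.
Qed.

Lemma n2Z (z : R[i]) f : L2 f -> n2 (fun x => z * f x) = normc z ^+ 2 * n2 f.
Proof. by move=> fL; rewrite /n2 (N2Z z fL.1) (n2E fL). Qed.

Lemma L20 : L2 (fun=> 0).
Proof. by split; [exact: cmeas_cst|rewrite N20]. Qed.

Lemma L2_sum (I : eqType) (s : seq I) (F : I -> vec -> R[i]) :
  (forall i, i \in s -> L2 (F i)) -> L2 (fun x => \sum_(i <- s) F i x).
Proof.
elim: s => [|i s IH] iF.
  by under eq_fun do rewrite big_nil; exact: L20.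
under eq_fun do rewrite big_cons; apply: L2D; first by apply: iF; rewrite mem_head.
by apply: IH => j js; apply: iF; rewrite inE js orbT.
Qed.

Lemma n2_le f g : L2 f -> L2 g -> n2 g <= 2 * n2 f + 2 * n2 (fun x => f x - g x).
Proof.
move=> fL gL; have gfL := L2B gL fL.
have -> : n2 (fun x => f x - g x) = n2 (fun x => g x - f x) by rewrite /n2 N2_sym.
rewrite -lee_fin EFinD !EFinM -(n2E gfL) -(n2E fL) -(n2E gL).
rewrite [X in (N2 X <= _)%E](_ : g = fun x : vec => f x + (g x - f x)).
  by apply: N2D; [exact: fL.1|apply: cmeasB; [exact: gL.1|exact: fL.1]].
by apply/funext => x; rewrite addrC subrK.
Qed.

Lemma n2B_le f g h : L2 f -> L2 g -> L2 h ->
  n2 (fun x => f x - h x) <= 2 * n2 (fun x => f x - g x) + 2 * n2 (fun x => g x - h x).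
Proof.
move=> fL gL hL; rewrite -lee_fin EFinD !EFinM -!n2E; [|exact: L2B..].
rewrite (_ : (fun x => f x - h x) = fun x : vec => (f x - g x) + (g x - h x)).
  by apply: N2D; apply: cmeasB; first [exact: fL.1|exact: gL.1|exact: hL.1].
by apply/funext => x; rewrite addrA subrK.
Qed.

Lemma cintble_inner f g : L2 f -> L2 g -> cintble leb (fun x => f x * ((g x)^*)%R).
Proof.
move=> [mf foo] [mg goo].
have mf2 := measurable_normc2 mf; have mg2 := measurable_normc2 mg.
apply: (@cintble_le _ _ _ _ _
  (fun x : vec => 2 * normc (f x) ^+ 2 + 2 * normc (g x) ^+ 2)).
- by apply: cmeasM => //; exact: cmeasJ.
- by apply: measurable_funD; exact: measurable_funM.
- move=> x; rewrite normcM normcJ.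
  have := normc_ge0 (f x); have := normc_ge0 (g x).
  by have := sqr_ge0 (normc (f x) - normc (g x)); nra.
- by rewrite integral_sqr_sum// lte_add_pinfty// lte_mul_pinfty// lee_fin.
Qed.

Lemma integrable_normc2 f : L2 f ->
  leb.-integrable setT (EFin \o (fun x : vec => normc (f x) ^+ 2)).
Proof.
move=> [mf foo]; apply/integrableP; split; first exact: measurable_normc2E.
apply: le_lt_trans foo; rewrite le_eqVlt; apply/orP; left; apply/eqP.
by apply: eq_integral => x _; rewrite gee0_abs// lee_fin sqr_ge0.
Qed.

Lemma n2B f g : L2 f -> L2 g ->
  n2 (fun x => f x - g x) = n2 f + n2 g - 2 * complex.Re (inner f g).
Proof.
move=> fL gL; have fi := integrable_normc2 fL; have gi := integrable_normc2 gL.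
have ri := cintble_Re (cintble_inner fL gL).
have -> : n2 (fun x => f x - g x) = \int[leb]_x ((normc (f x) ^+ 2 + normc (g x) ^+ 2) -
    2 * complex.Re (f x * ((g x)^*)%R)).
  congr fine; apply: eq_integral => x _; congr EFin.
  rewrite !sqr_normc ReM !ReD !ImD !ReN !ImN ReJ ImJ; ring.
have r2 : leb.-integrable setT
    (EFin \o (fun x : vec => 2 * complex.Re (f x * ((g x)^*)%R))).
  exact: (integrableZl _ 2 ri).
rewrite RintegralB//; last exact: (integrableD _ fi gi).
by rewrite RintegralD// RintegralZl.
Qed.

Lemma innerD f g h : L2 f -> L2 g -> L2 h ->
  inner (fun x => f x + g x) h = inner f h + inner g h.
Proof.
move=> fL gL hL; apply: etrans (cintD (cintble_inner fL hL) (cintble_inner gL hL)).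
by apply: cint_ext => x; rewrite mulrDl.
Qed.

Lemma innerB f g h : L2 f -> L2 g -> L2 h ->
  inner (fun x => f x - g x) h = inner f h - inner g h.
Proof.
move=> fL gL hL; apply: etrans (cintB (cintble_inner fL hL) (cintble_inner gL hL)).
by apply: cint_ext => x; rewrite mulrBl.
Qed.

Lemma innerZl (z : R[i]) f g : L2 f -> L2 g ->
  inner (fun x => z * f x) g = z * inner f g.
Proof.
move=> fL gL; apply: etrans (cintZ z (cintble_inner fL gL)).
by apply: cint_ext => x; rewrite mulrA.
Qed.

Lemma innerJ f g : L2 f -> L2 g -> inner g f = ((inner f g)^*)%R.
Proof.
move=> fL gL; apply: etrans (cintJ (cintble_inner fL gL)).
by apply: cint_ext => x; rewrite rmorphM /= conjCK mulrC.
Qed.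

Lemma innerff f : L2 f -> inner f f = real_complex R (n2 f).
Proof.
move=> fL; apply: complex_ext => /=.
  by congr fine; apply: eq_integral => x _; rewrite mulcJ.
rewrite /Rintegral (eq_integral (cst 0%E)); last by move=> x _; rewrite mulcJ.
by rewrite integral0.
Qed.

Lemma inner_sum (I : eqType) (s : seq I) (F : I -> vec -> R[i]) g :
  (forall i, i \in s -> L2 (F i)) -> L2 g ->
  inner (fun x => \sum_(i <- s) F i x) g = \sum_(i <- s) inner (F i) g.
Proof.
move=> + gL; elim: s => [|i s IH] iF.
  rewrite big_nil; apply: etrans (cint0 leb).
  by apply: cint_ext => x; rewrite big_nil mul0r.
have iF' j : j \in s -> L2 (F j) by move=> js; apply: iF; rewrite inE js orbT.
rewrite big_cons -IH// -innerD//; last exact: L2_sum.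
  by apply: cint_ext => x; rewrite big_cons.
by apply: iF; rewrite mem_head.
Qed.

(** Nonnegativity of the squared norm of [f - t I g], with [I] the inner product, as a quadratic
    polynomial in the real [t]. *)
Lemma cauchy_schwarz f g : L2 f -> L2 g -> normc (inner f g) ^+ 2 <= n2 f * n2 g.
Proof.
move=> fL gL; set I := inner f g; have F0 := n2_ge0 f; have G0 := n2_ge0 g.
have q (t : R) : 0 <= n2 f + t ^+ 2 * normc I ^+ 2 * n2 g - 2 * (t * normc I ^+ 2).
  have tL := L2Z (real_complex R t * I) gL.
  have := n2_ge0 (fun x : vec => f x - real_complex R t * I * g x); rewrite n2B//.
  rewrite n2Z// (innerJ tL fL) ReJ innerZl// (innerJ fL gL) -/I -mulrA mulcJ.
  by rewrite normcM normc_real exprMn real_normK ?num_real// ReM /= mul0r subr0.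
have I0 := sqr_ge0 (normc I); set I2 := normc I ^+ 2 in q I0 *.
have [G1|Gn] := eqVneq (n2 g) 0.
  have [->|In] := eqVneq I2 0; first by rewrite mulr_ge0.
  (* When [n2 g = 0] the polynomial is affine in [t]; this [t] would give it the value [-1]. *)
  have := q ((n2 f + 1) / (2 * I2)); rewrite G1 mulr0 addr0.
  by rewrite (_ : 2 * _ = n2 f + 1); [lra|field].
(* The minimizer of the quadratic polynomial. *)
have := q ((n2 g)^-1).
have -> : n2 f + (n2 g)^-1 ^+ 2 * I2 * n2 g - 2 * ((n2 g)^-1 * I2) = n2 f - I2 / n2 g.
  by field.
have Gp : 0 < n2 g by rewrite lt_neqAle eq_sym Gn.
by rewrite subr_ge0 ler_pdivrMr.
Qed.

End square_integrable.

(** * Density of the inverse transforms in [L^2] *)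

Section density.
Context {R : realType} {d : nat}.
Local Notation vec := 'rV[R]_d.
Local Notation leb := (@lebesgue_measure_rV R d).
Implicit Types (f g h : vec -> R[i]).

Definition restr (A : set vec) f (x : vec) : R[i] := real_complex R (\1_A x) * f x.

Lemma restr_in A f x : A x -> restr A f x = f x.
Proof. by move=> Ax; rewrite /restr indicE mem_set// mul1r. Qed.

Lemma restr_out A f x : ~ A x -> restr A f x = 0.
Proof. by move=> Ax; rewrite /restr indicE memNset// mul0r. Qed.

(** Cutting both the domain and the values at [n] makes the error vanish at each point from some [n]
    on, under the domination [|f|^2]. *)
Lemma truncation f (e : R) : L2 f -> 0 < e -> exists M (A : set vec),
  [/\ measurable A, bounded_in_cube M M (restr A f) &
      n2 (fun x => f x - restr A f x) <= e].
Proof.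
move=> fL e0; have [mf foo] := fL.
pose A n : set vec := cube n%:R `&` [set x | normc (f x) <= n%:R].
have mA n : measurable (A n).
  apply: measurableI; first exact: measurable_cube.
  have := measurable_normc mf measurableT (@measurable_itv R `]-oo, n%:R]).
  by rewrite setTI => h; rewrite (_ : [set x | _] =
    (fun x : vec => normc (f x)) @^-1` [set` `]-oo, n%:R]]).
have mr n : cmeas (restr (A n) f).
  by apply: cmeasM => //; apply: cmeas_real; exact: measurable_indic.
pose F n (x : vec) := (normc (f x - restr (A n) f x) ^+ 2)%:E.
have mF n : measurable_fun setT (F n) by apply: measurable_normc2E; exact: cmeasB.
have Fle n x : (`|F n x| <= (normc (f x) ^+ 2)%:E)%E.
  rewrite gee0_abs ?lee_fin ?sqr_ge0//; have [xA|xA] := pselect (A n x).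
    by rewrite restr_in// subrr normc0 expr0n /= sqr_ge0.
  by rewrite restr_out// subr0.
have F0 x : (F ^~ x) @ \oo --> (0 : \bar R)%E.
  apply: cvg_near_cst.
  pose B := normc (f x) + \sum_i `|x ord0 i|.
  have B0 : 0 <= B by rewrite addr_ge0 ?normc_ge0// sumr_ge0.
  exists (Num.bound B) => // n /= Bn.
  have hB : B <= n%:R.
    by apply: le_trans (ltW (archi_boundP B0)) _; rewrite ler_nat.
  rewrite /F restr_in ?subrr ?normc0 ?expr0n//; split.
    move=> i; apply: le_trans hB; rewrite /B (bigD1 i)//= addrCA lerDl.
    by rewrite addr_ge0 ?normc_ge0// sumr_ge0.
  by apply: le_trans hB; rewrite lerDl sumr_ge0.
have ig : leb.-integrable setT (fun x : vec => (normc (f x) ^+ 2)%:E).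
  exact: integrable_normc2.
have cvgF : (\int[leb]_x F n x @[n --> \oo] --> (0 : \bar R))%E.
  rewrite -[X in _ --> X](@integral0 _ _ R leb setT).
  exact: (dominated_cvg measurableT mF (fun x _ => F0 x) _ ig (fun n x _ => Fle n x)).
have /fine_cvgP[_ /cvgrPdist_le/(_ _ e0)[n _ /(_ n (leqnn n))]] := cvgF.
rewrite sub0r normrN => he.
exists n%:R, (A n); split => //; last exact: le_trans (ler_norm _) he.
split => // x; last by move=> xn; apply: restr_out => -[].
have [xA|xA] := pselect (A n x); last by rewrite restr_out// normc0.
by rewrite restr_in//; case: xA.
Qed.

(** Conjugation exchanges the two transforms, so that Plancherel's formula passes from [ift] to
    [fourier]. *)
Lemma fourier_ift f w : cintble leb f ->
  fourier f w = ((ift (fun x => ((f x)^*)%R) w)^*)%R.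
Proof.
move=> fi; rewrite /ift -cintJ; last by apply: cintble_cis; exact: cintbleJ.
by apply: cint_ext => x; rewrite rmorphM /= conjCK -cisN dotC.
Qed.

Lemma bounded_in_cubeJ M K f : bounded_in_cube M K f ->
  bounded_in_cube M K (fun x => ((f x)^*)%R).
Proof.
move=> [mf fK f0]; split; first exact: cmeasJ.
- by move=> x; rewrite normcJ.
- by move=> x xM; rewrite f0// rmorph0.
Qed.

Lemma bounded_in_cube_L2 M K f : bounded_in_cube M K f -> L2 f.
Proof. by move=> fb; have [mf _ _] := fb; split => //; exact: bounded_in_cube_sqr_lty fb. Qed.

Lemma L2_ift M K h : bounded_in_cube M K h -> L2 (ift h).
Proof.
move=> hb; have [mh _ _] := hb; split; first exact: cmeas_ift.
by rewrite (plancherel_ift hb); exact: bounded_in_cube_sqr_lty hb.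
Qed.

Lemma L2_fourier M K f : bounded_in_cube M K f -> L2 (fourier f) /\ n2 (fourier f) = n2 f.
Proof.
move=> fb; have fi := bounded_in_cube_cintble fb; have fJ := bounded_in_cubeJ fb.
have [mJ Joo] := L2_ift fJ.
have -> : fourier f = fun w => ((ift (fun x => ((f x)^*)%R) w)^*)%R.
  by apply/funext => w; exact: fourier_ift.
split; first by split; [exact: cmeasJ|rewrite N2J].
by rewrite /n2 N2J (plancherel_ift fJ) N2J.
Qed.

(* Both distances expand to [n2 h + n2 f] minus twice the real part of the
   integral of [h * (fourier f)^*]. *)
Lemma n2_ift_sub M K f M' K' h : bounded_in_cube M K f -> bounded_in_cube M' K' h ->
  n2 (fun x => ift h x - f x) = n2 (fun w => h w - fourier f w).
Proof.
move=> fb hb; have [FL Fn] := L2_fourier fb.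
have fL := bounded_in_cube_L2 fb; have hL := bounded_in_cube_L2 hb.
rewrite (n2B (L2_ift hb) fL) (n2B hL FL) Fn (inner_ift hb (bounded_in_cube_cintble fb)).
by rewrite /n2 (plancherel_ift hb).
Qed.

(** Truncate [f] to [g], then the transform of [g] to [h]. By [n2_ift_sub], [ift h] is as close to
    [g] as [h] is to [fourier g], which stands in for an inversion theorem. Each error [e / 4] is
    doubled by [n2B_le]. *)
Lemma ift_dense f (e : R) : L2 f -> 0 < e -> exists M K h,
  bounded_in_cube M K h /\ n2 (fun x => f x - ift h x) <= e.
Proof.
move=> fL e0; have e40 : 0 < e / 4 by rewrite divr_gt0.
have [M [A [mA fb fe]]] := truncation fL e40; set g := restr A f in fb fe.
have [FL Fn] := L2_fourier fb.
have [M' [A' [mA' hb he]]] := truncation FL e40; set h := restr A' _ in hb he.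
exists M', M', h; split => //.
have := n2B_le fL (bounded_in_cube_L2 fb) (L2_ift hb).
have -> : n2 (fun x => g x - ift h x) = n2 (fun x => ift h x - g x).
  by rewrite /n2 N2_sym.
rewrite (n2_ift_sub fb hb).
have -> : n2 (fun w => h w - fourier g w) = n2 (fun w => fourier g w - h w).
  by rewrite /n2 N2_sym.
lra.
Qed.

End density.

(** * Extension of frame bounds from a dense class, for any family in [L^2] *)

Section frame_bounds.
Context {R : realType} {d : nat}.
Local Notation vec := 'rV[R]_d.
Local Notation leb := (@lebesgue_measure_rV R d).
Variables (I : choiceType) (S : set I) (psi : I -> vec -> R[i]).
Hypothesis psiL : forall i, S i -> L2 (psi i).
Implicit Types (f g h : vec -> R[i]).

Local Notation frame_sum := (frame_sum S psi).

Lemma frame_sum_ge0 f : (0 <= frame_sum f)%E.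
Proof. by apply: esum_ge0 => i _; rewrite lee_fin sqr_ge0. Qed.

Lemma sum_frame_sum f (r : seq I) : uniq r -> (forall i, i \in r -> S i) ->
  ((\sum_(i <- r) normc (inner f (psi i)) ^+ 2)%:E <= frame_sum f)%E.
Proof.
move=> ur rS; by rewrite -sumEFin; exact: sum_le_esum.
Qed.

Lemma inner_split f g i : L2 f -> L2 g -> S i -> normc (inner f (psi i)) ^+ 2 <=
  2 * normc (inner g (psi i)) ^+ 2 + 2 * normc (inner (fun x => f x - g x) (psi i)) ^+ 2.
Proof.
move=> fL gL Si; rewrite (innerB fL gL (psiL Si)).
have := sqr_normcD (inner g (psi i)) (inner f (psi i) - inner g (psi i)).
by rewrite addrC subrK.
Qed.

Lemma frame_sum_split f g : L2 f -> L2 g ->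
  (frame_sum f <= 2%:E * frame_sum g + 2%:E * frame_sum (fun x => (f x - g x)%R))%E.
Proof.
move=> fL gL.
rewrite /frame_sum -!esumZl//; last 2 first.
- by move=> i _; rewrite lee_fin sqr_ge0.
- by move=> i _; rewrite lee_fin sqr_ge0.
rewrite -esumD; last 2 first.
- by move=> i _; rewrite lee_fin mulr_ge0// sqr_ge0.
- by move=> i _; rewrite lee_fin mulr_ge0// sqr_ge0.
by apply: le_esum => i Si; rewrite -!EFinM -EFinD lee_fin inner_split.
Qed.

Variables (D : set (vec -> R[i])) (A B : R).
Hypotheses (DL : forall g, D g -> L2 g) (A0 : 0 <= A) (B0 : 0 <= B)
  (D_bounds : forall g, D g -> (A%:E * N2 g <= frame_sum g <= B%:E * N2 g)%E)
  (D_dense : forall f (e : R), L2 f -> 0 < e -> exists2 g, D g & n2 (fun x => f x - g x) <= e).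

(** A finite part of the frame sum is continuous by Cauchy-Schwarz, with a constant [P] depending on
    that part. The approximant is chosen after the part, so [P] disappears from the result. The 4
    combines a 2 from splitting the inner products with a 2 from [n2_le]. *)
Lemma bessel_dense f : L2 f -> (frame_sum f <= (4 * B)%:E * N2 f)%E.
Proof.
move=> fL; rewrite n2E// -EFinM; apply: esum_le_bound => r ur rS.
rewrite sumEFin lee_fin; apply/ler_addgt0Pr => e e0.
pose P := \sum_(i <- r) n2 (psi i).
have P0 : 0 <= P by apply: sumr_ge0 => i _; exact: n2_ge0.
(* [4 * B + 2 * P] is the total coefficient of the approximation error [q]; the 1 makes the divisor
   positive. *)
have k0 : 0 < 4 * B + 2 * P + 1 by rewrite ltr_wpDl// addr_ge0// mulr_ge0.
have [g Dg fg] := D_dense fL (divr_gt0 e0 k0); have gL := DL Dg.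
have /andP[_] := D_bounds Dg; rewrite (n2E gL) -EFinM => Bg.
have := le_trans (sum_frame_sum g ur rS) Bg; rewrite lee_fin => {}Bg.
set q := n2 _ in fg.
apply: (@le_trans _ _ (2 * (B * n2 g) + 2 * (q * P))).
  apply: (@le_trans _ _ (\sum_(i <- r) (2 * normc (inner g (psi i)) ^+ 2 +
      2 * normc (inner (fun x => f x - g x) (psi i)) ^+ 2))).
    rewrite big_seq [leRHS]big_seq; apply: ler_sum => i ir.
    by apply: inner_split => //; exact: rS.
  rewrite big_split /= -!mulr_sumr lerD// ler_wpM2l//.
  rewrite /P mulr_sumr big_seq [leRHS]big_seq; apply: ler_sum => i ir.
  by apply: cauchy_schwarz; [exact: L2B|apply: psiL; exact: rS].
have gf := n2_le fL gL; rewrite -/q in gf.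
have q0 : 0 <= q by exact: n2_ge0.
have {}fg : q * (4 * B + 2 * P + 1) <= e by rewrite -ler_pdivlMr.
have : 2 * (B * n2 g) <= 2 * (B * (2 * n2 f + 2 * q)).
  by rewrite ler_wpM2l// ler_wpM2l.
nra.
Qed.

Lemma frame_lower_dense f : L2 f -> ((A / 4)%:E * N2 f <= frame_sum f)%E.
Proof.
move=> fL; have Bf := bessel_dense fL; have f0 := frame_sum_ge0 f.
have foo : (frame_sum f < +oo)%E.
  by apply: le_lt_trans Bf _; rewrite n2E// -EFinM ltry.
rewrite (n2E fL) -EFinM -[leRHS]fineK ?ge0_fin_numE// lee_fin.
apply/ler_addgt0Pr => e e0; set E := fine _.
have E0 : 0 <= E by rewrite fine_ge0.
(* With [q] the approximation error, the estimates combine to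
   [A * n2 f <= 4 * E + (2 * A + 16 * B) * q], where 16 contains the 4 of [bessel_dense]. *)
have k0 : 0 < 2 * A + 16 * B + 1 by rewrite ltr_wpDl// addr_ge0// mulr_ge0.
have [g Dg fg] := D_dense fL (divr_gt0 e0 k0); have gL := DL Dg.
have /andP[Ag _] := D_bounds Dg.
have gfL := L2B gL fL.
have := le_trans Ag (le_trans (frame_sum_split gL fL)
  (leeD2l _ (lee_wpmul2l _ (bessel_dense gfL)))).
have h20 : (0 <= 2%:E :> \bar R)%E by rewrite lee_fin.
move=> /(_ h20).
have -> : frame_sum f = E%:E by rewrite fineK// ge0_fin_numE.
rewrite N2_sym (n2E gL) (n2E (L2B fL gL)); set q := n2 (fun x => f x - g x) in fg *.
rewrite -!EFinM -EFinD lee_fin => h.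
have gf := n2_le gL fL.
have qE : n2 (fun x => g x - f x) = q by rewrite /q /n2 N2_sym.
rewrite qE in gf.
have q0 : 0 <= q by exact: n2_ge0.
have {}fg : q * (2 * A + 16 * B + 1) <= e by rewrite -ler_pdivlMr.
have : A * n2 f <= A * (2 * n2 g + 2 * q) by rewrite ler_wpM2l.
nra.
Qed.

End frame_bounds.

(** * Completeness of [L^2] along rapidly converging sequences *)

Section completeness.
Context {R : realType} {d : nat}.
Local Notation vec := 'rV[R]_d.
Local Notation leb := (@lebesgue_measure_rV R d).

Lemma small_pow4 (c e : R) : 0 < e -> exists n, c / 4 ^+ n <= e.
Proof.
move=> e0; exists (Num.bound (`|c| / e)).
have h : `|c| / e < (Num.bound (`|c| / e))%:R by apply: archi_boundP; rewrite divr_ge0// ltW.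
rewrite ler_pdivrMr ?exprn_gt0//; apply: le_trans (ler_norm _) _.
rewrite mulrC -ler_pdivrMr//; apply: le_trans (ltW h) _.
by rewrite -natrX ler_nat ltnW// ltn_expl.
Qed.

Lemma sum_half_le (r : seq nat) : uniq r -> \sum_(k <- r) 2 ^- k <= 2 :> R.
Proof.
move=> ur; pose N := (\max_(k <- r) k).+1.
apply: (@le_trans _ _ (\sum_(k <- iota 0 N) 2 ^- k)).
  apply: ler_sum_subset => // k kr.
  by rewrite mem_iota add0n /N ltnS; exact: (@leq_bigmax_seq _ r (fun=> true) id k).
suff -> : \sum_(k <- iota 0 N) 2 ^- k = 2 - 2 * 2 ^- N :> R.
  by rewrite lerBlDr lerDl mulr_ge0// invr_ge0 exprn_ge0.
elim: N => [|n IH]; first by rewrite big_nil expr0 invr1 mulr1 subrr.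
rewrite -addn1 iotaD big_cat /= big_seq1 add0n IH addn1 exprS invfM.
by field; rewrite expf_neq0.
Qed.

Lemma geometric_cvg (u : nat -> R) (c : R) :
  (forall n m, (n <= m)%N -> `|u m - u n| <= c / 2 ^+ n) -> cvgn u.
Proof.
move=> h; apply/cauchy_cvgP/cauchy_exP => e e0.
have [n hn] := small_pow4 c (divr_gt0 e0 (ltr0n R 2)).
exists (u (2 * n)%N); exists (2 * n)%N => // m /= nm.
rewrite /ball /= distrC; apply: le_lt_trans (h _ _ nm) _.
rewrite exprM (_ : 2 ^+ 2 = 4 :> R); last by ring.
by apply: le_lt_trans hn _; rewrite gtr_pMr// invf_lt1// ltr1n.
Qed.

Lemma sqr_dist_lim_le (u v : nat -> R) (a b c : R) n : cvgn u -> cvgn v ->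
  (forall m, (n <= m)%N -> (u m - a) ^+ 2 + (v m - b) ^+ 2 <= c) ->
  (limn u - a) ^+ 2 + (limn v - b) ^+ 2 <= c.
Proof.
move=> cu cv h.
have sq (w : nat -> R) (l : R) : cvgn w ->
    ((w m - l) ^+ 2 @[m --> \oo] --> (limn w - l) ^+ 2).
  move=> cw; have cwl : w m - l @[m --> \oo] --> limn w - l.
    by apply: cvgB => //; exact: cvg_cst.
  exact: (cvgM cwl cwl).
have cc : (u m - a) ^+ 2 + (v m - b) ^+ 2 @[m --> \oo] -->
    (limn u - a) ^+ 2 + (limn v - b) ^+ 2 by apply: cvgD; exact: sq.
rewrite -(cvg_lim (@Rhausdorff R) cc); apply: limr_le.
  by apply/cvg_ex; eexists; exact: cc.
by exists n => // m /= nm; exact: h.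
Qed.

(** Each use of [sqr_normcD] doubles the remaining terms; the weights [4 ^ k] grow faster than these
    powers of 2. *)
Lemma telescope_sqr (z : nat -> R[i]) j n : normc (z (n + j)%N - z n) ^+ 2 <=
  2 / 4 ^+ n * \sum_(k <- iota n j) 4 ^+ k * normc (z k.+1 - z k) ^+ 2.
Proof.
elim: j n => [|j IH] n; first by rewrite addn0 subrr normc0 expr0n big_nil mulr0.
rewrite /= big_cons.
have -> : z (n + j.+1)%N - z n = (z (n.+1 + j)%N - z n.+1) + (z n.+1 - z n).
  by rewrite addnS -addSn addrA subrK.
apply: le_trans (sqr_normcD _ _) _.
have := IH n.+1; set s := \sum_(k <- iota n.+1 j) _; set D := normc (z n.+1 - z n) ^+ 2.
have s0 : 0 <= s.
  by apply: sumr_ge0 => k _; rewrite mulr_ge0 ?exprn_ge0 ?normc_ge0.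
have q0 : 0 < 4 ^- n :> R by rewrite invr_gt0 exprn_gt0.
have -> : 2 / 4 ^+ n * (4 ^+ n * D + s) = 2 * D + 2 * (4 ^- n * s).
  by field; rewrite expf_neq0.
have -> : 2 / 4 ^+ n.+1 * s = (4 ^- n * s) / 2.
  by rewrite exprS; field; rewrite expf_neq0.
have : 0 <= 4 ^- n * s by rewrite mulr_ge0// ltW.
move: (4 ^- n * s) => y; lra.
Qed.

(** The weighted sum [W] of squared increments has finite integral: against the weights [4 ^ k] the
    rate [8 ^- k] leaves [2 ^- k]. By [telescope_sqr], [W] controls all differences pointwise, so
    the sequence converges where [W] is finite, and integrating the same bound gives the rate in
    norm. *)
Lemma L2_complete (G : nat -> vec -> R[i]) (K : R) : (forall n, L2 (G n)) ->
  (forall n, n2 (fun x => G n.+1 x - G n x) <= K / 8 ^+ n) ->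
  exists2 F, L2 F & forall n, n2 (fun x => F x - G n x) <= 4 * K / 4 ^+ n.
Proof.
move=> GL GK.
have K0 : 0 <= K by have := le_trans (n2_ge0 _) (GK 0%N); rewrite expr0 divr1.
have mG n : cmeas (G n) by have [] := GL n.
pose W (x : vec) : \bar R :=
  (\esum_(k in setT) (4 ^+ k * normc (G k.+1 x - G k x) ^+ 2)%:E)%E.
have t0 k x : 0 <= 4 ^+ k * normc (G k.+1 x - G k x) ^+ 2.
  by rewrite mulr_ge0 ?exprn_ge0 ?normc_ge0.
have mt k : measurable_fun setT
    (fun x : vec => (4 ^+ k * normc (G k.+1 x - G k x) ^+ 2)%:E).
  apply/measurable_EFinP; apply: measurable_funM => //.
  by apply: measurable_normc2; exact: cmeasB.
have mW : measurable_fun setT W.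
  by apply: measurable_esum => // k x _; rewrite lee_fin.
have W0 x : (0 <= W x)%E by apply: esum_ge0 => k _; rewrite lee_fin.
have IW : (\int[leb]_x W x <= (2 * K)%:E)%E.
  rewrite /W integral_esum//; last by move=> k x _; rewrite lee_fin.
  apply: esum_le_bound => r ur _.
  apply: (@le_trans _ _ (\sum_(k <- r) (K * 2 ^- k)%:E)%E).
    apply: lee_sum => k _; have DL := L2B (GL k.+1) (GL k).
    under eq_integral do rewrite EFinM.
    rewrite ge0_integralZl_EFin ?exprn_ge0//; last 2 first.
    - by move=> x _; rewrite lee_fin sqr_ge0.
    - by apply: measurable_normc2E; exact: DL.1.
    rewrite -[X in (_ * X)%E]/(N2 (fun x => G k.+1 x - G k x)) n2E// -EFinM lee_fin.
    apply: le_trans (ler_wpM2l _ (GK k)) _; first by rewrite exprn_ge0.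
    rewrite (_ : 8 = 4 * 2 :> R); last by ring.
    rewrite exprMn le_eqVlt; apply/orP; left; apply/eqP; field.
    by rewrite !expf_neq0.
  by rewrite sumEFin lee_fin -mulr_sumr mulrC ler_wpM2r// sum_half_le.
have tel n j x : ((normc (G (n + j)%N x - G n x) ^+ 2)%:E <= (2 / 4 ^+ n)%:E * W x)%E.
  apply: (@le_trans _ _ ((2 / 4 ^+ n)%:E *
      (\sum_(k <- iota n j) 4 ^+ k * normc (G k.+1 x - G k x) ^+ 2)%:E)%E).
    by rewrite -EFinM lee_fin; exact: (telescope_sqr (G ^~ x)).
  apply: lee_wpmul2l; first by rewrite lee_fin divr_ge0// exprn_ge0.
  by rewrite -sumEFin; apply: sum_le_esum => //; exact: iota_uniq.
pose A : set vec := [set x | (W x < +oo)%E].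
have mA : measurable A.
  by have := emeasurable_fun_infty_o measurableT mW +oo%E; rewrite setTI.
have dist n m x : A x -> (n <= m)%N ->
    normc (G m x - G n x) <= 2 * (1 + fine (W x)) / 2 ^+ n.
  move=> Ax nm; have w0 : 0 <= fine (W x) by rewrite fine_ge0.
  have c0 : 0 <= 2 * (1 + fine (W x)) / 2 ^+ n.
    by rewrite divr_ge0 ?exprn_ge0// mulr_ge0// addr_ge0.
  rewrite -(@ler_pXn2r _ 2%N)// ?nnegrE ?normc_ge0//.
  have := tel n (m - n)%N x; rewrite subnKC// -[W x]fineK; last by rewrite ge0_fin_numE.
  rewrite -EFinM lee_fin => /le_trans; apply.
  rewrite expr_div_n -exprM mulnC exprM (_ : 2 ^+ 2 = 4 :> R); last by ring.
  rewrite mulrAC ler_wpM2r ?invr_ge0 ?exprn_ge0//.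
  by nra.
(* The indicator of the set where [W] is finite makes the sequences converge at every point, hence
   the limit is measurable. *)
pose u (P : R[i] -> R) n (x : vec) := \1_A x * P (G n x).
have ucvg P x : {morph P : y z / y - z} -> (forall z, `|P z| <= normc z) ->
    cvgn (fun n => u P n x).
  move=> PB Pn; apply: (@geometric_cvg _ (2 * (1 + fine (W x)))) => n m nm.
  rewrite /u -mulrBr normrM indicE; have [xA|xA] := boolP (x \in A).
    by rewrite normr1 mul1r -PB; apply: le_trans (Pn _) _; apply: dist => //; exact: set_mem.
  by rewrite normr0 mul0r divr_ge0 ?exprn_ge0// mulr_ge0// addr_ge0// fine_ge0.
have Reu x : cvgn (fun n => u (@complex.Re R) n x).
  by apply: ucvg => [y z|z]; [rewrite ReD ReN|exact: normr_Re_le].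
have Imu x : cvgn (fun n => u (@complex.Im R) n x).
  by apply: ucvg => [y z|z]; [rewrite ImD ImN|exact: normr_Im_le].
pose F (x : vec) : R[i] := Complex (limn (fun n => u (@complex.Re R) n x))
  (limn (fun n => u (@complex.Im R) n x)).
have mF : cmeas F.
  have mi : measurable_fun setT (\1_A : vec -> R) by exact: measurable_indic.
  split => /=.
    apply: (measurable_fun_cvg (h := u (@complex.Re R))) => // n.
    by apply: measurable_funM => //; exact: (mG n).1.
  apply: (measurable_fun_cvg (h := u (@complex.Im R))) => // n.
  by apply: measurable_funM => //; exact: (mG n).2.
have FG n x : ((normc (F x - G n x) ^+ 2)%:E <= (2 / 4 ^+ n)%:E * W x)%E.
  have [xA|xA] := pselect (A x); last first.
    (* Off [A] the right-hand side is infinite, so the bound holds at every point and no exceptional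
       null set has to be carried along. *)
    have -> : W x = +oo%E.
      by apply/eqP; rewrite -leye_eq leNgt; apply/negP => /xA.
    by rewrite gt0_muley ?leey// lte_fin divr_gt0// exprn_gt0.
  rewrite -[W x]fineK; last by rewrite ge0_fin_numE.
  rewrite -EFinM lee_fin sqr_normc !ReD !ImD !ReN !ImN /=.
  apply: (sqr_dist_lim_le (n := n)) => // m nm.
  have := tel n (m - n)%N x; rewrite subnKC// -[W x]fineK; last by rewrite ge0_fin_numE.
  rewrite -EFinM lee_fin; apply: le_trans.
  by rewrite /u indicE mem_set// !mul1r sqr_normc !ReD !ImD !ReN !ImN.
have FGN n : (N2 (fun x => (F x - G n x)%R) <= (4 * K / 4 ^+ n)%:E)%E.
  apply: (@le_trans _ _ (\int[leb]_x ((2 / 4 ^+ n)%:E * W x))%E).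
    apply: ge0_le_integral => //.
    - by move=> x _; rewrite lee_fin sqr_ge0.
    - by apply: measurable_normc2E; exact: cmeasB.
    - exact: emeasurable_funM.
  rewrite ge0_integralZl_EFin ?divr_ge0 ?exprn_ge0//.
  apply: le_trans (lee_wpmul2l _ IW) _; first by rewrite lee_fin divr_ge0// exprn_ge0.
  by rewrite -EFinM lee_fin le_eqVlt; apply/orP; left; apply/eqP; ring.
have FL : L2 F.
  have -> : F = fun x => (F x - G 0%N x) + G 0%N x by apply/funext => x; rewrite subrK.
  apply: L2D => //; split; first exact: cmeasB.
  by apply: le_lt_trans (FGN 0%N) _; rewrite ltry.
exists F => // n; rewrite -lee_fin -n2E//; exact: L2B.
Qed.

End completeness.

(** * The frame operator of a family satisfying a Bessel bound *)

Section frame_operator.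
Context {R : realType} {d : nat}.
Local Notation vec := 'rV[R]_d.
Local Notation leb := (@lebesgue_measure_rV R d).
Variables (I : choiceType) (S : set I) (psi : I -> vec -> R[i]) (B : R).
Hypotheses (psiL : forall i, S i -> L2 (psi i)) (B_gt0 : 0 < B)
  (bessel : forall f, L2 f -> (frame_sum S psi f <= B%:E * N2 f)%E).

Definition synth (c : I -> R[i]) (r : seq I) (x : vec) : R[i] :=
  \sum_(i <- r) c i * psi i x.

Definition sub_index (r : seq I) := uniq r /\ forall i, i \in r -> S i.

Lemma sub_index_undup r s : sub_index r -> sub_index s -> sub_index (undup (r ++ s)).
Proof.
move=> [_ rS] [_ sS]; split; first exact: undup_uniq.
by move=> i; rewrite mem_undup mem_cat => /orP[/rS|/sS].
Qed.

Lemma L2_synth c r : sub_index r -> L2 (synth c r).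
Proof. by move=> [_ rS]; apply: L2_sum => i ir; apply: L2Z; apply: psiL; exact: rS. Qed.

(** Duality: the squared norm of [g = synth c r] is a sum of [c i] times inner products of [psi i]
    with [g]. Weighting the two factors by [B] and [B^-1] before [2xy <= x^2 + y^2], Bessel's
    inequality returns half of [n2 g], which is absorbed on the left. *)
Lemma n2_synth c r : sub_index r ->
  n2 (synth c r) <= B * \sum_(i <- r) normc (c i) ^+ 2.
Proof.
move=> rS; have gL := L2_synth c rS; set g := synth c r in gL *.
have [ur rSi] := rS.
have h1 : n2 g <= \sum_(i <- r) normc (c i) * normc (inner g (psi i)).
  have -> : n2 g = normc (inner g g) by rewrite innerff// normc_real ger0_norm// n2_ge0.
  rewrite {1}/g inner_sum//; last by move=> i ir; apply: L2Z; apply: psiL; exact: rSi.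
  apply: le_trans (normc_sum_le _ _ _) _; rewrite big_seq [leRHS]big_seq.
  apply: ler_sum => i ir; have pL := psiL (rSi i ir).
  by rewrite innerZl// normcM (innerJ gL pL) normcJ.
have h2 : \sum_(i <- r) normc (c i) * normc (inner g (psi i)) <=
    (B * \sum_(i <- r) normc (c i) ^+ 2 +
     B^-1 * \sum_(i <- r) normc (inner g (psi i)) ^+ 2) / 2.
  rewrite !mulr_sumr -big_split /= mulr_suml; apply: ler_sum => i _.
  set y := normc (c i); set z := normc (inner g (psi i)).
  have -> : (B * y ^+ 2 + B^-1 * z ^+ 2) / 2 = y * z + B^-1 * (B * y - z) ^+ 2 / 2.
    by field; rewrite gt_eqF.
  by rewrite lerDl divr_ge0// mulr_ge0 ?sqr_ge0// invr_ge0 ltW.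
have := le_trans (sum_frame_sum psi g ur rSi) (bessel gL).
rewrite n2E// -EFinM lee_fin => h3.
have : B^-1 * \sum_(i <- r) normc (inner g (psi i)) ^+ 2 <= n2 g.
  by rewrite mulrC ler_pdivrMr// mulrC.
lra.
Qed.

Lemma n2_synthB c r s : sub_index r -> sub_index s -> {subset r <= s} ->
  n2 (fun x => synth c s x - synth c r x) <=
  B * (\sum_(i <- s) normc (c i) ^+ 2 - \sum_(i <- r) normc (c i) ^+ 2).
Proof.
move=> rS sS rs; have [ur rSi] := rS; have [us sSi] := sS.
pose t := [seq i <- s | i \notin r].
have split (V : zmodType) (F : I -> V) :
    \sum_(i <- s) F i = \sum_(i <- r) F i + \sum_(i <- t) F i.
  rewrite (bigID (mem r)) /= -[X in X + _]big_filter -[X in _ + X]big_filter; congr (_ + _).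
  apply: perm_big; apply: uniq_perm => //; first exact: filter_uniq.
  by move=> i; rewrite mem_filter /=; case ir : (i \in r) => //=; exact: rs.
have tS : sub_index t.
  split; first exact: filter_uniq.
  by move=> i; rewrite mem_filter => /andP[_ /sSi].
have -> : (fun x => synth c s x - synth c r x) = synth c t.
  by apply/funext => x; rewrite /synth split addrC addKr.
by rewrite split addrC addKr; exact: n2_synth.
Qed.

Variable f : vec -> R[i].
Hypothesis fL : L2 f.
Local Notation coef := (fun i => inner f (psi i)).
Local Notation E := (frame_sum S psi f).
Local Notation csum r := (\sum_(i <- r) normc (inner f (psi i)) ^+ 2).

Lemma frame_sumE : E = (fine E)%:E.
Proof.
rewrite fineK// ge0_fin_numE ?frame_sum_ge0//.
by apply: le_lt_trans (bessel fL) _; rewrite n2E// -EFinM ltry.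
Qed.

Lemma csum_le r : sub_index r -> csum r <= fine E.
Proof. by move=> [ur rS]; rewrite -lee_fin -frame_sumE sum_frame_sum. Qed.

Lemma csum_approx (e : R) : 0 < e -> exists2 r, sub_index r & fine E - e <= csum r.
Proof.
move=> e0; have Efin : E \is a fin_num by rewrite frame_sumE.
have [_ [A AS <-] hA] := ub_ereal_sup_adherent e0 Efin.
have [finA subA] := AS.
exists (fset_set A).
  by split; [exact: fset_uniq|move=> i; rewrite in_fset_set// => /set_mem; exact: subA].
have {hA} : (E - e%:E < \sum_(i \in A) (normc (inner f (psi i)) ^+ 2)%:E)%E := hA.
by rewrite fsbig_finite//= sumEFin frame_sumE -EFinB lte_fin => /ltW.
Qed.

(** Finite sets [X n] that exhaust the frame sum up to [8 ^- n] leave, by [n2_synthB], at most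
    [B / 8 ^ n] for any larger set. So the partial sums along [X n] meet the rate of [L2_complete],
    and the limit is unconditional. *)
Lemma frame_operator_L2 : exists2 Sf, L2 Sf & forall e : R, 0 < e ->
  exists2 r, sub_index r & forall s, sub_index s -> {subset r <= s} ->
  n2 (fun x => Sf x - synth coef s x) <= e.
Proof.
have e8 n : 0 < (8 ^+ n)^-1 :> R by rewrite invr_gt0 exprn_gt0.
have /choice[X hX] n : exists r, sub_index r /\ fine E - (8 ^+ n)^-1 <= csum r.
  by have [r] := csum_approx (e8 n); exists r.
have XS n : sub_index (X n) by have [] := hX n.
have tail n s : sub_index s -> {subset X n <= s} ->
    n2 (fun x => synth coef s x - synth coef (X n) x) <= B / 8 ^+ n.
  move=> sS Xs; apply: le_trans (n2_synthB _ (XS n) sS Xs) _.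
  rewrite ler_wpM2l ?(ltW B_gt0)//; have := csum_le sS; have [_] := hX n; lra.
have XL n := L2_synth coef (XS n).
have step n : n2 (fun x => synth coef (X n.+1) x - synth coef (X n) x) <= 4 * B / 8 ^+ n.
  (* [X n] need not be contained in [X n.+1], so the two are compared through their union. *)
  pose U := undup (X n.+1 ++ X n); have US : sub_index U by exact: sub_index_undup.
  have h1 : n2 (fun x => synth coef U x - synth coef (X n) x) <= B / 8 ^+ n.
    by apply: tail => // i iX; rewrite mem_undup mem_cat iX orbT.
  have h2 : n2 (fun x => synth coef U x - synth coef (X n.+1) x) <= B / 8 ^+ n.+1.
    by apply: tail => // i iX; rewrite mem_undup mem_cat iX.
  have := n2B_le (XL n.+1) (L2_synth coef US) (XL n).
  have -> : n2 (fun x => synth coef (X n.+1) x - synth coef U x) =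
    n2 (fun x => synth coef U x - synth coef (X n.+1) x) by rewrite /n2 N2_sym.
  move: h2; rewrite exprS invfM.
  have : 0 <= B / 8 ^+ n by rewrite divr_ge0 ?exprn_ge0// ltW.
  rewrite -!mulrA; move: (8 ^+ n)^-1 h1 => y h1 h0 h2; lra.
have [Sf SfL SfX] := L2_complete XL step.
exists Sf => // e e0.
(* [L2_complete] with [K = 4 * B] gives 16 and the tail gives 1; [n2B_le] doubles both, whence
   34. *)
have [n hn] := small_pow4 (34 * B) e0.
exists (X n) => // s sS Xs.
apply: le_trans (n2B_le SfL (XL n) (L2_synth coef sS)) _.
have -> : n2 (fun x => synth coef (X n) x - synth coef s x) =
    n2 (fun x => synth coef s x - synth coef (X n) x) by rewrite /n2 N2_sym.
have h1 := SfX n; have h2 := tail n s sS Xs.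
have h3 : B / 8 ^+ n <= B / 4 ^+ n.
  rewrite ler_wpM2l ?(ltW B_gt0)// lef_pV2 ?posrE ?exprn_gt0//.
  by rewrite lerXn2r ?nnegrE// ler_nat.
move: hn h1; rewrite -!mulrA; move: (B / 4 ^+ n) h3 => y; lra.
Qed.

(** Pairing a partial sum of the series with [f] gives the corresponding partial sum of the frame
    sum, which is real and nonnegative; the modulus then passes to the limit. *)
Lemma inner_frame_operator Sf : L2 Sf ->
  (forall e : R, 0 < e -> exists2 r, sub_index r & forall s, sub_index s ->
    {subset r <= s} -> n2 (fun x => Sf x - synth coef s x) <= e) ->
  (normc (inner Sf f))%:E = E.
Proof.
move=> SfL Sf_lim; rewrite frame_sumE; congr EFin; apply/eqP.
rewrite -subr_eq0 -normr_eq0 eq_le normr_ge0 andbT; apply/ler_addgt0Pr => e e0.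
have f0 : 0 < n2 f + 1 by rewrite ltr_wpDl// n2_ge0.
have e20 : 0 < e / 2 by rewrite divr_gt0.
(* This tolerance makes the Cauchy-Schwarz bound at most [(e / 2) ^ 2]; the 1 guards against
   [n2 f = 0]. *)
have [r rS hr] := Sf_lim ((e / 2) ^+ 2 / (n2 f + 1)) (divr_gt0 (exprn_gt0 _ e20) f0).
have [t tS ht] := csum_approx e20.
pose s := undup (r ++ t); have sS : sub_index s by exact: sub_index_undup.
have sL := L2_synth coef sS; have [us sSi] := sS.
have {}hr : n2 (fun x => Sf x - synth coef s x) <= (e / 2) ^+ 2 / (n2 f + 1).
  by apply: hr => // i ir; rewrite mem_undup mem_cat ir.
have iE : inner (synth coef s) f = real_complex R (csum s).
  rewrite inner_sum//; last by move=> i si; apply: L2Z; apply: psiL; exact: sSi.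
  rewrite rmorph_sum /= big_seq [RHS]big_seq; apply: eq_bigr => i si.
  have pL := psiL (sSi i si).
  by rewrite innerZl// (innerJ fL pL) mulcJ.
have h1 : normc (inner Sf f - real_complex R (csum s)) <= e / 2.
  rewrite -iE -innerB// -(@ler_pXn2r _ 2%N)// ?nnegrE ?normc_ge0 ?(ltW e20)//.
  apply: le_trans (cauchy_schwarz (L2B SfL sL) fL) _.
  apply: le_trans (ler_wpM2r (n2_ge0 f) hr) _.
  rewrite -mulrA ler_piMr ?sqr_ge0// mulrC ler_pdivrMr//; lra.
have h2 : csum t <= csum s.
  apply: ler_sum_subset; [by move=> i; exact: sqr_ge0|by case: tS|].
  by move=> i it; rewrite mem_undup mem_cat it orbT.
have h3 := csum_le sS.
have c0 : 0 <= csum s by apply: sumr_ge0 => i _; exact: sqr_ge0.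
have h4 : `|normc (inner Sf f) - csum s| <= e / 2.
  have cs : normc (real_complex R (csum s)) = csum s by rewrite normc_real ger0_norm.
  have := le_normcD (real_complex R (csum s) - inner Sf f) (inner Sf f).
  have := le_normcD (inner Sf f - real_complex R (csum s)) (real_complex R (csum s)).
  rewrite !subrK cs -[X in _ -> _ <= X + _ -> _]normcN opprB ler_norml.
  by move=> h5 h6; apply/andP; split; lra.
rewrite add0r; move: h4; rewrite !ler_norml => /andP[h5 h6]; apply/andP; split; lra.
Qed.

End frame_operator.

Lemma cLnorm2_le (R : realType) (d : nat) (h : 'rV[R]_d -> R[i]) (e : R) :
  0 <= e -> (N2 h <= (e ^+ 2)%:E)%E -> (cLnorm 2%:E h <= e%:E)%E.
Proof.
move=> e0; rewrite -cLnorm2_sqr expe2.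
have : (0 <= cLnorm 2%:E h)%E by exact: Lnorm_ge0.
case: (cLnorm 2%:E h) => [r| |//] r0; last by rewrite mulyy.
by rewrite -EFinM !lee_fin -expr2 ler_pXn2r ?nnegrE.
Qed.


Theorem theorem5p7 (R : realType) (d : nat) (d_ge1 : (1 <= d)%N)
    (phi : 'rV[R]_d -> R[i])
    (phi_L1 : cLp 1%:E phi) (phi_L2 : cLp 2%:E phi)
    (mu : R) (mu_gt0 : 0 < mu)
    (a b : R) (a_gt0 : 0 < a) (b_gt0 : 0 < b)
    (Phi_bounds : forall w : 'rV[R]_d,
      (a%:E <= \esum_(pl in @Lambda d) (normc (Phi phi mu pl.1 pl.2 w) ^+ 2)%:E
            <= b%:E)%E)
    (N C : R) (N_gt : 2 * d%:R < N) (C_gt0 : 0 < C)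
    (phi_decay : forall w : 'rV[R]_d,
      normc (fourier phi w) <= C / (1 + enorm w) `^ N) :
  exists A B nu0 : R, [/\ 0 < A, 0 < B, 0 < nu0 &
    exists2 nu : R, 0 < nu < nu0 &
    forall f : 'rV[R]_d -> R[i], cLp 2%:E f ->
    exists2 Sf : 'rV[R]_d -> R[i], is_frame_operator phi mu nu f Sf &
      (A%:E * cLnorm 2%:E f ^+ 2 <= (normc (inner Sf f))%:E
         <= B%:E * cLnorm 2%:E f ^+ 2)%E ].
Proof.
have phi1 := cLp1_cintble phi_L1; have /cLp2E[_ phi2] := phi_L2.
pose K := @farK R d b C * 30 ^+ d * @LambdaC R d.
have K0 : 0 <= K.
  by rewrite !mulr_ge0 ?sqrtr_ge0 ?(ltW C_gt0) ?exprn_ge0.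
(* The three entries ensure [nu ^ d <= nu], cells wide compared with the spread of the frequencies
   of a box, and a total error of at most [a / 2]. *)
pose nu0 := Num.min 1 (Num.min (16 * mu)^-1 (a / 2 / (K + 1))).
have nu0_gt0 : 0 < nu0.
  by rewrite !lt_min ltr01 invr_gt0 mulr_gt0// !divr_gt0// ltr_wpDl.
pose nu := nu0 / 2.
have nu_gt0 : 0 < nu by rewrite divr_gt0.
have nu_lt : nu < nu0 by rewrite /nu gtr_pMr// invf_lt1// ltr1n.
have [nu_le1 nu_le nuK] : [/\ nu <= 1, nu <= (16 * mu)^-1 & nu <= a / 2 / (K + 1)].
  by move: (ltW nu_lt); rewrite /nu0 !le_min => /and3P.
have nu_small : @farK R d b C * 30 ^+ d * @LambdaC R d * nu <= a / 2.
  rewrite -/K; move: nuK; rewrite ler_pdivlMr ?ltr_wpDl// => h; nra.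
pose A := a / 2 * nu ^- d; pose B := (b + a / 2) * nu ^- d.
have nud : 0 < nu ^- d by rewrite invr_gt0 exprn_gt0.
have A0 : 0 < A by rewrite !mulr_gt0.
have B0 : 0 < B by rewrite mulr_gt0// addr_gt0// divr_gt0.
pose psi := atom phi mu nu.
have psiL g : @Gamma d g -> L2 (psi g).
  by case: g => -[p k] l gG; split; [exact: (cintble_atom mu nu phi1 k gG).1|exact: N2_atom_lty].
pose D : set ('rV[R]_d -> R[i]) :=
  [set g | exists M K' h, bounded_in_cube M K' h /\ g = ift h].
have DL g : D g -> L2 g by move=> [M [K' [h [hb ->]]]]; exact: L2_ift hb.
have D_bounds g : D g ->
    (A%:E * N2 g <= frame_sum (@Gamma d) psi g <= B%:E * N2 g)%E.
  move=> [M [K' [h [hb ->]]]]; rewrite (plancherel_ift hb).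
  exact: (frame_sum_ift d_ge1 phi1 mu_gt0 a_gt0 b_gt0 Phi_bounds N_gt C_gt0 phi_decay
    nu_gt0 nu_le nu_le1 nu_small hb).
have D_dense f (e : R) : L2 f -> 0 < e -> exists2 g, D g & n2 (fun x => f x - g x) <= e.
  move=> fL e0; have [M [K' [h [hb he]]]] := ift_dense fL e0.
  by exists (ift h) => //; exists M, K', h.
have B40 : 0 < 4 * B by rewrite mulr_gt0.
have bessel f : L2 f -> (frame_sum (@Gamma d) psi f <= (4 * B)%:E * N2 f)%E.
  exact: (bessel_dense psiL DL (ltW B0) D_bounds D_dense).
(* [A] and [B] bound the frame sum on inverse transforms; the factors 4 are lost in passing to all
   of [L^2] by density. *)
exists (A / 4), (4 * B), nu0; split => //; first by rewrite divr_gt0.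
exists nu; first by rewrite nu_gt0.
move=> f /cLp2E fL.
have [Sf SfL Sf_lim] := frame_operator_L2 psiL B40 bessel fL.
exists Sf; last first.
  rewrite (inner_frame_operator psiL bessel fL SfL Sf_lim) cLnorm2_sqr.
  rewrite (bessel f fL) andbT.
  exact: (frame_lower_dense psiL DL (ltW A0) (ltW B0) D_bounds D_dense).
split; first exact/cLp2E.
(* [is_frame_operator] measures the error by the norm, the limit above by its square: hence the
   tolerance [e ^+ 2]. *)
move=> e e0; have [r [ur rS] hr] := Sf_lim (e ^+ 2) (exprn_gt0 2 e0).
exists [fset g in r]%fset; split; first by move=> g /=; rewrite inE; exact: rS.
move=> F /fsubsetP rF FS.
have sF : sub_index (@Gamma d) (F : seq _) by split; [exact: fset_uniq|exact: FS].
apply: cLnorm2_le; first exact: ltW.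
have dL := L2B SfL (L2_synth psiL (fun g => inner f (psi g)) sF).
rewrite [N2 _](n2E dL) lee_fin; apply: hr => // g gr.
by apply: rF; rewrite inE.
Qed.
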